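(* Let $n\in\mathbb{N}_0$ and $m\in\mathbb{N}$, let $a,b\in\mathbb{R}$ with $b\neq0$, and let $I\subset\mathbb{R}$ be an open interval on which $a+bq>0$. Then, as indefinite integrals in $q$ on $I$ (up to an additive constant), $$\int q^{n}\,\psi^{(m)}(a+bq)\,dq=n!\sum_{j=0}^{n}\frac{(-1)^j}{b^{j+1}(n-j)!}\,q^{n-j}\,\psi^{(m-j-1)}(a+bq),$$ that is, the right-hand side is an antiderivative on $I$ of $q^n\psi^{(m)}(a+bq)$.
   Context: $\mathbb{N}=\{1,2,\dots\}$, $\mathbb{N}_0=\{0,1,2,\dots\}$. The functions $\psi^{(k)}(q)$, $q>0$, are defined for all integers $k$ as follows. $\psi^{(0)}(q)=\psi(q)=\frac{d}{dq}\ln\Gamma(q)$ is the digamma function, and for $k\in\mathbb{N}$, $\psi^{(k)}(q)=\frac{d^k}{dq^k}\psi(q)$ is the polygamma function. For $k\in\mathbb{N}$ the balanced negapolygamma function is $$\psi^{(-k)}(q)=\frac{1}{k!}\left[A_k(q)-H_{k-1}B_k(q)\right],\qquad A_k(q)=k\,\frac{\partial}{\partial z}\zeta(z,q)\Big|_{z=1-k},$$ where $\zeta(z,q)$ is the Hurwitz zeta function ($\zeta(z,q)=\sum_{n\ge0}(n+q)^{-z}$ for $\operatorname{Re}z>1$, analytically continued in $z$ to $\mathbb{C}\setminus\{1\}$), $B_k(q)$ is the $k$-th Bernoulli polynomial, given by $\frac{te^{qt}}{e^t-1}=\sum_{k\ge0}B_k(q)\frac{t^k}{k!}$, and $H_r=\sum_{i=1}^r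 1/i$ is the harmonic number ($H_0=0$). *)

(* Defs.v *)
From Stdlib Require Import Reals ZArith ClassicalEpsilon.
From Coquelicot Require Import Coquelicot.

Open Scope R_scope.

Definition Gamma (q : R) : R :=
  RInt_gen (fun t => Rpower t (q - 1) * exp (- t))
    (at_right 0) (Rbar_locally p_infty).

Definition digamma (q : R) : R := Derive (fun x => ln (Gamma x)) q.

(* [Rcpow r z] is r^z = exp (z ln r), for a real base r > 0. *)
Definition Rcpow (r : R) (z : C) : C :=
  (exp (Re z * ln r) * cos (Im z * ln r),
   exp (Re z * ln r) * sin (Im z * ln r)).

(* Analyticity is local representability by a convergent power series, with
   complex coefficients and complex variable; D is meant to be open. *)
Definition analytic_on (D : C -> Prop) (f : C -> C) : Prop :=
  forall z0 : C, D z0 ->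
    exists c : nat -> C,
      locally z0 (fun z : C => is_pseries c (z - z0)%C (f z)).

Definition is_hurwitz_continuation (q : R) (f : C -> C) : Prop :=
  (forall z : C, 1 < Re z ->
     is_series (fun n : nat => Rcpow (INR n + q) (- z)%C) (f z)) /\
  analytic_on (fun z : C => z <> RtoC 1) f.

(* For q > 0 the continuation is unique on C \ {1}; the value at z = 1 is
   unspecified. *)
Definition hurwitz_zeta (z : C) (q : R) : C :=
  epsilon (inhabits (fun _ : C => RtoC 0)) (is_hurwitz_continuation q) z.

(* The expansion of t e^(qt) / (e^t - 1) in powers of t is only required on
   some punctured neighbourhood of 0, which determines all coefficients. *)
Definition is_bernoulli_seq (q : R) (B : nat -> R) : Prop :=
  locally' 0 (fun t : R =>
    is_pseries (fun k => B k / INR (fact k)) t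
      (t * exp (q * t) / (exp t - 1))).

Definition bernoulli_poly (k : nat) (q : R) : R :=
  epsilon (inhabits (fun _ : nat => 0)) (is_bernoulli_seq q) k.

Definition harmonic (r : nat) : R := sum_n_m (fun i => / INR i) 1 r.

(* The z-derivative is the complex one; for real q > 0 its value at the real
   point 1 - k is real, so [Re] only changes the type. *)
Definition negapolygamma_A (k : nat) (q : R) : R :=
  INR k * Re (C_derive (fun z => hurwitz_zeta z q) (RtoC (1 - INR k))).

Definition negapolygamma (k : nat) (q : R) : R :=
  / INR (fact k) *
  (negapolygamma_A k q - harmonic (k - 1) * bernoulli_poly k q).

(* [polygamma k] is psi^(k), for every integer k. *)
Definition polygamma (k : Z) (q : R) : R :=
  match k with
  | Z0 => digamma q
  | Zpos p => Derive_n digamma (Pos.to_nat p) q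
  | Zneg p => negapolygamma (Pos.to_nat p) q
  end.

(* Main.v *)
Require Import Defs.
From Stdlib Require Import Reals ZArith Lra Lia Psatz ClassicalEpsilon.
From Coquelicot Require Import Coquelicot.

Open Scope R_scope.

(* By repeated integration by parts everything reduces to
   (psi^(k))' = psi^(k+1) for every integer k.

   Let Z(z,q) = (z-1) zeta(z,q).  Around a real centre c > 2 its Taylor
   coefficients in z are explicit series, and
     Z(z,q) = q^(1-z) + (z-1) int_0^1 (1-t) Z(z+1,q+t) dt
   bounds the coefficients at c by those at c + 1, so that the radius of
   convergence, at least c - 1, is at least c - 1 + K for every K.  Hence Z is
   entire, and the identity theorem makes Z(z,q)/(z-1) the unique continuation
   of the Dirichlet series.  Differentiating coefficientwise in q gives
     d/dq Z(x,q) = -(x-1) Z(x+1,q),   Z(x,q+1) = Z(x,q) - (x-1) q^(-x),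
   and the same for the x-derivative Z'.

   The function L(q) = zeta'(0,q) = -Z'(0,q) - Z(0,q) satisfies
   L(q+1) = L(q) + ln q and L'' = Z(2,q) >= 0, so the Bohr-Mollerup argument
   shows that ln Gamma - L is constant; thus psi = -Z'(1,q), and psi is smooth.
   The functions Z(1-k,q) obey the derivative and difference equations of the
   Bernoulli polynomials, whence B_k(q) = Z(1-k,q), and therefore
     psi^(-k)(q) = -(1/k!) (Z'(1-k,q) + H_k Z(1-k,q)),
   an expression that equals psi at k = 0 and whose q-derivative is the same
   expression at k - 1. *)

(** The factor z - 1 removes the pole of zeta, so a single power series about 3 represents the
    function on the whole plane, and 1 becomes an ordinary point at which the z-derivative carries
    the digamma function. Centres stay above 2 because the integration by parts involves the
    Dirichlet series at centre c - 1, which must exceed 1. A q-derivative raises z by one; moving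
    the centre from c to c + 1 as well leaves the local variable z - c fixed, so relations between
    functions become relations between coefficients. Zeta and the Bernoulli polynomials are chosen
    by [epsilon], so each needs existence and uniqueness. Complex arguments serve this and the
    complex derivative; the rest concerns real power series in z with coefficients differentiable in
    q. [digamma] is a bare [Derive] of the logarithm of an improper integral: comparison with an
    explicit smooth function spares differentiation under the integral sign. The harmonic numbers
    are needed because d/dq Z'(1-k,q) leaves an extra multiple of Z(2-k,q), absorbed by H_k -
    H_(k-1) = 1/k. *)

Local Notation is_Cseries := (@is_series C_AbsRing C_NormedModule).
Local Notation is_Cpseries := (@is_pseries C_AbsRing C_NormedModule).

(** * Series of real functions *)

Lemma is_derive_continuity_pt (f : R -> R) (x l : R) :
  is_derive f x l -> continuity_pt f x.
Proof.
  intros H. apply continuity_pt_filterlim, (ex_derive_continuous f). now exists l.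
Qed.

Lemma ex_series_bound (a b : nat -> R) :
  (forall n, Rabs (a n) <= b n) -> ex_series b -> ex_series a.
Proof. intros H; apply (ex_series_le (V := R_CompleteNormedModule)), H. Qed.

Lemma Rabs_Series_le (a b : nat -> R) :
  (forall n, Rabs (a n) <= b n) -> ex_series b -> Rabs (Series a) <= Series b.
Proof.
  intros H Hb.
  assert (Ha : ex_series (fun n => Rabs (a n))).
  { apply ex_series_bound with b; auto. intros n; rewrite Rabs_Rabsolu; apply H. }
  eapply Rle_trans; [apply Series_Rabs, Ha|].
  apply Series_le; auto. intros n; split; [apply Rabs_pos|apply H].
Qed.

Lemma ex_series_nonneg_bounded (a : nat -> R) (M : R) :
  (forall n, 0 <= a n) -> (forall N, sum_n a N <= M) -> ex_series a.
Proof.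
  intros Ha HM.
  destruct (ex_finite_lim_seq_incr (sum_n a) M) as [l Hl]; auto.
  { intros n. rewrite sum_Sn. specialize (Ha (S n)). unfold plus; simpl; lra. }
  exists l; exact Hl.
Qed.

Lemma sum_n_le_Series (a : nat -> R) (N : nat) :
  (forall n, 0 <= a n) -> ex_series a -> sum_n a N <= Series a.
Proof.
  intros Ha Hs.
  apply (is_lim_seq_incr_compare (sum_n a)); [apply (Series_correct _ Hs)|].
  intros n. rewrite sum_Sn. specialize (Ha (S n)). unfold plus; simpl; lra.
Qed.

Lemma Series_tail_small (w : nat -> R) (eps : R) :
  ex_series w -> 0 < eps ->
  exists N, Rabs (Series (fun n => w (S N + n)%nat)) < eps.
Proof.
  intros Hw He.
  assert (H : is_lim_seq (sum_n w) (Series w)) by apply (Series_correct _ Hw).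
  apply is_lim_seq_spec in H.
  destruct (H (mkposreal _ He)) as [N HN]. specialize (HN N (le_n N)). simpl in HN.
  exists N.
  rewrite (Series_incr_n w (S N)) in HN; [|lia|auto].
  simpl Init.Nat.pred in HN. rewrite <- sum_n_Reals in HN.
  match goal with H : Rabs (?a - (?a + ?b)) < _ |- _ =>
    replace (a - (a + b)) with (- b) in H by ring; rewrite Rabs_Ropp in H end.
  exact HN.
Qed.

(** Dominated convergence for series: the tail of [w] bounds everything beyond [N] uniformly in [K],
    and the head is a finite sum of null sequences. *)
Lemma Series_tannery (t : nat -> nat -> R) (w : nat -> R) :
  ex_series w -> (forall n K, Rabs (t n K) <= w n) ->
  (forall n, is_lim_seq (t n) 0) ->
  is_lim_seq (fun K => Series (fun n => t n K)) 0.
Proof.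
  intros Hw Ht Hl.
  apply is_lim_seq_spec. intros [eps He]; simpl.
  destruct (Series_tail_small w (eps / 2) Hw) as [N HN]; [lra|].
  assert (Hfin : is_lim_seq (fun K => sum_n (fun n => t n K) N) 0).
  { clear HN. induction N.
    - apply is_lim_seq_ext with (t 0%nat); auto. intros K; now rewrite sum_O.
    - apply is_lim_seq_ext with (fun K => sum_n (fun n => t n K) N + t (S N) K).
      { intros K; now rewrite sum_Sn. }
      replace (Finite 0) with (Finite (0 + 0)) by (f_equal; ring).
      apply is_lim_seq_plus'; auto. }
  apply is_lim_seq_spec in Hfin.
  assert (He2 : 0 < eps / 2) by lra.
  destruct (Hfin (mkposreal _ He2)) as [K0 HK0]; simpl in HK0.
  exists K0; intros K HK. specialize (HK0 K HK).
  rewrite (Series_incr_n (fun n => t n K) (S N)); [|lia|].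
  2:{ apply ex_series_bound with w; auto. }
  simpl Init.Nat.pred. rewrite <- sum_n_Reals.
  assert (Rabs (Series (fun k => t (S N + k)%nat K)) <= Series (fun k => w (S N + k)%nat)).
  { apply Rabs_Series_le. intros; apply Ht. now apply -> (ex_series_incr_n w). }
  pose proof (Rle_abs (Series (fun k => w (S N + k)%nat))).
  rewrite Rminus_0_r in HK0 |- *.
  eapply Rle_lt_trans; [apply Rabs_triang|]. lra.
Qed.

Lemma is_series_sum_n (u : nat -> nat -> R) (l : nat -> R) (K : nat) :
  (forall k, is_series (fun n => u n k) (l k)) ->
  is_series (fun n => sum_n (u n) K) (sum_n l K).
Proof.
  intros H. induction K.
  - rewrite sum_O. eapply is_series_ext; [|apply H]. intros n; now rewrite sum_O.
  - rewrite sum_Sn. eapply is_series_ext.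
    2:{ apply (is_series_plus (V := R_NormedModule) (fun n => sum_n (u n) K)
          (fun n => u n (S K))); [apply IHK|apply H]. }
    intros n; now rewrite sum_Sn.
Qed.

(** Fubini under a bound [w] on the absolute row sums. Finite sums over [k] pass through the sum
    over [n]; what they miss in row [n] is at most [w n + w n] and tends to 0, so [Series_tannery]
    applies. *)
Lemma Series_swap (u : nat -> nat -> R) (w : nat -> R) :
  ex_series w -> (forall n K, sum_n (fun k => Rabs (u n k)) K <= w n) ->
  is_series (fun k => Series (fun n => u n k)) (Series (fun n => Series (u n))).
Proof.
  intros Hw Hu.
  assert (Hrow : forall n, ex_series (fun k => Rabs (u n k))).
  { intros n. apply ex_series_nonneg_bounded with (w n); auto. intros; apply Rabs_pos. }
  assert (Hent : forall n k, Rabs (u n k) <= w n).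
  { intros n k. eapply Rle_trans; [|apply (Hu n k)].
    destruct k. rewrite sum_O; lra. rewrite sum_Sn.
    assert (0 <= sum_n (fun k => Rabs (u n k)) k).
    { rewrite sum_n_Reals. apply cond_pos_sum. intros; apply Rabs_pos. }
    unfold plus; simpl; lra. }
  assert (Hpart : forall n K, Rabs (sum_n (u n) K) <= w n).
  { intros n K. eapply Rle_trans; [|apply (Hu n K)].
    rewrite !sum_n_Reals. apply Rsum_abs. }
  assert (HS : forall n, Rabs (Series (u n)) <= w n).
  { intros n. eapply Rle_trans; [apply Series_Rabs, Hrow|].
    pose proof (Series_correct _ (Hrow n)) as H.
    apply (is_lim_seq_le (sum_n (fun k => Rabs (u n k))) (fun _ => w n)
      (Series (fun k => Rabs (u n k))) (w n)); auto.
    apply is_lim_seq_const. }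
  assert (Hcol : forall k, ex_series (fun n => u n k)).
  { intros k. apply ex_series_bound with w; auto. }
  assert (Hlim : is_lim_seq
    (fun K => Series (fun n => sum_n (u n) K - Series (u n))) 0).
  { apply Series_tannery with (fun n => w n + w n).
    - apply (ex_series_plus w w); auto.
    - intros n K. unfold Rminus. eapply Rle_trans; [apply Rabs_triang|].
      rewrite Rabs_Ropp. apply Rplus_le_compat; auto.
    - intros n. replace (Finite 0) with (Finite (Series (u n) - Series (u n))) by (f_equal; ring).
      apply is_lim_seq_minus'; [|apply is_lim_seq_const].
      apply (Series_correct _ (ex_series_Rabs _ (Hrow n))). }
  change (is_lim_seq (sum_n (fun k => Series (fun n => u n k)))
    (Series (fun n => Series (u n)))).
  apply (is_lim_seq_ext (fun K => Series (fun n => Series (u n)) +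
     Series (fun n => sum_n (u n) K - Series (u n)))).
  - intros K.
    assert (HK : is_series (fun n => sum_n (u n) K) (sum_n (fun k => Series (fun n => u n k)) K)).
    { apply is_series_sum_n. intros k; apply Series_correct, Hcol. }
    rewrite Series_minus.
    + rewrite (is_series_unique _ _ HK). ring.
    + eexists; apply HK.
    + apply ex_series_bound with w; auto.
  - replace (Finite (Series (fun n => Series (u n)))) with
      (Finite (Series (fun n => Series (u n)) + 0)) by (f_equal; ring).
    apply is_lim_seq_plus'; [apply is_lim_seq_const|auto].
Qed.

(** A quadratic remainder, unlike a little-o, can be added up over a series and is inherited from a
    complex remainder by taking real parts; both uses occur below. *)
Lemma is_derive_of_quadratic_bound (f : R -> R) (q l M d : R) :
  0 < d ->
  (forall x, Rabs (x - q) < d -> Rabs (f x - f q - l * (x - q)) <= M * (x - q) ^ 2) ->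
  is_derive f q l.
Proof.
  intros Hd H. apply is_derive_Reals. intros eps He.
  (* [M] may be zero or negative, hence the later division by [Rabs M + 1]. *)
  assert (HM : 0 < Rabs M + 1) by (pose proof (Rabs_pos M); lra).
  assert (Hdel : 0 < Rmin d (eps / (Rabs M + 1))).
  { apply Rmin_pos; auto. apply Rdiv_lt_0_compat; lra. }
  exists (mkposreal _ Hdel). simpl. intros h Hh0 Hh.
  assert (H1 : Rabs h < d) by (eapply Rlt_le_trans; [apply Hh|apply Rmin_l]).
  assert (H2 : Rabs h < eps / (Rabs M + 1)) by (eapply Rlt_le_trans; [apply Hh|apply Rmin_r]).
  specialize (H (q + h)). replace (q + h - q) with h in H by ring. specialize (H H1).
  replace ((f (q + h) - f q) / h - l) with ((f (q + h) - f q - l * h) / h) by (field; auto).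
  assert (Hp : 0 < Rabs h) by (apply Rabs_pos_lt; auto).
  rewrite Rabs_div by auto.
  apply Rmult_lt_reg_r with (Rabs h); auto.
  unfold Rdiv at 1. rewrite Rmult_assoc, Rinv_l, Rmult_1_r by lra.
  eapply Rle_lt_trans; [apply H|].
  rewrite <- (pow2_abs h).
  pose proof (Rle_abs M).
  assert (H2' : Rabs h * (Rabs M + 1) < eps).
  { apply (Rmult_lt_compat_r (Rabs M + 1)) in H2; auto.
    unfold Rdiv in H2. rewrite Rmult_assoc, Rinv_l, Rmult_1_r in H2; lra. }
  nra.
Qed.

(** Two applications of the mean value theorem, to [f] up to [x] and to [g] up to the intermediate
    point, give the constant [M] instead of [M / 2]. *)
Lemma taylor1_bound (f g h : R -> R) (M q d x : R) :
  Rabs (x - q) < d ->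
  (forall y, Rabs (y - q) < d -> is_derive f y (g y)) ->
  (forall y, Rabs (y - q) < d -> is_derive g y (h y)) ->
  (forall y, Rabs (y - q) < d -> Rabs (h y) <= M) ->
  Rabs (f x - f q - g q * (x - q)) <= M * (x - q) ^ 2.
Proof.
  intros Hx Hf Hg Hh.
  assert (Hin : forall z y, Rabs (z - q) < d -> Rmin q z <= y <= Rmax q z ->
     Rabs (y - q) < d /\ Rabs (y - q) <= Rabs (z - q)).
  { intros z y Hz. unfold Rmin, Rmax. destruct (Rle_dec q z);
    revert Hz; unfold Rabs; repeat destruct Rcase_abs; lra. }
  destruct (MVT_gen f q x g) as [xi [Hxi E]].
  { intros y Hy. apply Hf. apply (Hin x); auto; lra. }
  { intros y Hy. eapply is_derive_continuity_pt; apply Hf.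
    apply (Hin x); auto. }
  destruct (Hin x xi Hx Hxi) as [Hxi1 Hxi2].
  destruct (MVT_gen g q xi h) as [eta [Heta E2]].
  { intros y Hy. apply Hg. apply (Hin xi); auto; lra. }
  { intros y Hy. eapply is_derive_continuity_pt; apply Hg.
    apply (Hin xi); auto. }
  destruct (Hin xi eta Hxi1 Heta) as [He1 He2].
  rewrite E.
  replace (g xi * (x - q) - g q * (x - q)) with ((h eta * (xi - q)) * (x - q)) by (rewrite <- E2; ring).
  rewrite !Rabs_mult. rewrite <- (pow2_abs (x - q)).
  specialize (Hh eta He1).
  pose proof (Rabs_pos (h eta)). pose proof (Rabs_pos (xi - q)). pose proof (Rabs_pos (x - q)).
  assert (Rabs (h eta) * Rabs (xi - q) <= M * Rabs (x - q)).
  { apply Rmult_le_compat; auto. }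
  nra.
Qed.

(** The first-order remainders of the terms are at most [M n * (x - q) ^ 2] by [taylor1_bound], so
    they sum to a quadratic remainder of the whole series. *)
Lemma is_derive_Series (f g h : nat -> R -> R) (M : nat -> R) (q d : R) :
  0 < d -> ex_series M ->
  (forall n y, Rabs (y - q) < d -> is_derive (f n) y (g n y)) ->
  (forall n y, Rabs (y - q) < d -> is_derive (g n) y (h n y)) ->
  (forall n y, Rabs (y - q) < d -> Rabs (h n y) <= M n) ->
  (forall y, Rabs (y - q) < d -> ex_series (fun n => f n y)) ->
  ex_series (fun n => g n q) ->
  is_derive (fun x => Series (fun n => f n x)) q (Series (fun n => g n q)).
Proof.
  intros Hd HM Hf Hg Hh Sf Sg.
  apply is_derive_of_quadratic_bound with (M := Series M) (d := d); auto.
  intros x Hx.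
  assert (Hq : Rabs (q - q) < d) by (rewrite Rminus_diag, Rabs_R0; auto).
  rewrite <- Series_minus by auto.
  rewrite <- Series_scal_r.
  rewrite <- Series_minus.
  2:{ apply (ex_series_minus (fun n => f n x)); auto. }
  2:{ apply ex_series_scal_r; auto. }
  rewrite <- Series_scal_r.
  apply Rabs_Series_le.
  - intros n. apply taylor1_bound with (h n) d; auto.
  - apply ex_series_scal_r; auto.
Qed.

(** * Real powers and the p-series *)

Lemma Rpower_pos (x y : R) : 0 < Rpower x y.
Proof. apply exp_pos. Qed.

Lemma is_derive_Rpower (x y : R) :
  0 < x -> is_derive (fun t => Rpower t y) x (y * Rpower x (y - 1)).
Proof. intros Hx. apply is_derive_Reals. now apply derivable_pt_lim_power. Qed.

Lemma Rpower_le_neg (x y p : R) : 0 < x <= y -> 0 <= p -> Rpower y (- p) <= Rpower x (- p).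
Proof.
  intros H Hp. unfold Rpower. 
  destruct (Rle_lt_or_eq_dec x y) as [Hxy|Hxy]; [lra| |subst; lra].
  pose proof (ln_increasing x y ltac:(lra) Hxy).
  destruct (Req_dec (-p * ln y) (- p * ln x)) as [->|Hn]; [lra|].
  left; apply exp_increasing. nra.
Qed.

Lemma ex_series_Rpower (p : R) :
  1 < p -> ex_series (fun n => Rpower (INR n + 1) (- p)).
Proof.
  intros Hp. apply ex_series_incr_1.
  apply ex_series_nonneg_bounded with (1 / (p - 1)).
  { intros; left; apply Rpower_pos. }
  (* The mean value theorem for t^(1-p) on [n+1, n+2] compares each term with a telescoping
     difference, as the integral test would. *)
  assert (Hstep : forall n, Rpower (INR (S n) + 1) (- p) <=
     1 / (p - 1) * (Rpower (INR n + 1) (1 - p) - Rpower (INR (S n) + 1) (1 - p))).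
  { intros n. pose proof (pos_INR n). rewrite S_INR.
    destruct (MVT_gen (fun t => Rpower t (1 - p)) (INR n + 1) (INR n + 1 + 1)
      (fun t => (1 - p) * Rpower t (1 - p - 1))) as [xi [Hxi E]].
    { intros y Hy. apply is_derive_Rpower. unfold Rmin in Hy; destruct Rle_dec; lra. }
    { intros y Hy. eapply is_derive_continuity_pt, is_derive_Rpower. unfold Rmin in Hy; destruct Rle_dec; lra. }
    unfold Rmin, Rmax in Hxi; destruct Rle_dec in Hxi; [|lra].
    replace (1 - p - 1) with (- p) in E by ring.
    assert (Rpower (INR n + 1 + 1) (- p) <= Rpower xi (- p)) by (apply Rpower_le_neg; lra).
    replace (Rpower (INR n + 1) (1 - p) - Rpower (INR n + 1 + 1) (1 - p))
      with ((p - 1) * Rpower xi (- p)) by lra.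
    replace (1 / (p - 1) * ((p - 1) * Rpower xi (- p))) with (Rpower xi (-p)) by (field; lra).
    auto. }
  intros N.
  assert (Hle : sum_n (fun n => Rpower (INR (S n) + 1) (- p)) N <=
    1 / (p - 1) * (1 - Rpower (INR (S N) + 1) (1 - p))).
  { induction N.
    - rewrite sum_O. eapply Rle_trans; [apply Hstep|].
      simpl INR at 1. rewrite Rplus_0_l.
      assert (E : Rpower 1 (1 - p) = 1) by (unfold Rpower; rewrite ln_1, Rmult_0_r; apply exp_0).
      rewrite E. lra.
    - rewrite sum_Sn. unfold plus; simpl AbelianMonoid.plus.
      pose proof (Hstep (S N)). simpl in IHN, H |- *. lra. }
  eapply Rle_trans; [apply Hle|].
  pose proof (Rpower_pos (INR (S N) + 1) (1 - p)).
  assert (0 < 1 / (p - 1)) by (apply Rdiv_lt_0_compat; lra).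
  nra.
Qed.

(** * Taylor coefficients of the Hurwitz zeta function *)

(* The coefficient of [(z - c)^k] in [x^(-z)]. *)
Definition pcoef (c : R) (k : nat) (x : R) : R :=
  Rpower x (- c) * (- ln x) ^ k / INR (fact k).

(* Multiplication by [z] on Taylor coefficients at the centre [c]. *)
Definition mulz (c : R) (u : nat -> R) (k : nat) : R :=
  c * u k + match k with O => 0 | S j => u j end.

(* [hcoef] and [zcoef] are the coefficients of [(z - c)^k] in zeta(z,q) and in
   (z - 1) zeta(z,q); both need [1 < c]. *)
Definition hcoef (c : R) (k : nat) (q : R) : R :=
  Series (fun n => pcoef c k (INR n + q)).

Definition zcoef (c : R) (k : nat) (q : R) : R :=
  mulz (c - 1) (fun j => hcoef c j q) k.

Lemma INR_fact_pos (k : nat) : 0 < INR (fact k).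
Proof. apply lt_0_INR, lt_O_fact. Qed.

Lemma pcoef_derive (c : R) (k : nat) (x : R) :
  0 < x -> is_derive (pcoef c k) x (- mulz c (fun j => pcoef (c + 1) j x) k).
Proof.
  intros Hx. unfold pcoef, mulz.
  assert (Hf := INR_fact_neq_0).
  assert (E : Rpower x (- (c + 1)) = Rpower x (- c) / x).
  { replace (- (c + 1)) with (- c + Ropp 1) by ring.
    rewrite Rpower_plus, (Rpower_Ropp x 1), Rpower_1; auto. }
  assert (Hl := is_derive_ln x Hx).
  assert (Hp := is_derive_Rpower x (- c) Hx).
  assert (E' : Rpower x (- c - 1) = Rpower x (- c) / x).
  { unfold Rminus. rewrite Rpower_plus, (Rpower_Ropp x 1), Rpower_1; auto. }
  rewrite E' in Hp.
  destruct k as [|k].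
  - apply is_derive_ext with (fun t => Rpower t (- c)).
    { intros t; simpl. field. }
    replace (- (c * (Rpower x (- (c + 1)) * (- ln x) ^ 0 / INR (fact 0)) + 0))
      with (- c * (Rpower x (- c) / x)); auto.
    rewrite E. simpl. field. lra.
  - assert (Hq : is_derive (fun t => (- ln t) ^ S k) x (INR (S k) * - / x * (- ln x) ^ k)).
    { apply (is_derive_pow (fun t => - ln t) (S k) x (- / x)).
      apply (is_derive_opp ln x (/ x)); auto. }
    pose proof (is_derive_mult (fun t => Rpower t (- c)) (fun t => (- ln t) ^ S k) x _ _ Hp Hq Rmult_comm) as H.
    apply (is_derive_scal _ _ (/ INR (fact (S k)))) in H.
    eapply is_derive_ext; [|
      match type of H with is_derive _ _ ?l => replace (- _) with l; [apply H|] end].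
    + intros t; simpl. unfold mult, Rdiv; simpl. ring.
    + rewrite E. unfold plus, mult; simpl AbelianMonoid.plus; simpl Ring.mult.
      rewrite fact_simpl, mult_INR. simpl pow.
      change (match k with O => 1 | S _ => INR k + 1 end) with (INR (S k)).
      field. repeat split; auto; try lra. apply not_0_INR; lia.
Qed.

Lemma pow_div_fact_le_exp (L : R) (k : nat) : 0 <= L -> L ^ k / INR (fact k) <= exp L.
Proof.
  intros HL.
  assert (H := is_exp_Reals L). apply is_pseries_R in H.
  rewrite <- (is_series_unique _ _ H).
  eapply Rle_trans; [|apply (sum_n_le_Series _ k)].
  - destruct k.
    + rewrite sum_O. simpl. lra.
    + rewrite sum_n_Reals, tech5. unfold Rdiv. rewrite (Rmult_comm (L ^ S k)).
      match goal with |- _ <= ?S + _ => assert (0 <= S); [|lra] end.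
      apply cond_pos_sum. intros n.
      apply Rmult_le_pos; [left; apply Rinv_0_lt_compat, INR_fact_pos|apply pow_le; auto].
  - intros n. apply Rmult_le_pos; [left; apply Rinv_0_lt_compat, INR_fact_pos|apply pow_le; auto].
  - eexists; apply H.
Qed.

(** A Cauchy estimate without contours: [Y] dominates [u] and [/ u], so [Rabs (ln u) <= ln Y], and
    (r ln Y)^k / k! is a single term of the series of exp(r ln Y) = Y^r. *)
Lemma pcoef_bound (c r x Y u : R) (k : nat) :
  0 <= c -> 0 <= r -> 0 < x -> 1 <= Y -> / x <= Y -> x <= u <= Y ->
  Rabs (pcoef c k u) * r ^ k <= Rpower x (- c) * Rpower Y r.
Proof.
  intros Hc Hr Hx HY HxY Hu. unfold pcoef, Rdiv.
  assert (HL : 0 <= ln Y) by (rewrite <- ln_1; apply ln_le; lra).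
  assert (Habs : Rabs (- ln u) <= ln Y).
  { rewrite Rabs_Ropp. apply Rabs_le. split.
    - assert (ln (/ u) <= ln Y).
      { apply ln_le. apply Rinv_0_lt_compat; lra.
        apply Rle_trans with (/ x); auto. apply Rinv_le_contravar; lra. }
      rewrite ln_Rinv in H by lra. lra.
    - apply ln_le; lra. }
  rewrite !Rabs_mult, <- RPow_abs.
  rewrite (Rabs_pos_eq (Rpower _ _)) by (left; apply Rpower_pos).
  rewrite (Rabs_pos_eq (/ _)) by (left; apply Rinv_0_lt_compat, INR_fact_pos).
  assert (Hmain : Rabs (- ln u) ^ k * / INR (fact k) * r ^ k <= Rpower Y r).
  { apply Rle_trans with ((r * ln Y) ^ k / INR (fact k)).
    - rewrite Rpow_mult_distr. unfold Rdiv.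
      assert (Rabs (- ln u) ^ k <= ln Y ^ k) by (apply pow_incr; split; auto; apply Rabs_pos).
      assert (0 <= / INR (fact k) * r ^ k).
      { apply Rmult_le_pos; [left; apply Rinv_0_lt_compat, INR_fact_pos|apply pow_le; auto]. }
      nra.
    - apply pow_div_fact_le_exp. nra. }
  assert (Rpower u (- c) <= Rpower x (- c)) by (apply Rpower_le_neg; lra).
  rewrite !Rmult_assoc in *.
  apply Rmult_le_compat; auto.
  - left; apply Rpower_pos.
  - repeat apply Rmult_le_pos; [apply pow_le, Rabs_pos|left; apply Rinv_0_lt_compat, INR_fact_pos|apply pow_le; auto].
Qed.

Lemma Rpower_mult_base (x y p : R) : 0 < x -> 0 < y -> Rpower (x * y) p = Rpower x p * Rpower y p.
Proof.
  intros Hx Hy. unfold Rpower. rewrite ln_mult by auto.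
  rewrite <- exp_plus. f_equal; ring.
Qed.

(** Up to a constant, (n+x)^(-c) (n+Y)^r behaves like (n+1)^(-(c-r)): the radius [r] costs [r]
    powers of [n], and summability for r < c - 1 reflects the pole at distance c - 1. *)
Lemma pcoef_shift_bound (c r x y : R) :
  0 <= r <= c -> 0 < x <= y ->
  exists C, 0 <= C /\ forall n k q, x <= q <= y ->
    Rabs (pcoef c k (INR n + q)) * r ^ k <= C * Rpower (INR n + 1) (- (c - r)).
Proof.
  intros Hr Hx.
  (* [Y] exceeds [y], 1 and [/ x], so [INR n + Y] meets the demands of [pcoef_bound] for every [n];
     [Y / x] is the largest ratio of [INR n + Y] to [INR n + x]. *)
  set (Y := y + 1 + / x).
  assert (Hix : 0 < / x) by (apply Rinv_0_lt_compat; lra).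
  assert (HYx : 0 < Y / x) by (apply Rdiv_lt_0_compat; unfold Y; lra).
  exists (Rpower (Y / x) c). split; [left; apply Rpower_pos|].
  intros n k q Hq. pose proof (pos_INR n) as Hn.
  eapply Rle_trans; [apply (pcoef_bound c r (INR n + x) (INR n + Y))|]; try lra.
  - unfold Y; lra.
  - apply Rle_trans with (/ x). apply Rinv_le_contravar; lra. unfold Y; lra.
  - unfold Y; lra.
  - assert (H1 : Rpower (INR n + x) (- c) <= Rpower (Y / x) c * Rpower (INR n + Y) (- c)).
    { apply Rle_trans with (Rpower (/ (Y / x) * (INR n + Y)) (- c)).
      - apply Rpower_le_neg; [|lra]. split.
        + apply Rmult_lt_0_compat; [apply Rinv_0_lt_compat; auto| unfold Y; lra].
        + apply Rmult_le_reg_l with (Y / x); auto. rewrite <- Rmult_assoc, Rinv_r, Rmult_1_l by lra.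
          replace (Y / x * (INR n + x)) with (Y / x * INR n + Y) by (field; lra).
          assert (1 <= Y / x). { apply Rmult_le_reg_r with x; [lra|].
            unfold Rdiv; rewrite Rmult_assoc, Rinv_l; unfold Y; lra. }
          nra.
      - right. rewrite Rpower_mult_base.
        + f_equal. rewrite Rpower_Ropp. unfold Rpower.
          rewrite ln_Rinv by auto. rewrite <- exp_Ropp. f_equal; ring.
        + apply Rinv_0_lt_compat; auto.
        + unfold Y; lra. }
    assert (H2 : Rpower (INR n + Y) (- c) * Rpower (INR n + Y) r <= Rpower (INR n + 1) (- (c - r))).
    { rewrite <- Rpower_plus. replace (- c + r) with (- (c - r)) by ring.
      apply Rpower_le_neg; unfold Y; lra. }
    pose proof (Rpower_pos (Y / x) c). pose proof (Rpower_pos (INR n + Y) r).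
    apply Rle_trans with (Rpower (Y / x) c * Rpower (INR n + Y) (- c) * Rpower (INR n + Y) r).
    + apply Rmult_le_compat_r; [lra|auto].
    + rewrite Rmult_assoc. apply Rmult_le_compat_l; [lra|auto].
Qed.

(** On the circle of radius [r] about [c] the factor z has modulus at most [Rabs c + r]. *)
Lemma mulz_bound (c r B : R) (u : nat -> R) (k : nat) :
  0 <= r -> (forall j, Rabs (u j) * r ^ j <= B) ->
  Rabs (mulz c u k) * r ^ k <= (Rabs c + r) * B.
Proof.
  intros Hr Hu. unfold mulz.
  assert (HB : 0 <= B).
  { eapply Rle_trans; [|apply (Hu 0%nat)]. apply Rmult_le_pos; [apply Rabs_pos|simpl; lra]. }
  pose proof (pow_le r k Hr).
  eapply Rle_trans; [apply Rmult_le_compat_r; [auto|apply Rabs_triang]|].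
  rewrite Rmult_plus_distr_r, Rmult_plus_distr_r. apply Rplus_le_compat.
  - rewrite Rabs_mult, Rmult_assoc. apply Rmult_le_compat_l; auto. apply Rabs_pos.
  - destruct k as [|k].
    + rewrite Rabs_R0. nra.
    + simpl. specialize (Hu k). nra.
Qed.

(** The radius (c-1)/2 leaves the exponent c - (c-1)/2 = (c+1)/2, which exceeds 1. *)
Lemma pcoef_series_bound (c x y : R) :
  1 < c -> 0 < x <= y ->
  exists w, ex_series w /\ forall n k q, x <= q <= y ->
    Rabs (pcoef c k (INR n + q)) * ((c - 1) / 2) ^ k <= w n.
Proof.
  intros Hc Hx.
  destruct (pcoef_shift_bound c ((c - 1) / 2) x y) as [C [HC H]]; [lra|auto|].
  exists (fun n => C * Rpower (INR n + 1) (- (c - (c - 1) / 2))). split; auto.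
  apply (ex_series_scal_l (V := R_NormedModule) C). apply ex_series_Rpower. lra.
Qed.

Lemma Rle_of_scaled (a b r : R) : 0 < r -> a * r <= b -> a <= b * / r.
Proof.
  intros Hr H. apply Rmult_le_reg_r with r; auto. rewrite Rmult_assoc, Rinv_l, Rmult_1_r; lra.
Qed.

Lemma pcoef_ex_series (c q : R) (k : nat) :
  1 < c -> 0 < q -> ex_series (fun n => pcoef c k (INR n + q)).
Proof.
  intros Hc Hq. destruct (pcoef_series_bound c q q Hc ltac:(lra)) as [w [Hw H]].
  apply ex_series_bound with (fun n => w n * / ((c - 1) / 2) ^ k).
  - intros n. apply Rle_of_scaled. apply pow_lt; lra. apply H; lra.
  - now apply ex_series_scal_r.
Qed.

Lemma is_series_mulz (c : R) (u : nat -> nat -> R) (l : nat -> R) (k : nat) :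
  (forall j, is_series (fun n => u n j) (l j)) ->
  is_series (fun n => mulz c (u n) k) (mulz c l k).
Proof.
  intros H. unfold mulz.
  apply (is_series_plus (V := R_NormedModule)).
  - apply (is_series_scal_l (V := R_NormedModule) c (fun n => u n k)). apply H.
  - destruct k; [|apply H].
    apply filterlim_ext with (fun _ => 0).
    { intros n. rewrite sum_n_const. ring. }
    apply filterlim_const.
Qed.

Lemma mulz_opp (c : R) (u : nat -> R) (k : nat) :
  mulz c (fun j => - u j) k = - mulz c u k.
Proof. unfold mulz; destruct k; ring. Qed.

Lemma is_derive_mulz (c : R) (f : nat -> R -> R) (l : nat -> R) (k : nat) (x : R) :
  (forall j, is_derive (f j) x (l j)) ->
  is_derive (fun t => mulz c (fun j => f j t) k) x (mulz c l k).
Proof.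
  intros H. unfold mulz.
  apply (is_derive_plus (fun t => c * f k t)).
  - apply (is_derive_scal (f k)), H.
  - destruct k; [apply (is_derive_const (V := R_NormedModule) 0)|apply H].
Qed.

(** Coefficient form of d/dq zeta(z,q) = -z zeta(z+1,q); at the centre c + 1 the local variable of z
    + 1 is again z - c. *)
Lemma hcoef_derive (c q : R) (k : nat) :
  1 < c -> 0 < q ->
  is_derive (hcoef c k) q (- mulz c (fun j => hcoef (c + 1) j q) k).
Proof.
  intros Hc Hq.
  assert (Hd : 0 < q / 2) by lra.
  assert (Hpos : forall n y, Rabs (y - q) < q / 2 -> 0 < INR n + y /\ q / 2 <= y <= 2 * q).
  { intros n y Hy. pose proof (pos_INR n). apply Rabs_def2 in Hy. lra. }
  assert (Hq0 : Rabs (q - q) < q / 2) by (rewrite Rminus_diag, Rabs_R0; auto).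
  (* Second derivatives of the terms live at the centre c + 2; for [y] within [q / 2] of [q] they
     are dominated by one summable [w], up to the two factors of [mulz_bound]. *)
  destruct (pcoef_series_bound (c + 1 + 1) (q / 2) (2 * q)) as [w [Hw Hb]]; [lra|lra|].
  set (r := (c + 1 + 1 - 1) / 2) in Hb.
  assert (Hr : 0 < r) by (unfold r; lra).
  assert (HS : is_series (fun n => - mulz c (fun j => pcoef (c + 1) j (INR n + q)) k)
     (- mulz c (fun j => hcoef (c + 1) j q) k)).
  { apply (is_series_opp (V := R_NormedModule)).
    apply is_series_mulz. intros j. apply Series_correct, pcoef_ex_series; lra. }
  rewrite <- (is_series_unique _ _ HS).
  apply (is_derive_Series (fun n y => pcoef c k (INR n + y))
    (fun n y => - mulz c (fun j => pcoef (c + 1) j (INR n + y)) k)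
    (fun n y => mulz c (mulz (c + 1) (fun j => pcoef (c + 1 + 1) j (INR n + y))) k)
    (fun n => (Rabs c + r) * ((Rabs (c + 1) + r) * w n) * / r ^ k) q (q / 2)); auto.
  - apply ex_series_scal_r.
    apply (ex_series_scal_l (V := R_NormedModule) (Rabs c + r)).
    apply (ex_series_scal_l (V := R_NormedModule) (Rabs (c + 1) + r)); auto.
  - intros n y Hy. destruct (Hpos n y Hy) as [H1 _].
    assert (He := pcoef_derive c k _ H1).
    apply (is_derive_comp (pcoef c k) (fun y => INR n + y) y _ 1) in He.
    + unfold scal in He; simpl in He; unfold mult in He; simpl in He. rewrite Rmult_1_l in He. exact He.
    + auto_derive; auto.
  - intros n y Hy. destruct (Hpos n y Hy) as [H1 _].
    replace (mulz c (mulz (c + 1) (fun j => pcoef (c + 1 + 1) j (INR n + y))) k)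
      with (- mulz c (fun k => - mulz (c + 1) (fun j => pcoef (c + 1 + 1) j (INR n + y)) k) k).
    2:{ rewrite (mulz_opp c (mulz (c+1) _)). ring. }
    apply (is_derive_opp (fun y => mulz c (fun j => pcoef (c + 1) j (INR n + y)) k)).
    apply (is_derive_mulz c (fun j y => pcoef (c + 1) j (INR n + y))). intros j.
    assert (He := pcoef_derive (c + 1) j _ H1).
    apply (is_derive_comp (pcoef (c + 1) j) (fun y => INR n + y) y _ 1) in He.
    + unfold scal in He; simpl in He; unfold mult in He; simpl in He. rewrite Rmult_1_l in He. exact He.
    + auto_derive; auto.
  - intros n y Hy. destruct (Hpos n y Hy) as [H1 H2].
    apply Rle_of_scaled. apply pow_lt; auto.
    apply mulz_bound; [lra|]. intros j. apply mulz_bound; [lra|]. intros i. apply Hb; auto.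
  - intros y Hy. destruct (Hpos 0%nat y Hy) as [H1 H2]. apply pcoef_ex_series; lra.
  - eexists; apply HS.
Qed.

(** Radius of convergence at least [rho], uniformly for [q] in compact subintervals of the positive
    axis. Boundedness of terms is easier to carry through [mulz] and the mean value step than
    convergence. *)
Definition loc_bdd (rho : R) (a : nat -> R -> R) : Prop :=
  forall r x y, 0 <= r < rho -> 0 < x <= y ->
  exists B, forall k q, x <= q <= y -> Rabs (a k q) * r ^ k <= B.

Lemma loc_bdd_mulz (rho c : R) (a : nat -> R -> R) :
  loc_bdd rho a -> loc_bdd rho (fun k q => mulz c (fun j => a j q) k).
Proof.
  intros H r x y Hr Hx. destruct (H r x y Hr Hx) as [B HB].
  exists ((Rabs c + r) * B). intros k q Hq. apply mulz_bound; [lra|]. intros; now apply HB.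
Qed.

(** [c - 1] is the distance from the centre to the pole. *)
Lemma loc_bdd_hcoef (c : R) : 1 < c -> loc_bdd (c - 1) (hcoef c).
Proof.
  intros Hc r x y Hr Hx.
  destruct (pcoef_shift_bound c r x y) as [C [HC H]]; [lra|auto|].
  exists (Series (fun n => C * Rpower (INR n + 1) (- (c - r)))).
  intros k q Hq.
  rewrite <- (Rabs_pos_eq (r ^ k)) by (apply pow_le; lra).
  rewrite <- Rabs_mult. unfold hcoef. rewrite <- Series_scal_r.
  apply Rabs_Series_le.
  - intros n. rewrite Rabs_mult, (Rabs_pos_eq (r ^ k)) by (apply pow_le; lra). now apply H.
  - apply (ex_series_scal_l (V := R_NormedModule) C). apply ex_series_Rpower. lra.
Qed.

(** The factor z produced by [hcoef_derive] equals (z+1) - 1 and completes zeta(z+1,q) to Z(z+1,q),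
    so the family [zcoef] is closed under d/dq. *)
Lemma zcoef_derive (c q : R) (k : nat) :
  1 < c -> 0 < q ->
  is_derive (zcoef c k) q (- mulz (c - 1) (fun j => zcoef (c + 1) j q) k).
Proof.
  intros Hc Hq. rewrite <- mulz_opp.
  apply (is_derive_mulz (c - 1) (hcoef c)). intros j.
  replace (zcoef (c + 1) j q) with (mulz c (fun i => hcoef (c + 1) i q) j).
  - now apply hcoef_derive.
  - unfold zcoef. f_equal. ring.
Qed.

Lemma hcoef_shift (c q : R) (k : nat) :
  1 < c -> 0 < q -> hcoef c k (q + 1) = hcoef c k q - pcoef c k q.
Proof.
  intros Hc Hq. unfold hcoef.
  rewrite (Series_incr_1 (fun n => pcoef c k (INR n + q))) by now apply pcoef_ex_series.
  simpl INR at 2. rewrite Rplus_0_l.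
  rewrite (Series_ext (fun n => pcoef c k (INR n + (q + 1))) (fun n => pcoef c k (INR (S n) + q))).
  ring. intros n. rewrite S_INR. f_equal; ring.
Qed.

Lemma zcoef_shift (c q : R) (k : nat) :
  1 < c -> 0 < q ->
  zcoef c k (q + 1) = zcoef c k q - mulz (c - 1) (fun j => pcoef c j q) k.
Proof.
  intros Hc Hq. unfold zcoef, mulz. destruct k; rewrite !hcoef_shift by auto; ring.
Qed.

(* Integration by parts turns [zcoef c] into a boundary term plus
   [int_0^1 (1 - t) (z - 1) Z(z + 1, q + t) dt], at the level of coefficients;
   the integral is replaced by a value of its integrand. *)
Lemma zcoef_mean_value (c q : R) (k : nat) :
  2 < c -> 0 < q ->
  exists t, 0 <= t <= 1 /\ zcoef c k q =
    pcoef (c - 1) k q + (1 - t) * mulz (c - 1) (fun j => zcoef (c + 1) j (q + t)) k.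
Proof.
  intros Hc Hq.
  (* By [hcoef_derive] the second summand has derivative [- zcoef c k (q + t)], cancelling what
     differentiation of [- (1 - t)] contributes; its increment over [0,1] is
     [- pcoef (c - 1) k q]. *)
  assert (Hder : forall t, 0 <= t <= 1 ->
    is_derive (fun t => - (1 - t) * zcoef c k (q + t) + hcoef (c - 1) k (q + t)) t
     ((1 - t) * mulz (c - 1) (fun j => zcoef (c + 1) j (q + t)) k)).
  { intros t Ht.
    assert (H1 := zcoef_derive c (q + t) k ltac:(lra) ltac:(lra)).
    assert (H2 := hcoef_derive (c - 1) (q + t) k ltac:(lra) ltac:(lra)).
    replace (c - 1 + 1) with c in H2 by ring.
    fold (zcoef c k (q + t)) in H2.
    assert (Hs : is_derive (fun t => q + t) t 1) by (auto_derive; auto).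
    apply (is_derive_comp _ (fun t => q + t) t _ 1) in H1; auto.
    apply (is_derive_comp _ (fun t => q + t) t _ 1) in H2; auto.
    assert (H3 : is_derive (fun t => - (1 - t)) t 1) by (auto_derive; auto; ring).
    pose proof (is_derive_plus _ _ _ _ _ (is_derive_mult _ _ _ _ _ H3 H1 Rmult_comm) H2) as H.
    eapply is_derive_ext; [|
      match type of H with is_derive _ _ ?l => replace (_ * _) with l; [apply H|] end].
    - intros s; reflexivity.
    - unfold plus, scal, mult; simpl. unfold mult; simpl. ring. }
  destruct (MVT_gen (fun t => - (1 - t) * zcoef c k (q + t) + hcoef (c - 1) k (q + t)) 0 1
    (fun t => (1 - t) * mulz (c - 1) (fun j => zcoef (c + 1) j (q + t)) k)) as [t [Ht E]].
  - intros t; unfold Rmin, Rmax; destruct Rle_dec; intros; apply Hder; lra.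
  - intros t; unfold Rmin, Rmax; destruct Rle_dec; intros;
      eapply is_derive_continuity_pt; apply Hder; lra.
  - exists t. unfold Rmin, Rmax in Ht; destruct Rle_dec in Ht; [|lra]. split; auto.
    rewrite hcoef_shift in E by lra. rewrite Rplus_0_r in E. lra.
Qed.

(** The boundary term comes from q^(1-z), which is entire in z and thus obeys a bound for every [r];
    the other term inherits its radius from the centre c + 1. The point q + t requires the longer
    interval up to [y + 1]. *)
Lemma zcoef_loc_bdd_S (rho c : R) :
  2 < c -> loc_bdd rho (zcoef (c + 1)) -> loc_bdd rho (zcoef c).
Proof.
  intros Hc H r x y Hr Hx.
  destruct (loc_bdd_mulz rho (c - 1) _ H r x (y + 1) Hr ltac:(lra)) as [B HB].
  set (Y := y + 1 + / x).
  assert (Hix : 0 < / x) by (apply Rinv_0_lt_compat; lra).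
  exists (Rpower x (- (c - 1)) * Rpower Y r + B).
  intros k q Hq.
  destruct (zcoef_mean_value c q k Hc ltac:(lra)) as [t [Ht ->]].
  assert (Hp : 0 <= r ^ k) by (apply pow_le; lra).
  eapply Rle_trans; [apply Rmult_le_compat_r; [auto|apply Rabs_triang]|].
  rewrite Rmult_plus_distr_r. apply Rplus_le_compat.
  - apply pcoef_bound; unfold Y; lra.
  - rewrite Rabs_mult, (Rabs_pos_eq (1 - t)) by lra.
    specialize (HB k (q + t) ltac:(lra)). simpl in HB.
    pose proof (Rabs_pos (mulz (c - 1) (fun j => zcoef (c + 1) j (q + t)) k)).
    assert (0 <= Rabs (mulz (c - 1) (fun j => zcoef (c + 1) j (q + t)) k) * r ^ k) by nra.
    nra.
Qed.

Lemma zcoef_loc_bdd (rho c : R) : 2 < c -> loc_bdd rho (zcoef c).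
Proof.
  intros Hc.
  (* Stated for all centres, because the step to [S K] at c' uses [K] at c' + 1, whose distance to
     the pole is one larger. *)
  assert (H : forall K c, 2 < c -> loc_bdd (c - 1 + INR K) (zcoef c)).
  { induction K; intros c' Hc'.
    - simpl. rewrite Rplus_0_r. apply loc_bdd_mulz. apply loc_bdd_hcoef; lra.
    - apply zcoef_loc_bdd_S; auto.
      replace (c' - 1 + INR (S K)) with (c' + 1 - 1 + INR K) by (rewrite S_INR; ring).
      apply IHK; lra. }
  destruct (INR_unbounded rho) as [K HK].
  intros r x y Hr Hx. apply (H K c Hc); auto. lra.
Qed.

(** * Complex power series *)

Lemma im_le_Cmod (z : C) : Rabs (Im z) <= Cmod z.
Proof. eapply Rle_trans; [apply Rmax_r|apply Rmax_Cmod]. Qed.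

Lemma Cmod_le_Re_Im (z : C) : Cmod z <= Rabs (Re z) + Rabs (Im z).
Proof.
  destruct z as [x y]; unfold Cmod; simpl fst; simpl snd; simpl Re; simpl Im.
  rewrite <- (sqrt_pow2 (Rabs x + Rabs y)) by (pose proof (Rabs_pos x); pose proof (Rabs_pos y); lra).
  apply sqrt_le_1_alt. rewrite <- (pow2_abs x), <- (pow2_abs y).
  pose proof (Rabs_pos x); pose proof (Rabs_pos y); nra.
Qed.

(** The uniform structure of [C] is that of a product, with squares as balls; discs give the same
    neighbourhoods, and the later estimates use the modulus. *)
Lemma locally_Cmod (z0 : C) (P : C -> Prop) :
  @locally C_UniformSpace z0 P <->
  exists eps, 0 < eps /\ forall h, Cmod h < eps -> P (z0 + h)%C.
Proof.
  split.
  - intros [eps H]. exists eps. split; [apply cond_pos|]. intros h Hh. apply H.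
    split.
    + change (Rabs (Re z0 + Re h + - Re z0) < eps).
      replace (Re z0 + Re h + - Re z0) with (Re h) by ring.
      eapply Rle_lt_trans; [apply re_le_Cmod|auto].
    + change (Rabs (Im z0 + Im h + - Im z0) < eps).
      replace (Im z0 + Im h + - Im z0) with (Im h) by ring.
      eapply Rle_lt_trans; [apply im_le_Cmod|auto].
  - intros [eps [He H]]. assert (He2 : 0 < eps / 2) by lra.
    exists (mkposreal _ He2). intros y [Hy1 Hy2].
    replace y with (z0 + (y - z0))%C by ring. apply H.
    eapply Rle_lt_trans; [apply Cmod_le_Re_Im|].
    change (Rabs (Re y - Re z0) < eps / 2) in Hy1.
    change (Rabs (Im y - Im z0) < eps / 2) in Hy2.
    change (Rabs (Re y - Re z0) + Rabs (Im y - Im z0) < eps). lra.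
Qed.

Lemma sum_n_C (a : nat -> C) (N : nat) :
  sum_n a N = (sum_n (fun n => Re (a n)) N, sum_n (fun n => Im (a n)) N).
Proof.
  induction N.
  - rewrite !sum_O. now destruct (a 0%nat).
  - rewrite !sum_Sn, IHN. reflexivity.
Qed.

Lemma is_series_C (a : nat -> C) (l : C) :
  is_Cseries a l <->
  is_series (fun n => Re (a n)) (Re l) /\ is_series (fun n => Im (a n)) (Im l).
Proof.
  unfold is_series. split.
  - intros H. split; apply filterlim_locally; intros eps;
      destruct (proj1 (filterlim_locally (F := eventually) _ _) H eps) as [N HN];
      exists N; intros n Hn; specialize (HN n Hn); rewrite sum_n_C in HN; apply HN.
  - intros [H1 H2]. apply filterlim_locally. intros eps.
    generalize (filter_and (F := eventually) _ _
      (proj1 (filterlim_locally (F := eventually) _ _) H1 eps)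
      (proj1 (filterlim_locally (F := eventually) _ _) H2 eps)).
    apply filter_imp. intros n [A B].
    rewrite sum_n_C. split; [apply A|apply B].
Qed.

Definition CSeries (a : nat -> C) : C :=
  (Series (fun n => Re (a n)), Series (fun n => Im (a n))).

Lemma is_series_C_unique (a : nat -> C) (l : C) :
  is_Cseries a l -> l = CSeries a.
Proof.
  intros H. apply is_series_C in H. destruct H as [H1 H2]. unfold CSeries.
  rewrite (is_series_unique _ _ H1), (is_series_unique _ _ H2). now destruct l.
Qed.

Lemma CSeries_ext (a b : nat -> C) : (forall n, a n = b n) -> CSeries a = CSeries b.
Proof. intros H; unfold CSeries; f_equal; apply Series_ext; intros n; now rewrite H. Qed.

Lemma CSeries_correct (a : nat -> C) :
  ex_series (fun n => Cmod (a n)) -> is_Cseries a (CSeries a).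
Proof.
  intros H. apply is_series_C. split; simpl; apply Series_correct;
    apply ex_series_bound with (fun n => Cmod (a n)); auto; intros n;
    [apply re_le_Cmod|apply im_le_Cmod].
Qed.

Lemma sum_n_nonneg_ge_term (a : nat -> R) (K : nat) :
  (forall n, 0 <= a n) -> a K <= sum_n a K.
Proof.
  intros H. destruct K. rewrite sum_O; lra.
  rewrite sum_n_Reals, tech5. assert (0 <= sum_f_R0 a K) by (apply cond_pos_sum; auto). lra.
Qed.

(** The modulus dominates both components, so [Series_swap] applies to each. The first conjunct
    records convergence in the original order, from which the Dirichlet series is recovered. *)
Lemma CSeries_swap (u : nat -> nat -> C) (w : nat -> R) :
  ex_series w -> (forall n K, sum_n (fun k => Cmod (u n k)) K <= w n) ->
  is_Cseries (fun n => CSeries (u n)) (CSeries (fun n => CSeries (u n))) /\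
  is_Cseries (fun k => CSeries (fun n => u n k))
    (CSeries (fun n => CSeries (u n))).
Proof.
  intros Hw Hu.
  assert (HRe : forall n K, sum_n (fun k => Rabs (Re (u n k))) K <= w n).
  { intros n K. eapply Rle_trans; [|apply (Hu n K)]. rewrite !sum_n_Reals.
    apply sum_Rle. intros; apply re_le_Cmod. }
  assert (HIm : forall n K, sum_n (fun k => Rabs (Im (u n k))) K <= w n).
  { intros n K. eapply Rle_trans; [|apply (Hu n K)]. rewrite !sum_n_Reals.
    apply sum_Rle. intros; apply im_le_Cmod. }
  assert (Hex : forall v : nat -> nat -> R, (forall n K, sum_n (fun k => Rabs (v n k)) K <= w n) ->
    ex_series (fun n => Series (v n))).
  { intros v Hv. apply ex_series_bound with w; auto. intros n.
    assert (Hn : ex_series (fun k => Rabs (v n k))).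
    { apply ex_series_nonneg_bounded with (w n); auto. intros; apply Rabs_pos. }
    eapply Rle_trans; [apply Series_Rabs, Hn|].
    apply (is_lim_seq_le (sum_n (fun k => Rabs (v n k))) (fun _ => w n)
      (Series (fun k => Rabs (v n k))) (w n)); auto.
    - apply (Series_correct _ Hn).
    - apply is_lim_seq_const. }
  split; apply is_series_C; simpl; split.
  - apply Series_correct, (Hex (fun n k => Re (u n k))); auto.
  - apply Series_correct, (Hex (fun n k => Im (u n k))); auto.
  - apply (Series_swap (fun n k => Re (u n k)) w); auto.
  - apply (Series_swap (fun n k => Im (u n k)) w); auto.
Qed.

Lemma is_pseries_C (c : nat -> C) (h v : C) :
  is_Cpseries c h v <->
  is_Cseries (fun k => (c k * h ^ k)%C) v.
Proof.
  assert (E : forall k, (c k * h ^ k)%C = @scal C_AbsRing C_ModuleSpace (@pow_n C_Ring h k) (c k)).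
  { intros k. apply Cmult_comm. }
  unfold is_pseries. split; apply is_series_ext; intros k; rewrite E; reflexivity.
Qed.

Lemma is_series_C_bounded (a : nat -> C) (l : C) :
  is_Cseries a l -> exists B, forall n, Cmod (a n) <= B.
Proof.
  intros H. destruct (filterlim_bounded (V := C_NormedModule) (sum_n a)) as [M HM].
  { exists l; exact H. }
  exists (M + M). intros n.
  destruct n as [|n].
  - assert (H0 := HM 0%nat). rewrite sum_O in H0. change (Cmod (a 0%nat) <= M) in H0.
    pose proof (Cmod_ge_0 (a 0%nat)). lra.
  - assert (H1 := HM (S n)). assert (H2 := HM n). change (Cmod (sum_n a (S n)) <= M) in H1. change (Cmod (sum_n a n) <= M) in H2.
    replace (a (S n)) with (sum_n a (S n) + - sum_n a n)%C.
    + eapply Rle_trans; [apply Cmod_triangle|]. rewrite Cmod_opp. lra.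
    + rewrite sum_Sn. unfold plus; simpl. ring.
Qed.

Lemma sum_geom_half (N : nat) : sum_n (fun k => (1 / 2) ^ k) N <= 2.
Proof.
  assert (H : sum_n (fun k => (1 / 2) ^ k) N = 2 - (1 / 2) ^ N).
  { induction N. rewrite sum_O; simpl; ring.
    rewrite sum_n_Reals, tech5, <- sum_n_Reals, IHN. simpl. field. }
  rewrite H. pose proof (pow_le (1/2) N). lra.
Qed.

(** For [Cmod h] at most rho/2 the terms are dominated by B (1/2)^k, whose sum is at most 2B. *)
Lemma pseries_C_sup (c : nat -> C) (B rho : R) (h v : C) :
  0 < rho -> (forall k, Cmod (c k) * rho ^ k <= B) -> Cmod h <= rho / 2 ->
  is_Cpseries c h v -> Cmod v <= 2 * B.
Proof.
  intros Hr Hc Hh Hv. apply is_pseries_C in Hv.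
  assert (HB : 0 <= B).
  { eapply Rle_trans; [|apply (Hc 0%nat)]. pose proof (Cmod_ge_0 (c 0%nat)). simpl; lra. }
  assert (Hlim : is_lim_seq (fun n => Cmod (sum_n (fun k => (c k * h ^ k)%C) n)) (Cmod v)).
  { apply (filterlim_comp _ _ _ _ (fun z : C => Cmod z) _ _ _ Hv).
    apply (filterlim_norm (V := C_NormedModule)). }
  apply (is_lim_seq_le (fun n => Cmod (sum_n (fun k => (c k * h ^ k)%C) n)) (fun _ => 2 * B)
    (Cmod v) (2 * B)); auto; [|apply is_lim_seq_const].
  intros n.
  eapply Rle_trans; [apply (norm_sum_n_m (V := C_NormedModule))|].
  apply Rle_trans with (sum_n (fun k => B * (1 / 2) ^ k) n).
  - apply sum_n_m_le. intros k. change (Cmod (c k * h ^ k) <= B * (1 / 2) ^ k).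
    rewrite Cmod_mult, Cmod_pow.
    apply Rle_trans with (Cmod (c k) * (rho / 2) ^ k).
    + apply Rmult_le_compat_l; [apply Cmod_ge_0|]. apply pow_incr. split; auto. apply Cmod_ge_0.
    + replace (rho / 2) with (rho * (1 / 2)) by field. rewrite Rpow_mult_distr, <- Rmult_assoc.
      apply Rmult_le_compat_r; auto. apply pow_le; lra.
  - apply Rle_trans with (B * sum_n (fun k => (1 / 2) ^ k) n).
    + right. apply (sum_n_mult_l (K := R_Ring) B (fun k => (1 / 2) ^ k) n).
    + pose proof (sum_geom_half n). nra.
Qed.

Lemma pseries_C_decr (c : nat -> C) (h v : C) :
  is_Cpseries c h v ->
  exists v' : C, is_Cpseries (fun k => c (S k)) h v' /\ v = (c 0%nat + h * v')%C.
Proof.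
  intros Hv. destruct (Ceq_dec h 0) as [->|Hh].
  (* At [h = 0] the equation leaves [v'] open; convergence of the shifted series fixes it to be
     [c 1]. *)
  - exists (c 1%nat). split.
    + apply (is_pseries_0 (V := C_NormedModule) (fun k => c (S k))).
    + assert (H0 := is_pseries_0 (K := C_AbsRing) (V := C_NormedModule) c).
      apply (filterlim_locally_unique (F := eventually)) with (1 := Hv) in H0.
      rewrite H0. ring.
  - exists (/ h * (v + - c 0%nat))%C. split.
    + apply (is_pseries_decr_1 (V := C_NormedModule) c h (/ h)%C v); auto.
      apply Cinv_l; auto.
    + field; auto.
Qed.

(** The shifted coefficients satisfy the same kind of bound with [B / rho], so [pseries_C_sup]
    applies to the quotient by [h]. *)
Lemma pseries_C_linear (c : nat -> C) (B rho : R) (h v : C) :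
  0 < rho -> (forall k, Cmod (c k) * rho ^ k <= B) -> Cmod h <= rho / 2 ->
  is_Cpseries c h v -> Cmod (v - c 0%nat) <= 2 * (B / rho) * Cmod h.
Proof.
  intros Hr Hc Hh Hv. destruct (pseries_C_decr _ _ _ Hv) as [v' [Hv' ->]].
  replace (c 0%nat + h * v' - c 0%nat)%C with (h * v')%C by ring.
  rewrite Cmod_mult, Rmult_comm. apply Rmult_le_compat_r; [apply Cmod_ge_0|].
  apply (pseries_C_sup (fun k => c (S k)) _ rho h); auto.
  intros k. specialize (Hc (S k)). simpl in Hc.
  apply Rmult_le_reg_r with rho; auto. unfold Rdiv. rewrite (Rmult_assoc B), Rinv_l, Rmult_1_r by lra.
  lra.
Qed.

Lemma pseries_C_quadratic (c : nat -> C) (B rho : R) (h v : C) :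
  0 < rho -> (forall k, Cmod (c k) * rho ^ k <= B) -> Cmod h <= rho / 2 ->
  is_Cpseries c h v ->
  Cmod (v - c 0%nat - c 1%nat * h) <= 2 * (B / rho / rho) * Cmod h ^ 2.
Proof.
  intros Hr Hc Hh Hv. destruct (pseries_C_decr _ _ _ Hv) as [v' [Hv' ->]].
  replace (c 0%nat + h * v' - c 0%nat - c 1%nat * h)%C with (h * (v' - c 1%nat))%C by ring.
  rewrite Cmod_mult.
  assert (Cmod (v' - c 1%nat) <= 2 * (B / rho / rho) * Cmod h).
  { apply (pseries_C_linear (fun k => c (S k))); auto.
    intros k. specialize (Hc (S k)). simpl in Hc.
    apply Rmult_le_reg_r with rho; auto. unfold Rdiv. rewrite (Rmult_assoc B), Rinv_l, Rmult_1_r by lra.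
    lra. }
  pose proof (Cmod_ge_0 h). nra.
Qed.

Lemma pseries_C_bounded (c : nat -> C) (h v : C) :
  is_Cpseries c h v ->
  exists B, forall k, Cmod (c k) * Cmod h ^ k <= B.
Proof.
  intros H. apply is_pseries_C, is_series_C_bounded in H. destruct H as [B HB].
  exists B. intros k. rewrite <- Cmod_pow, <- Cmod_mult. apply HB.
Qed.

(** Continuity at the centre gives [c 0 = 0]; dividing by [h] keeps the same nonzero zeros for the
    shifted series, and induction on the index does the rest. *)
Lemma pseries_C_zero (c : nat -> C) :
  (forall eps, 0 < eps -> exists h, h <> RtoC 0 /\ Cmod h < eps /\
     is_Cpseries c h (RtoC 0)) ->
  forall k, c k = RtoC 0.
Proof.
  intros H k. revert c H.
  assert (H0 : forall c : nat -> C, (forall eps, 0 < eps -> exists h, h <> RtoC 0 /\ Cmod h < eps /\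
     is_Cpseries c h (RtoC 0)) -> c 0%nat = RtoC 0).
  { intros c H. destruct (H 1 Rlt_0_1) as [h0 [Hh0 [_ Hs]]].
    apply pseries_C_bounded in Hs. destruct Hs as [B HB].
    assert (Hr : 0 < Cmod h0) by (now apply Cmod_gt_0).
    destruct (Req_dec (Cmod (c 0%nat)) 0) as [E|E]; [now apply Cmod_eq_0|].
    exfalso. assert (Hp : 0 < Cmod (c 0%nat)) by (pose proof (Cmod_ge_0 (c 0%nat)); lra).
    set (M := 2 * (B / Cmod h0)).
    assert (HM : 0 <= M).
    { unfold M. specialize (HB 0%nat). simpl in HB. apply Rmult_le_pos; [lra|].
      apply Rdiv_le_0_compat; lra. }
    destruct (H (Rmin (Cmod h0 / 2) (Cmod (c 0%nat) / (M + 1)))) as [h [_ [Hh Hs]]].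
    { apply Rmin_pos; [lra|]. apply Rdiv_lt_0_compat; lra. }
    assert (Hh1 : Cmod h < Cmod h0 / 2) by (eapply Rlt_le_trans; [apply Hh|apply Rmin_l]).
    assert (Hh2 : Cmod h < Cmod (c 0%nat) / (M + 1)) by (eapply Rlt_le_trans; [apply Hh|apply Rmin_r]).
    assert (HL := pseries_C_linear c B (Cmod h0) h 0 Hr HB ltac:(lra) Hs). fold M in HL.
    replace (0 - c 0%nat)%C with (- c 0%nat)%C in HL by ring. rewrite Cmod_opp in HL.
    apply (Rmult_lt_compat_r (M + 1)) in Hh2; [|lra].
    unfold Rdiv in Hh2. rewrite Rmult_assoc, Rinv_l, Rmult_1_r in Hh2 by lra.
    pose proof (Cmod_ge_0 h). nra. }
  induction k as [|k IH]; intros c H; [now apply H0|].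
  apply (IH (fun k => c (S k))). intros eps He.
  destruct (H eps He) as [h [Hh [Hhe Hs]]]. exists h. split; [auto|split; auto].
  destruct (pseries_C_decr _ _ _ Hs) as [v' [Hv' E]].
  rewrite (H0 c H), Cplus_0_l in E.
  replace (RtoC 0) with v'; auto.
  destruct (Ceq_dec v' 0) as [?|Hn]; auto. now destruct (Cmult_neq_0 h v' Hh Hn).
Qed.

(** * The identity theorem and complex derivatives *)

Definition analytic_at (f : C -> C) (z0 : C) : Prop :=
  exists c : nat -> C, @locally C_UniformSpace z0
    (fun z => is_Cpseries c (z - z0)%C (f z)).

(** A connectedness argument on [0,1]: let T be the supremum of the parameters up to which [f] and
    [g] agree near the segment. Agreement passes to T because coincidences accumulate there, and
    beyond T because it holds on a neighbourhood. *)
Lemma identity_segment (f g : C -> C) (w z : C) :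
  (forall t, 0 <= t <= 1 -> analytic_at f (w + t * (z - w))%C) ->
  (forall t, 0 <= t <= 1 -> analytic_at g (w + t * (z - w))%C) ->
  @locally C_UniformSpace w (fun y => f y = g y) -> f z = g z.
Proof.
  intros Hf Hg Hw.
  destruct (Ceq_dec z w) as [->|Hzw]; [now apply (locally_singleton w)|].
  set (gam := fun t : R => (w + t * (z - w))%C).
  set (P := fun t => @locally C_UniformSpace (gam t) (fun y => f y = g y)).
  assert (Hd : 0 < Cmod (z - w)) by now apply Cmod_gt_0, Cminus_eq_contra.
  assert (Hgam : forall s t, (gam s = gam t + (s - t)%R * (z - w))%C).
  { intros s t. unfold gam. rewrite RtoC_minus. ring. }
  assert (P0 : P 0).
  { unfold P, gam. replace (w + 0 * (z - w))%C with w by ring. exact Hw. }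
  (* Closedness: at an accumulation point of coincidences the difference of the two expansions has
     all coefficients 0 by [pseries_C_zero]. *)
  assert (Hstep : forall T, 0 <= T <= 1 ->
    (forall eps, 0 < eps -> exists t, t <> T /\ Rabs (t - T) < eps /\ f (gam t) = g (gam t)) -> P T).
  { intros T HT Hacc.
    destruct (Hf T HT) as [c Hc]. destruct (Hg T HT) as [d Hd'].
    apply locally_Cmod in Hc. apply locally_Cmod in Hd'.
    destruct Hc as [e1 [He1 Hc]], Hd' as [e2 [He2 Hd']].
    assert (Hz : forall k, (PS_minus c d k) = RtoC 0).
    { apply pseries_C_zero. intros eps He.
      set (e := Rmin eps (Rmin e1 e2)).
      assert (He' : 0 < e) by (repeat apply Rmin_pos; auto).
      destruct (Hacc (e / Cmod (z - w))) as [t [Ht [Hte Hfg]]].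
      { now apply Rdiv_lt_0_compat. }
      set (h := ((t - T)%R * (z - w))%C).
      assert (Hh : Cmod h < e).
      { unfold h. rewrite Cmod_mult, Cmod_R.
        apply (Rmult_lt_compat_r (Cmod (z - w))) in Hte; auto.
        unfold Rdiv in Hte. rewrite Rmult_assoc, Rinv_l, Rmult_1_r in Hte; lra. }
      assert (Hm1 : e <= eps) by apply Rmin_l.
      assert (Hm2 : e <= e1) by (eapply Rle_trans; [apply Rmin_r|apply Rmin_l]).
      assert (Hm3 : e <= e2) by (eapply Rle_trans; [apply Rmin_r|apply Rmin_r]).
      exists h. repeat split.
      - apply Cmult_neq_0; [|now apply Cminus_eq_contra].
        intros E. apply RtoC_inj in E. lra.
      - lra.
      - specialize (Hc h ltac:(lra)). specialize (Hd' h ltac:(lra)).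
        assert (Eh : (gam T + h)%C = gam t) by (symmetry; apply Hgam).
        fold (gam T) in Hc, Hd'.
        replace (gam T + h - gam T)%C with h in Hc, Hd' by ring.
        rewrite Eh in Hc, Hd'.
        rewrite Hfg in Hc.
        assert (Hs := is_pseries_minus (V := C_NormedModule) c d h _ _ Hc Hd').
        replace (RtoC 0) with (@plus C_NormedModule (g (gam t)) (opp (g (gam t)))); auto.
        apply (plus_opp_r (G := C_AbelianGroup)). }
    apply locally_Cmod. exists (Rmin e1 e2). split; [now apply Rmin_pos|].
    intros h Hh.
    specialize (Hc h). specialize (Hd' h).
    assert (Hcd : forall k, c k = d k).
    { intros k. specialize (Hz k). unfold PS_minus, PS_plus, PS_opp in Hz.
      replace (c k) with (d k + (c k + - d k))%C by ring.
      change ((c k + - d k)%C = RtoC 0) in Hz. rewrite Hz. ring. }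
    assert (Hc' := Hc (Rlt_le_trans _ _ _ Hh (Rmin_l _ _))).
    assert (Hd2 := Hd' (Rlt_le_trans _ _ _ Hh (Rmin_r _ _))).
    apply (is_pseries_ext _ d) in Hc'; auto.
    exact (filterlim_locally_unique (F := eventually) _ _ _ Hc' Hd2). }
  assert (Hopen : forall T, P T -> exists del, 0 < del /\ forall t, Rabs (t - T) < del -> P t).
  { intros T HT. apply locally_Cmod in HT. destruct HT as [e [He HT]].
    exists (e / Cmod (z - w)). split; [now apply Rdiv_lt_0_compat|].
    intros t Ht. apply locally_Cmod.
    assert (Hlt : Cmod ((t - T)%R * (z - w)) < e).
    { rewrite Cmod_mult, Cmod_R.
      apply (Rmult_lt_compat_r (Cmod (z - w))) in Ht; auto.
      unfold Rdiv in Ht. rewrite Rmult_assoc, Rinv_l, Rmult_1_r in Ht; lra. }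
    exists (e - Cmod ((t - T)%R * (z - w))). split; [lra|].
    intros h Hh. rewrite (Hgam t T), <- Cplus_assoc. apply HT.
    eapply Rle_lt_trans; [apply Cmod_triangle|]. lra. }
  set (E := fun t => 0 <= t <= 1 /\ forall s, 0 <= s <= t -> P s).
  destruct (completeness E) as [T [HT1 HT2]].
  { exists 1. intros t [Ht _]; lra. }
  { exists 0. split; [lra|]. intros s Hs. now replace s with 0 by lra. }
  assert (HT0 : 0 <= T <= 1).
  { split; [apply HT1; split; [lra|intros s Hs; now replace s with 0 by lra]|].
    apply HT2. intros t [Ht _]; lra. }
  assert (Hbelow : forall s, 0 <= s < T -> P s).
  { intros s Hs. destruct (Classical_Prop.classic (P s)) as [|Hn]; auto.
    exfalso. assert (T <= s); [|lra].
    apply HT2. intros t [Ht Ht']. destruct (Rle_dec t s); auto.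
    exfalso. apply Hn, Ht'. lra. }
  assert (PT : P T).
  { destruct (Req_dec T 0) as [->|HTn]; auto.
    apply Hstep; auto. intros eps He.
    exists (T - Rmin (T / 2) (eps / 2)).
    assert (0 < Rmin (T / 2) (eps / 2)) by (apply Rmin_pos; lra).
    pose proof (Rmin_l (T / 2) (eps / 2)). pose proof (Rmin_r (T / 2) (eps / 2)).
    repeat split; [lra| |].
    - replace (T - Rmin (T / 2) (eps / 2) - T) with (- Rmin (T / 2) (eps / 2)) by ring.
      rewrite Rabs_Ropp, Rabs_pos_eq; lra.
    - apply (locally_singleton (T := C_UniformSpace) _ (fun y => f y = g y)), Hbelow. lra. }
  destruct (Hopen T PT) as [del [Hdel Hnear]].
  assert (HTE : T = 1).
  { destruct (Rle_lt_or_eq_dec T 1 ltac:(lra)) as [Hlt|]; auto. exfalso.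
    assert (Hm : 0 < Rmin (1 - T) (del / 2)) by (apply Rmin_pos; lra).
    pose proof (Rmin_l (1 - T) (del / 2)). pose proof (Rmin_r (1 - T) (del / 2)).
    assert (T + Rmin (1 - T) (del / 2) <= T); [|lra].
    apply HT1. split; [lra|]. intros s Hs.
    destruct (Rlt_dec s T); [apply Hbelow; lra|].
    apply Hnear. rewrite Rabs_pos_eq; lra. }
  rewrite HTE in PT. apply (locally_singleton (T := C_UniformSpace) _ (fun y => f y = g y)) in PT.
  unfold gam in PT. replace (w + 1 * (z - w))%C with z in PT by ring. exact PT.
Qed.

Lemma analytic_at_quadratic (f : C -> C) (z0 : C) :
  analytic_at f z0 -> exists c1 M d, 0 < d /\ 0 <= M /\ forall h, Cmod h < d ->
    Cmod (f (z0 + h)%C - f z0 - c1 * h) <= M * Cmod h ^ 2.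
Proof.
  intros [c Hc]. apply locally_Cmod in Hc. destruct Hc as [e [He Hc]].
  assert (H0 : f z0 = c 0%nat).
  { specialize (Hc (RtoC 0)). rewrite Cmod_0 in Hc. specialize (Hc He).
    replace (z0 + 0 - z0)%C with (RtoC 0) in Hc by ring. rewrite Cplus_0_r in Hc.
    apply (filterlim_locally_unique (F := eventually) _ _ _ Hc).
    apply (is_pseries_0 (V := C_NormedModule) c). }
  (* The expansion converges at distance [e / 2], which bounds the coefficients with rho = e/2; the
     remainder estimate then holds for moduli up to rho/2 = e/4. *)
  assert (Hh : Cmod (RtoC (e / 2)) = e / 2) by (rewrite Cmod_R; apply Rabs_pos_eq; lra).
  destruct (pseries_C_bounded c _ _ (Hc (RtoC (e / 2)) ltac:(lra))) as [B HB].
  replace (z0 + RtoC (e / 2) - z0)%C with (RtoC (e / 2)) in HB by ring. rewrite Hh in HB.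
  exists (c 1%nat), (2 * (B / (e / 2) / (e / 2))), (e / 4). split; [lra|]. split.
  - specialize (HB 0%nat). pose proof (Cmod_ge_0 (c 0%nat)). simpl in HB.
    apply Rmult_le_pos; [lra|]. repeat apply Rdiv_le_0_compat; lra.
  - intros h Hh'. rewrite H0. apply pseries_C_quadratic; [lra|auto|lra|].
    specialize (Hc h ltac:(lra)). replace (z0 + h - z0)%C with h in Hc by ring. exact Hc.
Qed.

(** [C_derive] is a total operator defined through a limit, so its value is obtained from uniqueness
    of that limit. *)
Lemma C_derive_of_quadratic (f : C -> C) (z0 c1 : C) (M d : R) :
  0 < d -> 0 <= M ->
  (forall h, Cmod h < d -> Cmod (f (z0 + h)%C - f z0 - c1 * h) <= M * Cmod h ^ 2) ->
  C_derive f z0 = c1.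
Proof.
  intros Hd HM H. apply is_C_lim_unique.
  apply filterlim_locally. intros eps.
  assert (He := cond_pos eps).
  unfold locally', within.
  apply locally_Cmod. exists (Rmin d (eps / (M + 1))). split.
  { apply Rmin_pos; auto. apply Rdiv_lt_0_compat; lra. }
  intros h Hh Hne. 
  assert (Hh0 : h <> RtoC 0). { intros ->. apply Hne, Cplus_0_r. }
  apply C_NormedModule_mixin_compat1.
  change (Cmod ((f (z0 + h)%C - f z0) / (z0 + h - z0) - c1) < eps).
  assert (Hp : 0 < Cmod h) by now apply Cmod_gt_0.
  replace ((f (z0 + h)%C - f z0) / (z0 + h - z0) - c1)%C
    with ((f (z0 + h)%C - f z0 - c1 * h) / h)%C.
  2:{ replace (z0 + h - z0)%C with h by ring. field. auto. }
  rewrite Cmod_div by auto.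
  apply Rmult_lt_reg_r with (Cmod h); auto. unfold Rdiv. rewrite Rmult_assoc, Rinv_l, Rmult_1_r by lra.
  assert (H1 := H h (Rlt_le_trans _ _ _ Hh (Rmin_l _ _))).
  assert (H2 := Rlt_le_trans _ _ _ Hh (Rmin_r _ _)).
  apply (Rmult_lt_compat_r (M + 1)) in H2; [|lra].
  unfold Rdiv in H2. rewrite Rmult_assoc, Rinv_l, Rmult_1_r in H2 by lra. nra.
Qed.

(** Real increments in the remainder of [analytic_at_quadratic] exhibit the same linear coefficient,
    so the complex derivative can be replaced by a real one. *)
Lemma Re_C_derive (f : C -> C) (x : R) :
  analytic_at f (RtoC x) ->
  is_derive (fun t : R => Re (f (RtoC t))) x (Re (C_derive f (RtoC x))).
Proof.
  intros Hf. destruct (analytic_at_quadratic _ _ Hf) as [c1 [M [d [Hd [HM H]]]]].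
  rewrite (C_derive_of_quadratic f x c1 M d Hd HM H).
  apply is_derive_of_quadratic_bound with M d; auto. intros y Hy.
  specialize (H (RtoC (y - x))). rewrite Cmod_R in H. specialize (H Hy).
  rewrite pow2_abs in H. eapply Rle_trans; [|apply H].
  replace (x + RtoC (y - x))%C with (RtoC y) by (rewrite RtoC_minus; ring).
  eapply Rle_trans; [|apply re_le_Cmod]. right. f_equal.
  unfold Cminus, Cplus, Copp, Cmult, Re; simpl. ring.
Qed.

(** * Entire power series and the change of centre *)

Definition entire_coef (a : nat -> C) : Prop :=
  forall r, 0 <= r -> exists B, forall k, Cmod (a k) * r ^ k <= B.

Definition Csum (a : nat -> C) (z : C) : C := CSeries (fun k => (a k * z ^ k)%C).

Lemma ex_series_of_double_radius (a : nat -> R) (B r : R) :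
  0 <= r -> (forall k, 0 <= a k) -> (forall k, a k * (2 * r) ^ k <= B) ->
  ex_series (fun k => a k * r ^ k).
Proof.
  intros Hr Ha H. apply ex_series_bound with (fun k => B * (1 / 2) ^ k).
  - intros k. specialize (H k). rewrite Rpow_mult_distr in H.
    rewrite Rabs_pos_eq by (apply Rmult_le_pos; [auto|apply pow_le; auto]).
    assert (E : 2 ^ k * (1 / 2) ^ k = 1).
    { rewrite <- Rpow_mult_distr. replace (2 * (1 / 2)) with 1 by field. apply pow1. }
    assert (0 < (1 / 2) ^ k) by (apply pow_lt; lra).
    apply Rle_trans with (a k * (2 ^ k * r ^ k) * (1 / 2) ^ k).
    + right. replace (a k * (2 ^ k * r ^ k) * (1 / 2) ^ k)
        with (a k * r ^ k * (2 ^ k * (1 / 2) ^ k)) by ring. rewrite E; ring.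
    + apply Rmult_le_compat_r; lra.
  - apply (ex_series_scal_l (V := R_NormedModule) B). apply ex_series_geom.
    rewrite Rabs_pos_eq; lra.
Qed.

Lemma entire_coef_ex_series (a : nat -> C) (r : R) :
  entire_coef a -> 0 <= r -> ex_series (fun k => Cmod (a k) * r ^ k).
Proof.
  intros Ha Hr. destruct (Ha (2 * r)) as [B HB]; [lra|].
  apply ex_series_of_double_radius with B; auto. intros; apply Cmod_ge_0.
Qed.

Lemma is_pseries_C_unique (a : nat -> C) (z l : C) :
  is_Cpseries a z l -> l = Csum a z.
Proof. intros H. apply is_series_C_unique. exact (proj1 (is_pseries_C _ _ _) H). Qed.

(* The coefficient of [h^j] in [(z0 + h)^k]. *)
Fixpoint binom_coef (z0 : C) (k j : nat) : C :=
  match k with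
  | O => match j with O => RtoC 1 | S _ => RtoC 0 end
  | S k' => (z0 * binom_coef z0 k' j +
      match j with O => RtoC 0 | S j' => binom_coef z0 k' j' end)%C
  end.

Lemma binom_coef_pseries (z0 h : C) (k : nat) :
  is_Cpseries (binom_coef z0 k) h ((z0 + h) ^ k)%C.
Proof.
  induction k.
  - apply is_pseries_C. apply filterlim_ext with (fun _ => RtoC 1).
    + induction x as [|x IH].
      * rewrite sum_O. simpl. ring.
      * rewrite sum_Sn, <- IH. unfold plus; simpl. ring.
    + apply filterlim_const.
  - assert (H1 := is_pseries_scal (V := C_NormedModule) z0 _ h _ (Cmult_comm _ _) IHk).
    assert (H2 := is_pseries_incr_1 (V := C_NormedModule) _ h _ IHk).
    assert (H3 := is_pseries_plus (V := C_NormedModule) _ _ h _ _ H1 H2).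
    match type of H3 with is_pseries _ _ ?l => replace ((z0 + h) ^ S k)%C with l end.
    + revert H3. apply is_pseries_ext. intros [|n]; reflexivity.
    + change ((z0 * (z0 + h) ^ k + h * (z0 + h) ^ k) = (z0 + h) * (z0 + h) ^ k)%C. ring.
Qed.

Lemma sum_n_shift (g : nat -> R) (J : nat) :
  sum_n (fun j => match j with O => 0 | S i => g i end) (S J) = sum_n g J.
Proof.
  induction J.
  - rewrite sum_Sn, !sum_O. unfold plus; simpl. ring.
  - rewrite sum_Sn, IHJ, sum_Sn. reflexivity.
Qed.

Lemma binom_coef_sum_le (z0 : C) (r : R) (k J : nat) :
  0 <= r -> sum_n (fun j => Cmod (binom_coef z0 k j) * r ^ j) J <= (Cmod z0 + r) ^ k.
Proof.
  intros Hr. revert J. induction k; intros J.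
  - right. simpl pow. induction J.
    + rewrite sum_O. simpl. rewrite Cmod_1. ring.
    + rewrite sum_n_Reals, tech5, <- sum_n_Reals, IHJ. simpl. rewrite Cmod_0. ring.
  - set (g := fun j => Cmod (binom_coef z0 k j) * r ^ j).
    assert (Hg : forall j, 0 <= g j).
    { intros j. apply Rmult_le_pos; [apply Cmod_ge_0|apply pow_le; auto]. }
    apply Rle_trans with (sum_n (fun j => Cmod z0 * g j +
       r * match j with O => 0 | S i => g i end) J).
    + rewrite !sum_n_Reals. apply sum_Rle. intros j _.
      simpl binom_coef.
      eapply Rle_trans; [apply Rmult_le_compat_r; [apply pow_le; auto|apply Cmod_triangle]|].
      rewrite Cmod_mult, Rmult_plus_distr_r. right. f_equal; [unfold g; ring|].
      destruct j; [rewrite Cmod_0; ring|]. unfold g. simpl. ring.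
    + rewrite sum_n_Reals, plus_sum, <- !sum_n_Reals.
      assert (E1 : sum_n (fun j => Cmod z0 * g j) J = Cmod z0 * sum_n g J).
      { apply (sum_n_mult_l (K := R_Ring) (Cmod z0) g J). }
      assert (E2 : sum_n (fun j => r * match j with O => 0 | S i => g i end) J =
        r * sum_n (fun j => match j with O => 0 | S i => g i end) J).
      { apply (sum_n_mult_l (K := R_Ring) r (fun j => match j with O => 0 | S i => g i end) J). }
      rewrite E1, E2. simpl pow. rewrite Rmult_plus_distr_r. apply Rplus_le_compat.
      * apply Rmult_le_compat_l; [apply Cmod_ge_0|apply IHk].
      * apply Rmult_le_compat_l; auto. destruct J.
        -- rewrite sum_O. apply pow_le. pose proof (Cmod_ge_0 z0); lra.
        -- rewrite sum_n_shift. apply IHk.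
Qed.

Lemma CSeries_scal_l (s : C) (u : nat -> C) (l : C) :
  is_Cseries u l -> CSeries (fun k => (s * u k)%C) = (s * CSeries u)%C.
Proof.
  intros H. rewrite <- (is_series_C_unique _ _ H). symmetry. apply is_series_C_unique.
  apply (is_series_scal_l (V := C_NormedModule) s u l H).
Qed.

(** Expand every power by the binomial theorem and interchange the sums; absolute convergence comes
    from [entire_coef] at radius [Cmod z0 + Cmod h]. *)
Lemma Csum_recenter (a : nat -> C) (z0 : C) :
  entire_coef a ->
  exists c, entire_coef c /\ forall h, is_Cpseries c h (Csum a (z0 + h)).
Proof.
  intros Ha.
  set (c := fun j => CSeries (fun k => (a k * binom_coef z0 k j)%C)).
  assert (Hs : forall h, is_Cpseries c h (Csum a (z0 + h))).
  { intros h. apply is_pseries_C.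
    set (u := fun k j => (a k * binom_coef z0 k j * h ^ j)%C).
    assert (Hz0 := Cmod_ge_0 z0). assert (Hh0 := Cmod_ge_0 h).
    destruct (CSeries_swap u (fun k => Cmod (a k) * (Cmod z0 + Cmod h) ^ k)) as [_ H].
    - apply entire_coef_ex_series; auto. lra.
    - intros k J. apply Rle_trans with (Cmod (a k) * sum_n (fun j => Cmod (binom_coef z0 k j) * Cmod h ^ j) J).
      + right. transitivity (sum_n (fun j => Cmod (a k) * (Cmod (binom_coef z0 k j) * Cmod h ^ j)) J).
        * apply sum_n_ext. intros j. unfold u. rewrite !Cmod_mult, Cmod_pow. apply Rmult_assoc.
        * apply (sum_n_mult_l (K := R_Ring) (Cmod (a k)) (fun j => Cmod (binom_coef z0 k j) * Cmod h ^ j) J).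
      + apply Rmult_le_compat_l; [apply Cmod_ge_0|]. apply binom_coef_sum_le; auto.
    - replace (Csum a (z0 + h)) with (CSeries (fun k => CSeries (u k))).
      + revert H. apply is_series_ext. intros j. unfold c.
        rewrite (CSeries_ext _ (fun k => (h ^ j * (a k * binom_coef z0 k j))%C))
          by (intros k; unfold u; ring).
        rewrite Cmult_comm. eapply CSeries_scal_l. apply CSeries_correct.
        (* One binomial coefficient is bounded by the whole expansion of (Cmod z0 + 1)^k, that is,
           by [binom_coef_sum_le] at radius 1. *)
        apply ex_series_bound with (fun k => Cmod (a k) * (Cmod z0 + 1) ^ k).
        * intros k. rewrite Rabs_pos_eq by apply Cmod_ge_0. rewrite Cmod_mult.
          apply Rmult_le_compat_l; [apply Cmod_ge_0|].
          eapply Rle_trans; [|apply (binom_coef_sum_le z0 1 k j Rle_0_1)].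
          eapply Rle_trans; [|apply (sum_n_nonneg_ge_term (fun j => Cmod (binom_coef z0 k j) * 1 ^ j) j)].
          -- rewrite pow1; lra.
          -- intros i. rewrite pow1, Rmult_1_r. apply Cmod_ge_0.
        * apply entire_coef_ex_series; auto. lra.
      + apply CSeries_ext. intros k. unfold u.
        assert (Hp := binom_coef_pseries z0 h k). apply is_pseries_C in Hp.
        rewrite (CSeries_ext _ (fun j => (a k * (binom_coef z0 k j * h ^ j))%C)) by (intros; ring).
        rewrite (CSeries_scal_l _ _ _ Hp). now rewrite <- (is_series_C_unique _ _ Hp). }
  exists c. split; auto.
  (* Convergence at the real point [r] bounds the terms there; as [r] is arbitrary, [c] is entire
     too. *)
  intros r Hr. destruct (pseries_C_bounded c _ _ (Hs (RtoC r))) as [B HB].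
  exists B. now rewrite Cmod_R, Rabs_pos_eq in HB by auto.
Qed.

Lemma Csum_analytic (a : nat -> C) (b z0 : C) :
  entire_coef a -> analytic_at (fun z => Csum a (z - b)%C) z0.
Proof.
  intros Ha. destruct (Csum_recenter a (z0 - b)%C Ha) as [c [_ Hc]].
  exists c. apply filter_forall.
  change (forall z : C, is_Cpseries c (z - z0)%C (Csum a (z - b)%C)).
  intros z.
  replace (z - b)%C with (z0 - b + (z - z0))%C by ring. apply Hc.
Qed.

Lemma CV_radius_infinite (a : nat -> R) :
  (forall r, 0 <= r -> exists B, forall k, Rabs (a k) * r ^ k <= B) -> CV_radius a = p_infty.
Proof.
  intros H.
  assert (Hb : forall r : R, Rbar_le (Rabs r) (CV_radius a)).
  { intros r. apply (proj1 (CV_radius_bounded a)).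
    destruct (H (Rabs r) (Rabs_pos r)) as [B HB]. exists B. intros n.
    rewrite Rabs_mult, <- RPow_abs, Rabs_Rabsolu. apply HB. }
  destruct (CV_radius a) as [x| |]; auto.
  - specialize (Hb (Rabs x + 1)). simpl in Hb. rewrite Rabs_pos_eq in Hb.
    + pose proof (Rle_abs x); lra.
    + pose proof (Rabs_pos x); lra.
  - destruct (Hb 0).
Qed.

(** * The complex exponential series *)

Definition cexp (w : C) : C := (exp (Re w) * cos (Im w), exp (Re w) * sin (Im w)).

Lemma exp_coef_bound (x L r : R) (k : nat) :
  Rabs x <= L ^ k -> 0 <= L -> 0 <= r -> Rabs (x / INR (fact k)) * r ^ k <= exp (L * r).
Proof.
  intros Hx HL Hr. unfold Rdiv. rewrite Rabs_mult.
  rewrite (Rabs_pos_eq (/ _)) by (left; apply Rinv_0_lt_compat, INR_fact_pos).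
  apply Rle_trans with ((L * r) ^ k / INR (fact k)).
  - rewrite Rpow_mult_distr. unfold Rdiv.
    assert (0 <= / INR (fact k) * r ^ k).
    { apply Rmult_le_pos; [left; apply Rinv_0_lt_compat, INR_fact_pos|apply pow_le; auto]. }
    nra.
  - apply pow_div_fact_le_exp. nra.
Qed.

(** Real form of F' = (u + iv) F: multiplied by exp(-(u+iv)t), F becomes constant, and the two
    expressions fed to [Hc] are the real and imaginary parts of this product. *)
Lemma rotation_ode (F1 F2 : R -> R) (u v : R) :
  (forall t, is_derive F1 t (u * F1 t - v * F2 t)) ->
  (forall t, is_derive F2 t (u * F2 t + v * F1 t)) ->
  F1 0 = 1 -> F2 0 = 0 -> F1 1 = exp u * cos v /\ F2 1 = exp u * sin v.
Proof.
  intros D1 D2 I1 I2.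
  assert (Hc : forall f : R -> R, (forall t, is_derive f t 0) -> f 1 = f 0).
  { intros f Hf. destruct (MVT_gen f 0 1 (fun _ => 0)) as [xi [_ E]]; [auto| |lra].
    intros t _. eapply is_derive_continuity_pt, Hf. }
  assert (E1 : forall t, ex_derive F1 t) by (intros t; eexists; apply D1).
  assert (E2 : forall t, ex_derive F2 t) by (intros t; eexists; apply D2).
  assert (D1' : forall t, Derive F1 t = u * F1 t - v * F2 t) by (intros t; apply is_derive_unique, D1).
  assert (D2' : forall t, Derive F2 t = u * F2 t + v * F1 t) by (intros t; apply is_derive_unique, D2).
  assert (G1 := Hc (fun t => exp (- (u * t)) * (cos (v * t) * F1 t + sin (v * t) * F2 t))
    ltac:(intros t; auto_derive; [repeat split; auto|
      change (Derive (fun x => F1 x) t) with (Derive F1 t);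
      change (Derive (fun x => F2 x) t) with (Derive F2 t); rewrite D1', D2'; ring])).
  assert (G2 := Hc (fun t => exp (- (u * t)) * (cos (v * t) * F2 t - sin (v * t) * F1 t))
    ltac:(intros t; auto_derive; [repeat split; auto|
      change (Derive (fun x => F1 x) t) with (Derive F1 t);
      change (Derive (fun x => F2 x) t) with (Derive F2 t); rewrite D1', D2'; ring])).
  simpl in G1, G2. rewrite I1, I2, !Rmult_0_r, !Rmult_1_r in G1, G2.
  rewrite Ropp_0, exp_0, cos_0, Rplus_0_r in G1. rewrite Ropp_0, exp_0, sin_0 in G2.
  assert (Hcs := sin2_cos2 v). unfold Rsqr in Hcs.
  assert (Hexp : exp u * exp (- u) = 1) by (rewrite <- exp_plus, Rplus_opp_r; apply exp_0).
  split.
  - transitivity (exp u * (cos v * (exp (- u) * (cos v * F1 1 + sin v * F2 1))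
      - sin v * (exp (- u) * (cos v * F2 1 - sin v * F1 1)))).
    + transitivity ((exp u * exp (- u)) * (sin v * sin v + cos v * cos v) * F1 1); [|ring].
      rewrite Hexp, Hcs; ring.
    + rewrite G1, G2. ring.
  - transitivity (exp u * (sin v * (exp (- u) * (cos v * F1 1 + sin v * F2 1))
      + cos v * (exp (- u) * (cos v * F2 1 - sin v * F1 1)))).
    + transitivity ((exp u * exp (- u)) * (sin v * sin v + cos v * cos v) * F2 1); [|ring].
      rewrite Hexp, Hcs; ring.
    + rewrite G1, G2. ring.
Qed.

(** As functions of a real t, the real and imaginary parts of the series of exp(wt) are power series
    that solve the system of [rotation_ode]; the claim is their value at t = 1. *)
Lemma cexp_series (w : C) :
  is_Cseries (fun k => (w ^ k * RtoC (/ INR (fact k)))%C) (cexp w).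
Proof.
  set (al := fun k => Re (w ^ k) / INR (fact k)).
  set (be := fun k => Im (w ^ k) / INR (fact k)).
  set (u := Re w). set (v := Im w).
  assert (Ha : CV_radius al = p_infty).
  { apply CV_radius_infinite. intros r Hr. exists (exp (Cmod w * r)). intros k.
    apply exp_coef_bound; auto; [|apply Cmod_ge_0]. rewrite <- Cmod_pow. apply re_le_Cmod. }
  assert (Hb : CV_radius be = p_infty).
  { apply CV_radius_infinite. intros r Hr. exists (exp (Cmod w * r)). intros k.
    apply exp_coef_bound; auto; [|apply Cmod_ge_0]. rewrite <- Cmod_pow. apply im_le_Cmod. }
  assert (Exa : forall t, ex_pseries al t) by (intros; apply CV_radius_inside; rewrite Ha; exact I).
  assert (Exb : forall t, ex_pseries be t) by (intros; apply CV_radius_inside; rewrite Hb; exact I).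
  assert (Da : forall t, is_derive (PSeries al) t (u * PSeries al t - v * PSeries be t)).
  { intros t. replace (u * PSeries al t - v * PSeries be t) with (PSeries (PS_derive al) t).
    - apply is_derive_PSeries. rewrite Ha; exact I.
    - rewrite <- !PSeries_scal, <- PSeries_minus.
      + apply PSeries_ext. intros k. unfold PS_derive, PS_minus, PS_plus, PS_opp, PS_scal, al, be.
        rewrite fact_simpl, mult_INR. unfold u, v.
        change (INR (S k) * (Re (w * w ^ k) / (INR (S k) * INR (fact k))) =
          Re w * (Re (w ^ k) / INR (fact k)) + - (Im w * (Im (w ^ k) / INR (fact k)))).
        unfold Cmult, Re, Im; simpl fst. simpl snd.
        field. split; [apply INR_fact_neq_0|apply not_0_INR; lia].
      + apply ex_pseries_scal; auto. apply Rmult_comm.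
      + apply ex_pseries_scal; auto. apply Rmult_comm. }
  assert (Db : forall t, is_derive (PSeries be) t (u * PSeries be t + v * PSeries al t)).
  { intros t. replace (u * PSeries be t + v * PSeries al t) with (PSeries (PS_derive be) t).
    - apply is_derive_PSeries. rewrite Hb; exact I.
    - rewrite <- !PSeries_scal, <- PSeries_plus.
      + apply PSeries_ext. intros k. unfold PS_derive, PS_plus, PS_scal, al, be.
        rewrite fact_simpl, mult_INR. unfold u, v.
        change (INR (S k) * (Im (w * w ^ k) / (INR (S k) * INR (fact k))) =
          Re w * (Im (w ^ k) / INR (fact k)) + Im w * (Re (w ^ k) / INR (fact k))).
        unfold Cmult, Re, Im; simpl fst. simpl snd.
        field. split; [apply INR_fact_neq_0|apply not_0_INR; lia].
      + apply ex_pseries_scal; auto. apply Rmult_comm.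
      + apply ex_pseries_scal; auto. apply Rmult_comm. }
  destruct (rotation_ode (PSeries al) (PSeries be) u v Da Db) as [F1 F2].
  { rewrite PSeries_0. unfold al; simpl; field. }
  { rewrite PSeries_0. unfold be; simpl; field. }
  apply is_series_C. unfold cexp. fold u v. rewrite <- F1, <- F2. split.
  - change (is_series (fun k => Re (w ^ k * RtoC (/ INR (fact k)))) (PSeries al 1)).
    eapply is_series_ext; [|exact (proj1 (is_pseries_R al 1 _) (PSeries_correct _ _ (Exa 1)))].
    intros k. cbv beta. unfold al. rewrite pow1, Rmult_1_r, re_scal_r. reflexivity.
  - change (is_series (fun k => Im (w ^ k * RtoC (/ INR (fact k)))) (PSeries be 1)).
    eapply is_series_ext; [|exact (proj1 (is_pseries_R be 1 _) (PSeries_correct _ _ (Exb 1)))].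
    intros k. cbv beta. unfold be. rewrite pow1, Rmult_1_r, im_scal_r. reflexivity.
Qed.

(** * The analytic continuation *)

Lemma Rcpow_pseries (c x : R) (s : C) :
  0 < x ->
  is_Cpseries (fun k => RtoC (pcoef c k x)) s (Rcpow x (- (c + s))%C).
Proof.
  intros Hx. apply is_pseries_C.
  assert (H := cexp_series (s * RtoC (- ln x))%C).
  apply (is_series_scal_l (V := C_NormedModule) (RtoC (Rpower x (- c)))) in H.
  match type of H with is_series _ ?l => replace (Rcpow x (- (c + s))%C) with l end.
  - revert H. apply is_series_ext. intros k.
    change ((RtoC (Rpower x (- c)) * ((s * RtoC (- ln x)) ^ k * RtoC (/ INR (fact k))))%C =
      (RtoC (pcoef c k x) * s ^ k)%C).
    unfold pcoef, Rdiv. rewrite Cpow_mult_l, !RtoC_mult, RtoC_pow. ring.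
  - change ((RtoC (Rpower x (- c)) * cexp (s * RtoC (- ln x)))%C = Rcpow x (- (c + s))%C).
    destruct s as [s1 s2]. unfold cexp, Rcpow, Rpower, Cmult, Cplus, Copp, RtoC, Re, Im; simpl.
    replace (exp (- (c + s1) * ln x)) with (exp (- c * ln x) * exp (s1 * - ln x - s2 * 0)).
    2:{ rewrite <- exp_plus. f_equal. ring. }
    replace (s1 * 0 + s2 * - ln x) with (- (0 + s2) * ln x) by ring.
    f_equal; ring.
Qed.

(* [hurwitz_Z c q s] is (z - 1) zeta(z,q) at [z = c + s]. *)
Definition hurwitz_Z (c q : R) (s : C) : C := Csum (fun k => RtoC (zcoef c k q)) s.

Lemma zcoef_entire (c q : R) : 2 < c -> 0 < q -> entire_coef (fun k => RtoC (zcoef c k q)).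
Proof.
  intros Hc Hq r Hr. destruct (zcoef_loc_bdd (r + 1) c Hc r q q) as [B HB]; [lra|lra|].
  exists B. intros k. rewrite Cmod_R. apply HB. lra.
Qed.

Lemma sum_geom_le (x : R) (N : nat) : 0 <= x < 1 -> sum_n (fun k => x ^ k) N <= / (1 - x).
Proof.
  intros Hx. rewrite <- Series_geom by (rewrite Rabs_pos_eq; lra).
  apply sum_n_le_Series. intros; apply pow_le; lra.
  apply ex_series_geom. rewrite Rabs_pos_eq; lra.
Qed.

(** Inside the disc that touches the pole, expanding each summand about [c] and interchanging the
    sums identifies the Taylor series with the Dirichlet series. *)
Lemma hurwitz_Z_dirichlet (c q : R) (s : C) :
  1 < c -> 0 < q -> Cmod s < c - 1 ->
  exists l : C, is_Cseries (fun n => Rcpow (INR n + q) (- (c + s))%C) l /\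
    hurwitz_Z c q s = ((c - 1 + s) * l)%C.
Proof.
  intros Hc Hq Hs.
  assert (Hs0 := Cmod_ge_0 s).
  (* A radius strictly in between serves twice: the coefficient bound at [r] leaves the exponent c -
     r > 1 in [n], and the ratio [Cmod s / r] below 1 sums over [k]. *)
  set (r := (Cmod s + (c - 1)) / 2).
  assert (Hr : Cmod s < r < c - 1) by (unfold r; lra).
  destruct (pcoef_shift_bound c r q q) as [C0 [HC0 Hb]]; [lra|lra|].
  set (u := fun n k => (RtoC (pcoef c k (INR n + q)) * s ^ k)%C).
  assert (Hx : 0 <= Cmod s / r < 1).
  { split. apply Rdiv_le_0_compat; lra. apply Rmult_lt_reg_r with r; [lra|].
    unfold Rdiv; rewrite Rmult_assoc, Rinv_l; lra. }
  destruct (CSeries_swap u (fun n => C0 * Rpower (INR n + 1) (- (c - r)) * / (1 - Cmod s / r)))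
    as [H1 H2].
  - apply ex_series_scal_r, (ex_series_scal_l (V := R_NormedModule) C0), ex_series_Rpower. lra.
  - intros n K.
    set (W := C0 * Rpower (INR n + 1) (- (c - r))).
    assert (HW : 0 <= W) by (apply Rmult_le_pos; [auto|left; apply Rpower_pos]).
    apply Rle_trans with (sum_n (fun k => W * (Cmod s / r) ^ k) K).
    + rewrite !sum_n_Reals. apply sum_Rle. intros k _. unfold u.
      rewrite Cmod_mult, Cmod_R, Cmod_pow.
      replace (Cmod s ^ k) with (r ^ k * (Cmod s / r) ^ k).
      2:{ rewrite <- Rpow_mult_distr. f_equal. field. lra. }
      rewrite <- Rmult_assoc. apply Rmult_le_compat_r; [apply pow_le; lra|]. apply Hb. lra.
    + apply Rle_trans with (W * sum_n (fun k => (Cmod s / r) ^ k) K).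
      * right. apply (sum_n_mult_l (K := R_Ring) W (fun k => (Cmod s / r) ^ k) K).
      * apply Rmult_le_compat_l; auto. now apply sum_geom_le.
  - set (S := CSeries (fun n => CSeries (u n))) in *.
    exists S. split.
    + revert H1. apply is_series_ext. intros n. symmetry. apply is_series_C_unique.
      apply (is_pseries_C (fun k => RtoC (pcoef c k (INR n + q)))).
      apply Rcpow_pseries. pose proof (pos_INR n); lra.
    + symmetry. apply is_pseries_C_unique.
      assert (Hh : is_Cpseries (fun k => RtoC (hcoef c k q)) s S).
      { apply is_pseries_C. revert H2. apply is_series_ext. intros k. symmetry.
        apply is_series_C_unique. apply is_series_C. unfold u. split.
        - eapply is_series_ext; [|rewrite re_scal_l; apply is_series_scal_r, Series_correct, (pcoef_ex_series c q k Hc Hq)].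
          intros n. cbv beta. now rewrite re_scal_l.
        - eapply is_series_ext; [|rewrite im_scal_l; apply is_series_scal_r, Series_correct, (pcoef_ex_series c q k Hc Hq)].
          intros n. cbv beta. now rewrite im_scal_l. }
      assert (P1 := is_pseries_scal (V := C_NormedModule) (RtoC (c - 1)) _ s _ (Cmult_comm _ _) Hh).
      assert (P2 := is_pseries_incr_1 (V := C_NormedModule) _ s _ Hh).
      assert (P3 := is_pseries_plus (V := C_NormedModule) _ _ s _ _ P1 P2).
      match type of P3 with is_pseries _ _ ?l => replace ((c - 1 + s) * S)%C with l end.
      * revert P3. apply is_pseries_ext. intros k. unfold zcoef, mulz. rewrite RtoC_plus, RtoC_mult.
        destruct k; reflexivity.
      * change ((RtoC (c - 1) * S + s * S) = (c - 1 + s) * S)%C. rewrite RtoC_minus. ring.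
Qed.

Lemma locally_Cmod_lt (w b : C) (d : R) :
  Cmod (w - b) < d -> @locally C_UniformSpace w (fun y => Cmod (y - b) < d).
Proof.
  intros H. apply (proj2 (locally_Cmod w (fun y => Cmod (y - b) < d))).
  exists (d - Cmod (w - b)). split; [lra|]. intros h Hh.
  replace (w + h - b)%C with ((w - b) + h)%C by ring.
  eapply Rle_lt_trans; [apply Cmod_triangle|]. lra.
Qed.

(** Near z = c both sides equal (z-1) times the Dirichlet series, c being inside the disc about c'
    because c' - c < c' - 1; entire functions that agree there agree everywhere. *)
Lemma hurwitz_Z_center_le (c c' q : R) (z : C) :
  2 < c <= c' -> 0 < q -> hurwitz_Z c q (z - c) = hurwitz_Z c' q (z - c').
Proof.
  intros Hc Hq.
  assert (Hdisc : forall y : C, Cmod (y - c) < c - 1 -> Cmod (y - c') < c' - 1 ->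
    hurwitz_Z c q (y - c) = hurwitz_Z c' q (y - c')).
  { intros y Hy Hy'.
    destruct (hurwitz_Z_dirichlet c q (y - c)) as [S [HS ->]]; [lra|auto|auto|].
    destruct (hurwitz_Z_dirichlet c' q (y - c')) as [S' [HS' ->]]; [lra|auto|auto|].
    replace (c + (y - c))%C with y in HS by ring.
    replace (c' + (y - c'))%C with y in HS' by ring.
    rewrite (is_series_C_unique _ _ HS), (is_series_C_unique _ _ HS'). ring. }
  apply (identity_segment (fun z => hurwitz_Z c q (z - c)) (fun z => hurwitz_Z c' q (z - c')) (RtoC c)).
  - intros t _. apply Csum_analytic, zcoef_entire; lra.
  - intros t _. apply Csum_analytic, zcoef_entire; lra.
  - assert (H1 : Cmod (c - c) < c - 1) by (replace (c - c)%C with (RtoC 0) by ring; rewrite Cmod_0; lra).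
    assert (H2 : Cmod (c - c') < c' - 1) by (rewrite <- RtoC_minus, Cmod_R, Rabs_left1; lra).
    generalize (filter_and (F := @locally C_UniformSpace (RtoC c)) _ _
      (locally_Cmod_lt _ _ _ H1) (locally_Cmod_lt _ _ _ H2)).
    apply filter_imp. intros y [Hy Hy']. now apply Hdisc.
Qed.

Lemma hurwitz_Z_center (c c' q : R) (z : C) :
  2 < c -> 2 < c' -> 0 < q -> hurwitz_Z c q (z - c) = hurwitz_Z c' q (z - c').
Proof.
  intros Hc Hc' Hq. destruct (Rle_dec c c').
  - apply hurwitz_Z_center_le; lra.
  - symmetry. apply hurwitz_Z_center_le; lra.
Qed.

Lemma disc_in_half_plane (z : C) : 1 < Re z -> exists c, 2 < c /\ Cmod (z - c) < c - 1.
Proof.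
  intros Hz. destruct z as [x y]; simpl in Hz.
  (* The modulus condition amounts to x^2 + y^2 - 1 < 2c(x-1); this [c] satisfies (c-3)(x-1) = x^2 +
     y^2 and exceeds 2. *)
  set (c := 3 + (y ^ 2 + x ^ 2) / (x - 1)).
  assert (H0 : 0 <= (y ^ 2 + x ^ 2) / (x - 1)).
  { apply Rdiv_le_0_compat; [|lra]. pose proof (pow2_ge_0 y); pose proof (pow2_ge_0 x); lra. }
  exists c. split; [unfold c; lra|].
  assert (Hc : (c - 3) * (x - 1) = y ^ 2 + x ^ 2) by (unfold c; field; lra).
  unfold Cmod; simpl fst; simpl snd.
  rewrite <- (sqrt_pow2 (c - 1)) by (unfold c; lra).
  apply sqrt_lt_1_alt. 
  pose proof (pow2_ge_0 (x + - c)). pose proof (pow2_ge_0 (y + - 0)).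
  split; [lra|]. assert (3 <= c) by (unfold c; lra).
  pose proof (pow2_ge_0 y). nra.
Qed.

Definition hurwitz_cont (q : R) (z : C) : C := (hurwitz_Z 3 q (z - RtoC 3) / (z - RtoC 1))%C.

Lemma Cseq_geom (x : C) : Cmod x < 1 ->
  is_Cseries (fun k => (x ^ k)%C) (/ (1 - x))%C.
Proof.
  intros Hx.
  assert (Hn : (1 - x)%C <> RtoC 0).
  { intros E. assert (x = RtoC 1) by (replace x with (1 - (1 - x))%C by ring; rewrite E; ring).
    subst. rewrite Cmod_1 in Hx; lra. }
  assert (Hs := CSeries_correct (fun k => (x ^ k)%C)).
  assert (Hs' : is_Cseries (fun k => (x ^ k)%C) (CSeries (fun k => (x ^ k)%C))).
  { apply Hs. eapply ex_series_ext; [|apply (ex_series_geom (Cmod x))].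
    - intros k; simpl; now rewrite Cmod_pow.
    - rewrite Rabs_pos_eq; auto. apply Cmod_ge_0. }
  set (l := CSeries (fun k => (x ^ k)%C)) in *.
  assert (H1 := is_series_scal_l (V := C_NormedModule) x _ _ Hs').
  assert (E : (l - 1)%C = (x * l)%C).
  { assert (H2 : is_Cseries (fun k => (x ^ S k)%C) (l - 1)%C).
    { apply (is_series_incr_1 (V := C_NormedModule) (fun k => (x ^ k)%C)).
      change (is_series (V := C_NormedModule) (fun k => (x ^ k)%C) (l - 1 + 1)%C).
      replace (l - 1 + 1)%C with l by ring. exact Hs'. }
    exact (filterlim_locally_unique (F := eventually) _ _ _ H2 H1). }
  replace (/ (1 - x))%C with l; auto.
  assert (E2 : ((1 - x) * l)%C = RtoC 1).
  { replace ((1 - x) * l)%C with (l - x * l)%C by ring. rewrite <- E. ring. }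
  replace l with ((1 - x) * l / (1 - x))%C by (field; auto). rewrite E2. unfold Cdiv. ring.
Qed.

Lemma analytic_at_inv (b z0 : C) : z0 <> b -> analytic_at (fun z => / (z - b))%C z0.
Proof.
  intros Hz.
  assert (Hd : (z0 - b)%C <> RtoC 0) by now apply Cminus_eq_contra.
  exists (fun k => (/ (z0 - b) * (- / (z0 - b)) ^ k)%C).
  apply locally_Cmod. exists (Cmod (z0 - b)). split; [now apply Cmod_gt_0|]. intros h Hh.
  apply is_pseries_C.
  assert (Hx : Cmod (- / (z0 - b) * h) < 1).
  { rewrite Cmod_mult, Cmod_opp, Cmod_inv by auto.
    apply Rmult_lt_reg_l with (Cmod (z0 - b)); [now apply Cmod_gt_0|].
    rewrite <- Rmult_assoc, Rinv_r; [lra|]. apply Rgt_not_eq. now apply Cmod_gt_0. }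
  assert (H := is_series_scal_l (V := C_NormedModule) (/ (z0 - b))%C _ _ (Cseq_geom _ Hx)).
  match type of H with is_series _ ?l => replace (/ (z0 + h - b))%C with l end.
  - revert H. apply is_series_ext. intros k.
    change ((/ (z0 - b) * (- / (z0 - b) * h) ^ k)%C =
      (/ (z0 - b) * (- / (z0 - b)) ^ k * (z0 + h - z0) ^ k)%C).
    replace (z0 + h - z0)%C with h by ring. rewrite Cpow_mult_l. ring.
  - change ((/ (z0 - b) * / (1 - - / (z0 - b) * h))%C = (/ (z0 + h - b))%C).
    assert (Hn : (z0 - b + h)%C <> RtoC 0).
    { intros E. assert (h = (- (z0 - b))%C) by (replace h with (z0 - b + h - (z0 - b))%C by ring; rewrite E; ring).
      subst h. rewrite Cmod_opp in Hh. lra. }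
    assert (Hn' : (z0 + h - b)%C <> RtoC 0) by (replace (z0 + h - b)%C with (z0 - b + h)%C by ring; auto).
    field. split; auto. 
Qed.

Lemma analytic_at_plus (f g : C -> C) (z0 : C) :
  analytic_at f z0 -> analytic_at g z0 -> analytic_at (fun z => f z + g z)%C z0.
Proof.
  intros [c Hc] [d Hd]. exists (PS_plus c d).
  generalize (filter_and (F := @locally C_UniformSpace z0) _ _ Hc Hd). apply filter_imp.
  intros z [H1 H2]. exact (is_pseries_plus (V := C_NormedModule) c d _ _ _ H1 H2).
Qed.

Lemma analytic_at_scal (s : C) (f : C -> C) (z0 : C) :
  analytic_at f z0 -> analytic_at (fun z => s * f z)%C z0.
Proof.
  intros [c Hc]. exists (PS_scal s c). revert Hc. apply filter_imp.
  intros z H. exact (is_pseries_scal (V := C_NormedModule) s c _ _ (Cmult_comm _ _) H).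
Qed.

Lemma analytic_at_ext (f g : C -> C) (z0 : C) :
  @locally C_UniformSpace z0 (fun z => f z = g z) -> analytic_at f z0 -> analytic_at g z0.
Proof.
  intros H [c Hc]. exists c.
  generalize (filter_and (F := @locally C_UniformSpace z0) _ _ H Hc). apply filter_imp.
  intros z [H1 H2]. now rewrite <- H1.
Qed.

Lemma locally_neq (z0 b : C) : z0 <> b -> @locally C_UniformSpace z0 (fun z => z <> b).
Proof.
  intros H. apply locally_Cmod. exists (Cmod (z0 - b)).
  split; [now apply Cmod_gt_0, Cminus_eq_contra|]. intros h Hh E.
  replace h with (- (z0 - b))%C in Hh by (rewrite <- E; ring). rewrite Cmod_opp in Hh. lra.
Qed.

(** Recentring Z at 1 and dividing by z - 1 leaves [c 0] over z - 1 plus an entire series, which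
    avoids products of power series. *)
Lemma hurwitz_cont_analytic (q : R) (z0 : C) :
  0 < q -> z0 <> RtoC 1 -> analytic_at (hurwitz_cont q) z0.
Proof.
  intros Hq Hz0.
  set (a := fun k => RtoC (zcoef 3 k q)).
  assert (Ha : entire_coef a) by (apply zcoef_entire; lra).
  destruct (Csum_recenter a (RtoC 1 - RtoC 3)%C Ha) as [c [Hc Hs]].
  assert (Hw : entire_coef (fun k => c (S k))).
  { intros r Hr. destruct (Hc (r + 1)) as [B HB]; [lra|]. exists B. intros k.
    eapply Rle_trans; [|apply (HB (S k))]. apply Rmult_le_compat_l; [apply Cmod_ge_0|].
    simpl. assert (r ^ k <= (r + 1) ^ k) by (apply pow_incr; lra).
    assert (0 <= (r + 1) ^ k) by (apply pow_le; lra). nra. }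
  apply analytic_at_ext with
    (fun z => (c 0%nat * / (z - RtoC 1) + Csum (fun k => c (S k)) (z - RtoC 1))%C).
  - assert (E : forall z : C, z <> RtoC 1 ->
      (c 0%nat * / (z - RtoC 1) + Csum (fun k => c (S k)) (z - RtoC 1))%C = hurwitz_cont q z).
    { intros z Hz. unfold hurwitz_cont, hurwitz_Z. fold a.
      assert (Hz' : (z - RtoC 1)%C <> RtoC 0) by now apply Cminus_eq_contra.
      destruct (pseries_C_decr c (z - RtoC 1)%C _ (Hs (z - RtoC 1)%C)) as [v [Hv E]].
      rewrite <- (is_pseries_C_unique _ _ _ Hv).
      replace (RtoC 1 - RtoC 3 + (z - RtoC 1))%C with (z - RtoC 3)%C in E by ring.
      rewrite E. field. auto. }
    generalize (locally_neq z0 _ Hz0). apply filter_imp. intros z Hz. now apply E.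
  - apply analytic_at_plus.
    + apply analytic_at_scal. now apply analytic_at_inv.
    + now apply Csum_analytic.
Qed.

Lemma hurwitz_cont_spec (q : R) : 0 < q -> is_hurwitz_continuation q (hurwitz_cont q).
Proof.
  intros Hq. split.
  - intros z Hz. destruct (disc_in_half_plane z Hz) as [c [Hc Hd]].
    destruct (hurwitz_Z_dirichlet c q (z - c) ltac:(lra) Hq Hd) as [S [HS E]].
    replace (c + (z - c))%C with z in HS by ring.
    assert (Hz1 : (z - RtoC 1)%C <> RtoC 0).
    { apply Cminus_eq_contra. intros ->. simpl in Hz; lra. }
    replace (hurwitz_cont q z) with S; auto.
    unfold hurwitz_cont. rewrite (hurwitz_Z_center 3 c q z) by lra. rewrite E.
    replace (c - 1 + (z - c))%C with (z - RtoC 1)%C by ring. field. auto.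
  - intros z0 Hz0. now apply hurwitz_cont_analytic.
Qed.

(** The segment starts from 2 + i or 2 - i, whichever lies on the same side of the real axis as [z]:
    it then meets the axis at most in [z] itself, so it misses 1. *)
Lemma hurwitz_continuation_unique (q : R) (f g : C -> C) (z : C) :
  is_hurwitz_continuation q f -> is_hurwitz_continuation q g -> z <> RtoC 1 -> f z = g z.
Proof.
  intros [Hf1 Hf2] [Hg1 Hg2] Hz.
  set (sg := if Rle_dec 0 (Im z) then 1 else -1).
  set (w := ((2, sg) : C)).
  assert (Hav : forall t, 0 <= t <= 1 -> (w + t * (z - w))%C <> RtoC 1).
  { intros t Ht E. 
    assert (EI : Im (w + t * (z - w))%C = 0) by (rewrite E; reflexivity).
    assert (EI' : sg + t * (Im z - sg) = 0).
    { rewrite <- EI. unfold w. destruct z as [x y]. simpl. ring. }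
    assert (t = 1).
    { unfold sg in EI'. destruct (Rle_dec 0 (Im z)); nra. }
    subst t. apply Hz. rewrite <- E. ring. }
  apply (identity_segment f g w z).
  - intros t Ht. apply Hf2, Hav, Ht.
  - intros t Ht. apply Hg2, Hav, Ht.
  - assert (Hfg : forall y : C, 1 < Re y -> f y = g y).
    { intros y Hy. rewrite (is_series_C_unique _ _ (Hf1 y Hy)).
      now rewrite (is_series_C_unique _ _ (Hg1 y Hy)). }
    apply locally_Cmod. exists 1. split; [lra|]. intros h Hh. apply Hfg.
    change (1 < 2 + Re h). pose proof (Rle_abs (- Re h)) as H'. rewrite Rabs_Ropp in H'.
    pose proof (re_le_Cmod h). lra.
Qed.

(** [hurwitz_cont] shows that the choice in [hurwitz_zeta] is not vacuous, and uniqueness identifies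
    the chosen function away from 1. *)
Lemma hurwitz_zeta_eq (q : R) (z : C) :
  0 < q -> z <> RtoC 1 -> hurwitz_zeta z q = hurwitz_cont q z.
Proof.
  intros Hq Hz. unfold hurwitz_zeta. apply (hurwitz_continuation_unique q); auto.
  - apply (epsilon_spec (inhabits (fun _ : C => RtoC 0)) (is_hurwitz_continuation q)).
    exists (hurwitz_cont q). now apply hurwitz_cont_spec.
  - now apply hurwitz_cont_spec.
Qed.

(* (x - 1) zeta(x,q) for real [x], including its value at the pole [x = 1]. *)
Definition zeta_num (q x : R) : R := PSeries (fun k => zcoef 3 k q) (x - 3).

Lemma zcoef_CV_radius (c q : R) :
  2 < c -> 0 < q -> CV_radius (fun k => zcoef c k q) = p_infty.
Proof.
  intros Hc Hq. apply CV_radius_infinite. intros r Hr.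
  destruct (zcoef_entire c q Hc Hq r Hr) as [B HB]. exists B. intros k.
  rewrite <- Cmod_R. apply HB.
Qed.

Lemma is_pseries_RtoC (a : nat -> R) (s l : R) :
  is_pseries a s l ->
  is_Cpseries (fun k => RtoC (a k)) (RtoC s) (RtoC l).
Proof.
  intros H. apply is_pseries_R in H.
  apply is_pseries_C, is_series_C. split.
  - eapply is_series_ext; [|exact H]. intros k. cbv beta. now rewrite <- RtoC_pow, <- RtoC_mult.
  - eapply is_series_ext with (a := fun _ => 0).
    + intros k. rewrite <- RtoC_pow, <- RtoC_mult. reflexivity.
    + apply filterlim_ext with (fun _ => 0).
      { intros n. rewrite sum_n_const. ring. }
      apply filterlim_const.
Qed.

Lemma hurwitz_Z_real (c q s : R) :
  2 < c -> 0 < q -> hurwitz_Z c q (RtoC s) = RtoC (PSeries (fun k => zcoef c k q) s).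
Proof.
  intros Hc Hq. unfold hurwitz_Z. symmetry. apply is_pseries_C_unique.
  apply is_pseries_RtoC, PSeries_correct, CV_radius_inside.
  rewrite zcoef_CV_radius; auto. exact I.
Qed.

Lemma hurwitz_cont_real (q x : R) :
  0 < q -> x <> 1 -> hurwitz_cont q (RtoC x) = RtoC (zeta_num q x / (x - 1)).
Proof.
  intros Hq Hx. unfold hurwitz_cont. rewrite <- !RtoC_minus, RtoC_div by lra.
  f_equal. apply hurwitz_Z_real; lra.
Qed.

(** Independence of the centre, known for complex arguments, is pulled back along the embedding of
    the reals. *)
Lemma zeta_num_center (c q x : R) :
  2 < c -> 0 < q -> zeta_num q x = PSeries (fun k => zcoef c k q) (x - c).
Proof.
  intros Hc Hq. apply RtoC_inj. unfold zeta_num.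
  rewrite <- !hurwitz_Z_real by lra. rewrite !RtoC_minus. apply hurwitz_Z_center; lra.
Qed.

Lemma negapolygamma_A_eq (k : nat) (q : R) :
  (1 <= k)%nat -> 0 < q ->
  negapolygamma_A k q = INR k * Derive (fun x => zeta_num q x / (x - 1)) (1 - INR k).
Proof.
  intros Hk Hq. unfold negapolygamma_A. f_equal.
  assert (Hk1 : 1 <= INR k) by (apply (le_INR 1); auto).
  set (x := 1 - INR k). assert (Hx : x <> 1) by (unfold x; lra).
  assert (Hx' : RtoC x <> RtoC 1) by (intros E; apply RtoC_inj in E; auto).
  assert (Han : analytic_at (fun z => hurwitz_zeta z q) (RtoC x)).
  { apply analytic_at_ext with (hurwitz_cont q).
    - generalize (locally_neq (RtoC x) (RtoC 1) Hx'). apply filter_imp.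
      intros z Hz. symmetry. now apply hurwitz_zeta_eq.
    - now apply hurwitz_cont_analytic. }
  symmetry. rewrite <- (is_derive_unique _ _ _ (Re_C_derive _ _ Han)).
  apply Derive_ext_loc.
  (* Within [1 - x] of [x] the real variable stays below the pole. *)
  assert (Hd : 0 < 1 - x) by (unfold x; lra).
  exists (mkposreal _ Hd). intros y Hy.
  change (Rabs (y - x) < 1 - x) in Hy. pose proof (Rle_abs (y - x)).
  rewrite hurwitz_zeta_eq, hurwitz_cont_real; auto; try lra.
  intros E; apply RtoC_inj in E; lra.
Qed.

(** * Dependence on q over the reals *)

Definition entire_family (a : nat -> R -> R) : Prop := forall rho, loc_bdd rho a.

Lemma entire_family_CV_radius (a : nat -> R -> R) (q : R) :
  entire_family a -> 0 < q -> CV_radius (fun k => a k q) = p_infty.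
Proof.
  intros Ha Hq. apply CV_radius_infinite. intros r Hr.
  destruct (Ha (r + 1) r q q) as [B HB]; [lra|lra|]. exists B. intros k. apply HB; lra.
Qed.

Lemma entire_family_ex_pseries (a : nat -> R -> R) (q s : R) :
  entire_family a -> 0 < q -> ex_pseries (fun k => a k q) s.
Proof.
  intros Ha Hq. apply CV_radius_inside. rewrite entire_family_CV_radius; auto. exact I.
Qed.

(** [d], the second derivative in [q], is bounded at radius [2 * Rabs s], so its terms at [s] have
    the geometric majorant B (1/2)^k asked for by [is_derive_Series]. *)
Lemma is_derive_PSeries_param (a b d : nat -> R -> R) (q s : R) :
  entire_family a -> entire_family b -> entire_family d ->
  (forall k y, 0 < y -> is_derive (a k) y (b k y)) ->
  (forall k y, 0 < y -> is_derive (b k) y (d k y)) ->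
  0 < q ->
  is_derive (fun y => PSeries (fun k => a k y) s) q (PSeries (fun k => b k q) s).
Proof.
  intros Ha Hb Hd Dab Dbd Hq.
  assert (Hs := Rabs_pos s).
  destruct (Hd (2 * Rabs s + 1) (2 * Rabs s) (q / 2) (2 * q)) as [B HB]; [lra|lra|].
  assert (Hpos : forall y, Rabs (y - q) < q / 2 -> q / 2 <= y <= 2 * q).
  { intros y Hy. apply Rabs_def2 in Hy. lra. }
  assert (H2 : forall k, (1 / 2) ^ k * 2 ^ k = 1).
  { intros k. rewrite <- Rpow_mult_distr. replace (1 / 2 * 2) with 1 by field. apply pow1. }
  unfold PSeries.
  apply (is_derive_Series (fun k y => a k y * s ^ k) (fun k y => b k y * s ^ k)
    (fun k y => d k y * s ^ k) (fun k => B * (1 / 2) ^ k) q (q / 2)); [lra| | | | | |].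
  - apply (ex_series_scal_l (V := R_NormedModule) B). apply ex_series_geom.
    rewrite Rabs_pos_eq; lra.
  - intros k y Hy. specialize (Hpos y Hy).
    apply (is_derive_ext (fun y => s ^ k * a k y)); [intros; apply Rmult_comm|].
    rewrite Rmult_comm. apply (is_derive_scal (a k)). apply Dab; lra.
  - intros k y Hy. specialize (Hpos y Hy).
    apply (is_derive_ext (fun y => s ^ k * b k y)); [intros; apply Rmult_comm|].
    rewrite Rmult_comm. apply (is_derive_scal (b k)). apply Dbd; lra.
  - intros k y Hy. specialize (Hpos y Hy). specialize (HB k y Hpos).
    rewrite Rabs_mult, <- RPow_abs. rewrite Rpow_mult_distr in HB.
    assert (0 < (1 / 2) ^ k) by (apply pow_lt; lra).
    replace (Rabs (d k y) * Rabs s ^ k) with (Rabs (d k y) * (2 ^ k * Rabs s ^ k) * (1 / 2) ^ k).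
    + apply Rmult_le_compat_r; lra.
    + transitivity (Rabs (d k y) * Rabs s ^ k * ((1 / 2) ^ k * 2 ^ k)); [ring|]. rewrite H2; ring.
  - intros y Hy. specialize (Hpos y Hy).
    apply (ex_pseries_R (fun k => a k y)), entire_family_ex_pseries; auto; lra.
  - apply (ex_pseries_R (fun k => b k q)), entire_family_ex_pseries; auto.
Qed.

Lemma INR_S_le_pow2 (k : nat) : INR (S k) <= 2 ^ k.
Proof.
  induction k; [simpl; lra|]. rewrite S_INR. simpl pow.
  assert (1 <= 2 ^ k) by (apply pow_R1_Rle; lra). lra.
Qed.

(** The factor k + 1 of the derived series is at most 2^k and is paid for by the larger radius 2r +
    1. *)
Lemma entire_family_PS_derive (a : nat -> R -> R) :
  entire_family a -> entire_family (fun k q => PS_derive (fun j => a j q) k).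
Proof.
  intros Ha rho r x y Hr Hx.
  destruct (Ha (2 * r + 1 + 1) (2 * r + 1) x y) as [B HB]; [lra|auto|].
  exists B. intros k q Hq. specialize (HB (S k) q Hq). unfold PS_derive.
  eapply Rle_trans; [|apply HB].
  rewrite Rabs_mult, (Rabs_pos_eq (INR _)) by apply pos_INR.
  simpl pow.
  assert (H1 := INR_S_le_pow2 k). assert (H2 := Rabs_pos (a (S k) q)).
  assert (H3 : 0 <= r ^ k) by (apply pow_le; lra).
  assert (H4 : (2 * r) ^ k <= (2 * r + 1) ^ k) by (apply pow_incr; lra).
  rewrite Rpow_mult_distr in H4.
  assert (H5 : INR (S k) * r ^ k <= (2 * r + 1) * (2 * r + 1) ^ k).
  { apply Rle_trans with (2 ^ k * r ^ k); [nra|].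
    assert (0 <= (2 * r + 1) ^ k) by (apply pow_le; lra). nra. }
  replace (INR (S k) * Rabs (a (S k) q) * r ^ k) with (Rabs (a (S k) q) * (INR (S k) * r ^ k)) by ring.
  apply Rmult_le_compat_l; auto.
Qed.

Lemma entire_family_zcoef (c : R) : 2 < c -> entire_family (zcoef c).
Proof. intros Hc rho. now apply zcoef_loc_bdd. Qed.

Lemma entire_family_mulz (c : R) (a : nat -> R -> R) :
  entire_family a -> entire_family (fun k q => mulz c (fun j => a j q) k).
Proof. intros Ha rho. now apply loc_bdd_mulz. Qed.

Lemma entire_family_opp (a : nat -> R -> R) :
  entire_family a -> entire_family (fun k q => - a k q).
Proof.
  intros Ha rho r x y Hr Hx. destruct (Ha rho r x y Hr Hx) as [B HB].
  exists B. intros k q Hq. rewrite Rabs_Ropp. now apply HB.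
Qed.

Lemma is_pseries_mulz (c s l : R) (u : nat -> R) :
  is_pseries u s l -> is_pseries (mulz c u) s ((c + s) * l).
Proof.
  intros H.
  assert (H1 := is_pseries_scal (V := R_NormedModule) c u s l (Rmult_comm _ _) H).
  assert (H2 := is_pseries_incr_1 (V := R_NormedModule) u s l H).
  assert (H3 := is_pseries_plus (V := R_NormedModule) _ _ s _ _ H1 H2).
  replace ((c + s) * l) with (plus (scal c l) (scal s l)) by (symmetry; apply Rmult_plus_distr_r).
  revert H3. apply is_pseries_ext. intros [|k]; reflexivity.
Qed.

Lemma PSeries_mulz (c s : R) (u : nat -> R) :
  ex_pseries u s -> PSeries (mulz c u) s = (c + s) * PSeries u s.
Proof. intros H. apply is_pseries_unique, is_pseries_mulz, PSeries_correct, H. Qed.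

(** At the centre 3 multiplication by z - 1 is [mulz 2]; the coefficients of Z(z+1,q) sit at the
    centre 4. *)
Definition zcoef_dq (k : nat) (q : R) : R := - mulz 2 (fun j => zcoef 4 j q) k.

Lemma zcoef_is_derive_dq (k : nat) (q : R) : 0 < q -> is_derive (zcoef 3 k) q (zcoef_dq k q).
Proof.
  intros Hq. assert (H := zcoef_derive 3 q k ltac:(lra) Hq).
  unfold zcoef_dq. replace 2 with (3 - 1) by ring. replace 4 with (3 + 1) by ring. exact H.
Qed.

Lemma zcoef_dq_is_derive (k : nat) (q : R) :
  0 < q -> is_derive (zcoef_dq k) q (- mulz 2 (fun j => - mulz 3 (fun i => zcoef 5 i q) j) k).
Proof.
  intros Hq. apply (is_derive_opp (fun q => mulz 2 (fun j => zcoef 4 j q) k)).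
  apply (is_derive_mulz 2 (zcoef 4)). intros j.
  assert (H := zcoef_derive 4 q j ltac:(lra) Hq).
  replace 3 with (4 - 1) by ring. replace 5 with (4 + 1) by ring. exact H.
Qed.

Lemma entire_family_zcoef_dq : entire_family zcoef_dq.
Proof. apply entire_family_opp, entire_family_mulz, entire_family_zcoef; lra. Qed.

(** With [s = x - 3] the argument [s + 4] is x + 1; [zeta_num_center] replaces the centre 4 by 3. *)
Lemma PSeries_zcoef_dq (q s : R) :
  0 < q -> PSeries (fun k => zcoef_dq k q) s = - ((2 + s) * zeta_num q (s + 4)).
Proof.
  intros Hq. rewrite (zeta_num_center 4 q) by lra. replace (s + 4 - 4) with s by ring.
  rewrite <- PSeries_mulz by (apply entire_family_ex_pseries; auto; apply entire_family_zcoef; lra).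
  rewrite <- PSeries_opp. apply PSeries_ext. reflexivity.
Qed.

Lemma zeta_num_dq (q x : R) :
  0 < q -> is_derive (fun q => zeta_num q x) q (- ((x - 1) * zeta_num q (x + 1))).
Proof.
  intros Hq. unfold zeta_num at 1.
  replace (- ((x - 1) * zeta_num q (x + 1))) with (PSeries (fun k => zcoef_dq k q) (x - 3)).
  2:{ rewrite PSeries_zcoef_dq by auto. replace (x - 3 + 4) with (x + 1) by ring. ring. }
  apply (is_derive_PSeries_param (zcoef 3) zcoef_dq
    (fun k q => - mulz 2 (fun j => - mulz 3 (fun i => zcoef 5 i q) j) k)); auto.
  - apply entire_family_zcoef; lra.
  - apply entire_family_zcoef_dq.
  - apply entire_family_opp, (entire_family_mulz 2 (fun j q => - mulz 3 (fun i => zcoef 5 i q) j)),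
      entire_family_opp, entire_family_mulz, entire_family_zcoef; lra.
  - intros k y Hy. now apply zcoef_is_derive_dq.
  - intros k y Hy. now apply zcoef_dq_is_derive.
Qed.

Definition zeta_num' (q x : R) : R := PSeries (PS_derive (fun k => zcoef 3 k q)) (x - 3).

Lemma is_derive_zeta_num (q x : R) : 0 < q -> is_derive (zeta_num q) x (zeta_num' q x).
Proof.
  intros Hq.
  assert (H : is_derive (PSeries (fun k => zcoef 3 k q)) (x - 3) (zeta_num' q x)).
  { apply is_derive_PSeries. rewrite zcoef_CV_radius by lra. exact I. }
  apply (is_derive_comp _ (fun x => x - 3) x _ 1) in H; [|auto_derive; auto].
  unfold scal in H; simpl in H; unfold mult in H; simpl in H. rewrite Rmult_1_l in H. exact H.
Qed.

Lemma is_derive_scal_fun (f g : R -> R) (k : R) (x l : R) :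
  is_derive f x l -> (forall t, g t = k * f t) -> is_derive g x (k * l).
Proof.
  intros H E. apply is_derive_ext with (fun t => k * f t); [intros; now rewrite E|].
  now apply is_derive_scal.
Qed.

(** The derivatives in q and in x commute because both act on coefficients; the derived series is
    then recognised as the x-derivative of the value in [zeta_num_dq]. *)
Lemma zeta_num'_dq (q x : R) :
  0 < q -> is_derive (fun q => zeta_num' q x) q
    (- (zeta_num q (x + 1) + (x - 1) * zeta_num' q (x + 1))).
Proof.
  intros Hq. unfold zeta_num' at 1.
  replace (- (zeta_num q (x + 1) + (x - 1) * zeta_num' q (x + 1)))
    with (PSeries (PS_derive (fun k => zcoef_dq k q)) (x - 3)).
  - apply (is_derive_PSeries_param (fun k q => PS_derive (fun j => zcoef 3 j q) k)
      (fun k q => PS_derive (fun j => zcoef_dq j q) k)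
      (fun k q => PS_derive (fun j => - mulz 2 (fun j => - mulz 3 (fun i => zcoef 5 i q) j) j) k)); auto.
    + apply entire_family_PS_derive, entire_family_zcoef; lra.
    + apply entire_family_PS_derive, entire_family_zcoef_dq.
    + apply (entire_family_PS_derive (fun j q => - mulz 2 (fun j => - mulz 3 (fun i => zcoef 5 i q) j) j)).
      apply entire_family_opp, (entire_family_mulz 2 (fun j q => - mulz 3 (fun i => zcoef 5 i q) j)),
        entire_family_opp, entire_family_mulz, entire_family_zcoef; lra.
    + intros k y Hy. apply is_derive_scal_fun with (zcoef 3 (S k)); [|reflexivity].
      now apply zcoef_is_derive_dq.
    + intros k y Hy. apply is_derive_scal_fun with (zcoef_dq (S k)); [|reflexivity].
      now apply zcoef_dq_is_derive.
  - rewrite <- Derive_PSeries.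
    2:{ rewrite entire_family_CV_radius; auto. exact I. apply entire_family_zcoef_dq. }
    apply is_derive_unique.
    apply is_derive_ext with (fun s => - ((2 + s) * zeta_num q (s + 4))).
    { intros s. now rewrite PSeries_zcoef_dq. }
    assert (H := is_derive_zeta_num q (x + 1) Hq).
    assert (E : ex_derive (zeta_num q) (x - 3 + 4)).
    { replace (x - 3 + 4) with (x + 1) by ring. eexists; apply H. }
    auto_derive; auto.
    change (fun x0 => zeta_num q x0) with (zeta_num q).
    replace (x - 3 + 4) with (x + 1) by ring. rewrite (is_derive_unique _ _ _ H). ring.
Qed.

Lemma pcoef_pseries (c x s : R) : is_pseries (fun k => pcoef c k x) s (Rpower x (- (c + s))).
Proof.
  assert (H := is_exp_Reals (s * - ln x)). apply is_pseries_R in H.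
  apply (is_series_scal_l (V := R_NormedModule) (Rpower x (- c))) in H.
  apply is_pseries_R.
  match type of H with is_series _ ?l => replace (Rpower x (- (c + s))) with l end.
  - revert H. apply is_series_ext. intros k. unfold pcoef, scal; simpl; unfold mult; simpl.
    rewrite Rpow_mult_distr. unfold Rdiv. ring.
  - unfold scal; simpl; unfold mult; simpl. unfold Rpower. rewrite <- exp_plus. f_equal. ring.
Qed.

Lemma zeta_num_shift (q x : R) :
  0 < q -> zeta_num (q + 1) x = zeta_num q x - (x - 1) * Rpower q (- x).
Proof.
  intros Hq. unfold zeta_num.
  assert (H1 := PSeries_correct _ _ (entire_family_ex_pseries (zcoef 3) q (x - 3)
    (entire_family_zcoef 3 ltac:(lra)) Hq)).
  assert (H2 := is_pseries_mulz (3 - 1) _ _ _ (pcoef_pseries 3 q (x - 3))).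
  assert (H3 := is_pseries_minus (V := R_NormedModule) _ _ _ _ _ H1 H2).
  apply is_pseries_unique.
  replace (- x) with (- (3 + (x - 3))) by ring. replace (x - 1) with (3 - 1 + (x - 3)) by ring.
  revert H3. apply is_pseries_ext. intros k. rewrite zcoef_shift by lra. reflexivity.
Qed.

Lemma zeta_num'_shift (q x : R) :
  0 < q -> zeta_num' (q + 1) x =
    zeta_num' q x - Rpower q (- x) + (x - 1) * ln q * Rpower q (- x).
Proof.
  intros Hq. assert (Hq1 : 0 < q + 1) by lra.
  rewrite <- (is_derive_unique _ _ _ (is_derive_zeta_num (q + 1) x Hq1)).
  apply is_derive_unique.
  apply is_derive_ext with (fun x => zeta_num q x - (x - 1) * exp (- x * ln q)).
  { intros t. now rewrite zeta_num_shift. }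
  assert (H := is_derive_zeta_num q x Hq).
  unfold Rpower. auto_derive; [eexists; apply H|].
  change (fun x0 => zeta_num q x0) with (zeta_num q). rewrite (is_derive_unique _ _ _ H). ring.
Qed.

(** At x = 2 the factor x - 1 is 1 and the value is the sum of the positive numbers (n+q)^(-2); this
    sign makes [lerch] convex. *)
Lemma zeta_num_2_ge_0 (q : R) : 0 < q -> 0 <= zeta_num q 2.
Proof.
  intros Hq.
  destruct (hurwitz_Z_dirichlet 3 q (RtoC (2 - 3))) as [S [HS E]]; [lra|auto| |].
  { rewrite Cmod_R, Rabs_left; lra. }
  rewrite hurwitz_Z_real in E by lra. fold (zeta_num q 2) in E.
  replace (3 - 1 + RtoC (2 - 3))%C with (RtoC 1) in E by (rewrite RtoC_minus; ring).
  rewrite Cmult_1_l in E.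
  apply is_series_C in HS. destruct HS as [HS _]. rewrite <- E in HS. simpl in HS.
  assert (Hp : forall n, 0 <= exp (- (3 + (2 - 3)) * ln (INR n + q)) *
    cos (- (0 + 0) * ln (INR n + q))).
  { intros n. replace (- (0 + 0)) with 0 by ring. rewrite Rmult_0_l, cos_0, Rmult_1_r.
    left; apply exp_pos. }
  rewrite <- (is_series_unique _ _ HS).
  eapply Rle_trans; [apply (Hp 0%nat)|].
  rewrite <- (sum_O (G := R_AbelianMonoid)
    (fun n => exp (- (3 + (2 - 3)) * ln (INR n + q)) * cos (- (0 + 0) * ln (INR n + q)))).
  apply sum_n_le_Series; [exact Hp|eexists; apply HS].
Qed.

(** * The gamma function and Lerch's formula *)

Lemma filter_prod_0_infty (P : R * R -> Prop) (a0 b0 : R) :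
  0 < a0 -> (forall a b, 0 < a < a0 -> b0 < b -> P (a, b)) ->
  filter_prod (at_right 0) (Rbar_locally p_infty) P.
Proof.
  intros Ha H.
  apply Filter_prod with (fun a => 0 < a < a0) (fun b => b0 < b).
  - exists (mkposreal _ Ha). intros y Hy Hy0. change (Rabs (y - 0) < a0) in Hy.
    rewrite Rminus_0_r in Hy. split; auto. eapply Rle_lt_trans; [apply Rle_abs|auto].
  - exists b0. auto.
  - intros a b H1 H2. now apply H.
Qed.

(** A bounded primitive [H] of the majorant controls all integrals of [g]. As [g] is nonnegative,
    these grow with the interval, so their supremum is the limit along the product filter. *)
Lemma is_RInt_gen_nonneg_dominated (g H h : R -> R) (K : R) :
  (forall t, 0 < t -> continuous g t) -> (forall t, 0 < t -> 0 <= g t) ->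
  (forall t, 0 < t -> is_derive H t (h t)) -> (forall t, 0 < t -> continuous h t) ->
  (forall t, 0 < t -> g t <= h t) -> (forall t, 0 < t -> Rabs (H t) <= K) ->
  exists l, is_RInt_gen g (at_right 0) (Rbar_locally p_infty) l /\
    forall a b, 0 < a <= b -> RInt g a b <= l.
Proof.
  intros Cg Pg DH Ch Hgh HK.
  assert (Ig : forall a b, 0 < a -> 0 < b -> ex_RInt g a b).
  { intros a b Ha Hb. apply (ex_RInt_continuous (V := R_CompleteNormedModule)).
    intros t Ht. apply Cg. eapply Rlt_le_trans; [|apply Ht]. now apply Rmin_glb_lt. }
  assert (Hbd : forall a b, 0 < a <= b -> RInt g a b <= 2 * K).
  { intros a b Hab.
    assert (Ih : is_RInt h a b (H b - H a)).
    { apply (is_RInt_derive H h).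
      - intros t Ht. apply DH. rewrite Rmin_left in Ht; lra.
      - intros t Ht. apply Ch. rewrite Rmin_left in Ht; lra. }
    apply Rle_trans with (H b - H a).
    - apply (is_RInt_le g h a b); [lra| |auto|intros; apply Hgh; lra].
      apply (RInt_correct (V := R_CompleteNormedModule)). apply Ig; lra.
    - assert (H1 := HK a ltac:(lra)). assert (H2 := HK b ltac:(lra)).
      apply Rabs_le_between in H1. apply Rabs_le_between in H2. lra. }
  assert (Hmono : forall a a0 b0 b, 0 < a <= a0 -> a0 <= b0 <= b -> RInt g a0 b0 <= RInt g a b).
  { intros a a0 b0 b Ha Hb.
    rewrite <- (RInt_Chasles g a a0 b) by (apply Ig; lra).
    rewrite <- (RInt_Chasles g a0 b0 b) by (apply Ig; lra).
    assert (0 <= RInt g a a0) by (apply RInt_ge_0; [lra|apply Ig; lra|intros; apply Pg; lra]).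
    assert (0 <= RInt g b0 b) by (apply RInt_ge_0; [lra|apply Ig; lra|intros; apply Pg; lra]).
    unfold plus; simpl. lra. }
  destruct (completeness (fun v => exists a b, 0 < a <= b /\ v = RInt g a b)) as [l [Hl1 Hl2]].
  { exists (2 * K). intros v [a [b [Hab ->]]]. now apply Hbd. }
  { exists (RInt g 1 1), 1, 1. split; [lra|auto]. }
  assert (Hle : forall a b, 0 < a <= b -> RInt g a b <= l).
  { intros a b Hab. apply Hl1. now exists a, b. }
  exists l. split; auto.
  intros P [eps HP].
  assert (He := cond_pos eps).
  destruct (Classical_Prop.classic (exists a b, 0 < a <= b /\ l - eps < RInt g a b)) as [[a0 [b0 [Hab Hlt]]]|Hn].
  - apply filter_prod_0_infty with a0 b0; [lra|]. intros a b Ha Hb. simpl.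
    exists (RInt g a b). split.
    + apply (RInt_correct (V := R_CompleteNormedModule)). apply Ig; lra.
    + apply HP. change (Rabs (RInt g a b - l) < eps).
      assert (H1 := Hle a b ltac:(lra)). assert (H2 := Hmono a a0 b0 b ltac:(lra) ltac:(lra)).
      apply Rabs_def1; lra.
  - exfalso. assert (l <= l - eps); [|lra]. apply Hl2. intros v [a [b [Hab ->]]].
    apply Rnot_lt_le. intros Hlt. apply Hn. now exists a, b.
Qed.

Lemma ln_le_sub1 (y : R) : 0 < y -> ln y <= y - 1.
Proof.
  intros Hy. assert (H := exp_ineq1_le (ln y)). rewrite exp_ln in H by auto. lra.
Qed.

(** The inequality ln y <= y - 1 at y = (1+t)/(q+1); the point of tangency is the maximum t = q of
    (1+t)^(q+1) exp(-t). *)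
Lemma Rpower_S_le_exp (q t : R) :
  0 < q -> 0 < t -> Rpower (1 + t) (q + 1) <= Rpower (q + 1) (q + 1) * exp t.
Proof.
  intros Hq Ht. unfold Rpower. rewrite <- exp_plus.
  assert (H : ln (1 + t) <= ln (q + 1) + t / (q + 1)).
  { assert (H1 : ln ((1 + t) / (q + 1)) <= (1 + t) / (q + 1) - 1).
    { apply ln_le_sub1. apply Rdiv_lt_0_compat; lra. }
    rewrite ln_div in H1 by lra.
    assert ((1 + t) / (q + 1) - 1 <= t / (q + 1)).
    { apply Rmult_le_reg_r with (q + 1); [lra|]. 
      replace (((1 + t) / (q + 1) - 1) * (q + 1)) with (t - q) by (field; lra).
      replace (t / (q + 1) * (q + 1)) with t by (field; lra). lra. }
    lra. }
  assert (H2 : (q + 1) * ln (1 + t) <= (q + 1) * ln (q + 1) + t).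
  { apply Rle_trans with ((q + 1) * (ln (q + 1) + t / (q + 1))).
    - apply Rmult_le_compat_l; lra.
    - right. field. lra. }
  destruct H2 as [H2|H2]; [left; now apply exp_increasing|rewrite H2; lra].
Qed.

Definition gamma_integrand (q t : R) : R := Rpower t (q - 1) * exp (- t).

Lemma gamma_integrand_pos (q t : R) : 0 < gamma_integrand q t.
Proof. apply Rmult_lt_0_compat; apply exp_pos. Qed.

Lemma gamma_integrand_continuous (q t : R) : 0 < t -> continuous (gamma_integrand q) t.
Proof.
  intros Ht. apply (ex_derive_continuous (gamma_integrand q)).
  unfold gamma_integrand, Rpower. auto_derive. auto.
Qed.

(** One majorant serves both ends: C0 t^(q-1) (1+t)^(-(q+1)) is the derivative of (C0/q)
    (t/(1+t))^q, which stays between 0 and C0/q. *)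
Lemma gamma_integrable (q : R) :
  0 < q -> exists l, is_RInt_gen (gamma_integrand q) (at_right 0) (Rbar_locally p_infty) l /\
    forall a b, 0 < a <= b -> RInt (gamma_integrand q) a b <= l.
Proof.
  intros Hq. set (C0 := Rpower (q + 1) (q + 1)).
  assert (HC : 0 < C0) by apply Rpower_pos.
  assert (Hu : forall t, 0 < t -> 0 < t / (1 + t) < 1).
  { intros t Ht. split; [apply Rdiv_lt_0_compat; lra|].
    apply Rmult_lt_reg_r with (1 + t); [lra|]. unfold Rdiv. rewrite Rmult_assoc, Rinv_l; lra. }
  apply is_RInt_gen_nonneg_dominated with
    (H := fun t => C0 / q * exp (q * ln (t / (1 + t))))
    (h := fun t => C0 * Rpower t (q - 1) * Rpower (1 + t) (- (q + 1))) (K := C0 / q).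
  - intros t Ht. now apply gamma_integrand_continuous.
  - intros t Ht. left; apply gamma_integrand_pos.
  - intros t Ht. specialize (Hu t Ht).
    assert (E : C0 * Rpower t (q - 1) * Rpower (1 + t) (- (q + 1)) =
      C0 / q * (exp (q * ln (t / (1 + t))) * (q * (/ (t * (1 + t)))))).
    { unfold Rpower. rewrite ln_div by lra.
      replace ((q - 1) * ln t) with (q * ln t + - ln t) by ring.
      replace (- (q + 1) * ln (1 + t)) with (- q * ln (1 + t) + - ln (1 + t)) by ring.
      rewrite !exp_plus, !exp_Ropp, !exp_ln by lra.
      replace (q * (ln t - ln (1 + t))) with (q * ln t + - q * ln (1 + t)) by ring.
      rewrite exp_plus. field. lra. }
    rewrite E. auto_derive; [split; [lra|split; [|exact I]]; apply Hu|].
    fold (t / (1 + t)). field. lra.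
  - intros t Ht. apply (ex_derive_continuous (fun t => C0 * Rpower t (q - 1) * Rpower (1 + t) (- (q + 1)))).
    unfold Rpower. auto_derive. lra.
  - intros t Ht. unfold gamma_integrand. rewrite (Rmult_comm C0), Rmult_assoc.
    apply Rmult_le_compat_l; [left; apply Rpower_pos|].
    assert (H := Rpower_S_le_exp q t Hq Ht). fold C0 in H.
    rewrite Rpower_Ropp, exp_Ropp.
    assert (H1 := Rpower_pos (1 + t) (q + 1)). assert (H2 := exp_pos t).
    apply Rmult_le_reg_r with (exp t * Rpower (1 + t) (q + 1)); [nra|].
    replace (/ exp t * (exp t * Rpower (1 + t) (q + 1))) with (Rpower (1 + t) (q + 1)) by (field; lra).
    replace (C0 * / Rpower (1 + t) (q + 1) * (exp t * Rpower (1 + t) (q + 1))) with (C0 * exp t) by (field; lra).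
    exact H.
  - intros t Ht. specialize (Hu t Ht).
    assert (Hcq : 0 < C0 / q) by (now apply Rdiv_lt_0_compat).
    assert (H1 := exp_pos (q * ln (t / (1 + t)))).
    rewrite Rabs_pos_eq by nra.
    assert (exp (q * ln (t / (1 + t))) <= 1).
    { apply Rle_trans with (exp 0); [|rewrite exp_0; lra]. left. apply exp_increasing.
      assert (ln (t / (1 + t)) < 0) by (rewrite <- ln_1; apply ln_increasing; apply Hu). nra. }
    nra.
Qed.

Lemma is_Gamma (q : R) :
  0 < q -> is_RInt_gen (gamma_integrand q) (at_right 0) (Rbar_locally p_infty) (Gamma q).
Proof.
  intros Hq. destruct (gamma_integrable q Hq) as [l [Hl _]].
  apply (RInt_gen_correct (V := R_CompleteNormedModule) (gamma_integrand q)). now exists l.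
Qed.

Lemma Gamma_pos (q : R) : 0 < q -> 0 < Gamma q.
Proof.
  intros Hq. destruct (gamma_integrable q Hq) as [l [Hl Hb]].
  assert (E : Gamma q = l) by (apply (is_RInt_gen_unique (V := R_CompleteNormedModule) _ _ Hl)).
  rewrite E. apply Rlt_le_trans with (RInt (gamma_integrand q) 1 2); [|apply Hb; lra].
  apply RInt_gt_0; [lra| |].
  - intros; apply gamma_integrand_pos.
  - intros t Ht. apply gamma_integrand_continuous; lra.
Qed.

Lemma gamma_boundary_0 (q : R) :
  0 < q -> filterlim (fun t => - (exp (q * ln t) * exp (- t))) (at_right 0) (locally 0).
Proof.
  intros Hq. apply filterlim_locally. intros eps.
  assert (He := cond_pos eps).
  (* The radius is eps^(1/q), so that t^q stays below eps. *)
  exists (mkposreal _ (exp_pos (/ q * ln eps))). intros t Ht Ht0.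
  change (Rabs (t - 0) < exp (/ q * ln eps)) in Ht. rewrite Rminus_0_r, Rabs_pos_eq in Ht by lra.
  change (Rabs (- (exp (q * ln t) * exp (- t)) - 0) < eps).
  rewrite Rminus_0_r, Rabs_Ropp.
  assert (H1 := exp_pos (q * ln t)). assert (H2 := exp_pos (- t)).
  rewrite Rabs_pos_eq by nra.
  assert (exp (- t) <= 1) by (rewrite <- exp_0; left; apply exp_increasing; lra).
  assert (exp (q * ln t) < eps).
  { rewrite <- (exp_ln eps) by auto. apply exp_increasing.
    apply ln_increasing in Ht; auto. rewrite ln_exp in Ht.
    apply (Rmult_lt_compat_l q) in Ht; auto. rewrite <- Rmult_assoc, Rinv_r, Rmult_1_l in Ht by lra. auto. }
  nra.
Qed.

Lemma gamma_boundary_infty (q : R) :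
  0 < q -> filterlim (fun t => - (exp (q * ln t) * exp (- t))) (Rbar_locally p_infty) (locally 0).
Proof.
  intros Hq. apply filterlim_locally. intros eps.
  assert (He := cond_pos eps). set (C0 := Rpower (q + 1) (q + 1)).
  assert (HC : 0 < C0) by apply Rpower_pos.
  (* From t^(q+1) <= (1+t)^(q+1) <= C0 exp t follows t^q exp(-t) <= C0/t, whence this threshold. *)
  exists (C0 / eps). intros t Ht.
  assert (Ht0 : 0 < t) by (eapply Rlt_trans; [|apply Ht]; now apply Rdiv_lt_0_compat).
  change (Rabs (- (exp (q * ln t) * exp (- t)) - 0) < eps).
  rewrite Rminus_0_r, Rabs_Ropp.
  assert (H1 := exp_pos (q * ln t)). assert (H2 := exp_pos (- t)).
  rewrite Rabs_pos_eq by nra.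
  assert (H := Rpower_S_le_exp q t Hq Ht0). fold C0 in H.
  assert (H3 : exp (q * ln t) * t <= Rpower (1 + t) (q + 1)).
  { unfold Rpower. rewrite <- (exp_ln t) at 2 by auto. rewrite <- exp_plus.
    assert (ln t < ln (1 + t)) by (apply ln_increasing; lra).
    left. apply exp_increasing. nra. }
  assert (H4 : exp t * exp (- t) = 1) by (rewrite <- exp_plus, Rplus_opp_r; apply exp_0).
  apply Rmult_lt_reg_r with t; auto.
  apply Rle_lt_trans with C0.
  - replace (exp (q * ln t) * exp (- t) * t) with (exp (q * ln t) * t * exp (- t)) by ring.
    apply Rle_trans with (C0 * exp t * exp (- t)); [apply Rmult_le_compat_r; lra|].
    rewrite Rmult_assoc, H4. lra.
  - apply (Rmult_lt_compat_r eps) in Ht; auto. unfold Rdiv in Ht.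
    rewrite Rmult_assoc, Rinv_l, Rmult_1_r in Ht; lra.
Qed.

(** Integration by parts as the integral of the derivative of -t^q exp(-t), whose limits at 0 and at
    infinity are both 0. *)
Lemma Gamma_succ (q : R) : 0 < q -> Gamma (q + 1) = q * Gamma q.
Proof.
  intros Hq.
  set (f := fun t => - (exp (q * ln t) * exp (- t))).
  set (g := fun t => minus (scal q (gamma_integrand q t)) (gamma_integrand (q + 1) t)).
  assert (Df : forall t, 0 < t -> is_derive f t (- g t)).
  { intros t Ht. unfold f, g, gamma_integrand, Rpower, minus, plus, opp, scal; simpl. unfold mult; simpl.
    replace (q + 1 - 1) with q by ring.
    replace ((q - 1) * ln t) with (q * ln t + - ln t) by ring. rewrite exp_plus, exp_Ropp, exp_ln by auto.
    auto_derive; auto. field. lra. }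
  assert (HR : filter_prod (at_right 0) (Rbar_locally p_infty)
    (fun ab => forall x, Rmin (fst ab) (snd ab) <= x <= Rmax (fst ab) (snd ab) -> 0 < x)).
  { apply filter_prod_0_infty with 1 1; [lra|]. intros a b Ha Hb x Hx. simpl in Hx.
    rewrite Rmin_left in Hx; lra. }
  assert (HD : is_RInt_gen (Derive f) (at_right 0) (Rbar_locally p_infty) (0 - 0)).
  { apply is_RInt_gen_Derive; try typeclasses eauto.
    - revert HR. apply filter_imp. intros ab H x Hx. eexists; apply Df, H, Hx.
    - revert HR. apply filter_imp. intros ab H x Hx.
      specialize (H x Hx).
      apply (continuous_ext_loc _ (fun t => - g t)).
      + exists (mkposreal x H). intros y Hy. change (Rabs (y - x) < x) in Hy. apply Rabs_def2 in Hy.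
        symmetry. apply is_derive_unique, Df; lra.
      + apply (continuous_opp (V := R_NormedModule) g), (continuous_minus (V := R_NormedModule)).
        * apply (continuous_scal_r (V := R_NormedModule)), gamma_integrand_continuous, H.
        * apply gamma_integrand_continuous, H.
    - apply gamma_boundary_0, Hq.
    - apply gamma_boundary_infty, Hq. }
  assert (HG : is_RInt_gen g (at_right 0) (Rbar_locally p_infty) (minus (scal q (Gamma q)) (Gamma (q + 1)))).
  { apply (is_RInt_gen_minus (V := R_NormedModule) (fun t => scal q (gamma_integrand q t))).
    - apply (is_RInt_gen_scal (V := R_NormedModule)), is_Gamma, Hq.
    - apply is_Gamma; lra. }
  apply (is_RInt_gen_opp (V := R_NormedModule)) in HG.
  assert (HG' : is_RInt_gen (Derive f) (at_right 0) (Rbar_locally p_infty)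
    (opp (minus (scal q (Gamma q)) (Gamma (q + 1))))).
  { revert HG. apply (is_RInt_gen_ext (V := R_NormedModule)).
    revert HR. apply filter_imp. intros ab H x Hx. symmetry. apply is_derive_unique, Df, H. lra. }
  apply (is_RInt_gen_unique (V := R_CompleteNormedModule)) in HG'.
  apply (is_RInt_gen_unique (V := R_CompleteNormedModule)) in HD.
  rewrite HG' in HD. unfold minus, plus, opp, scal in HD; simpl in HD. unfold mult in HD; simpl in HD. lra.
Qed.

(** The bounds ln y <= y - 1 at u/v and at 1/v, averaged with weights x and 1 - x, have right-hand
    side 0, [v] being the weighted mean of [u] and 1. *)
Lemma Rpower_weighted (u x : R) : 0 < u -> 0 <= x <= 1 -> Rpower u x <= 1 - x + x * u.
Proof.
  intros Hu Hx. set (v := 1 - x + x * u).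
  assert (Hv : 0 < v) by (unfold v; destruct (Req_dec x 0) as [->|]; nra).
  assert (H1 := ln_le_sub1 (u / v) ltac:(now apply Rdiv_lt_0_compat)).
  assert (H2 := ln_le_sub1 (1 / v) ltac:(apply Rdiv_lt_0_compat; lra)).
  rewrite ln_div in H1, H2 by lra. rewrite ln_1 in H2.
  assert (H3 : x * (u / v) + (1 - x) * (1 / v) = 1) by (unfold v; field; fold v; lra).
  assert (H : x * ln u <= ln v) by nra.
  unfold Rpower. rewrite <- (exp_ln v) by auto.
  destruct H as [H|H]; [left; now apply exp_increasing|rewrite H; lra].
Qed.

(** Log-convexity without Hoelder's inequality: [Rpower_weighted] at u = t/p is integrated, and
    dividing t by p makes the two resulting integrals add up to exactly p^x Gamma(p), since
    Gamma(p+1)/p = Gamma(p). *)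
Lemma Gamma_add_le (p x : R) : 0 < p -> 0 <= x <= 1 -> Gamma (p + x) <= Rpower p x * Gamma p.
Proof.
  intros Hp Hx.
  set (g := fun t => plus (scal (Rpower p x * (1 - x)) (gamma_integrand p t))
     (scal (Rpower p x * x / p) (gamma_integrand (p + 1) t))).
  assert (Hg : is_RInt_gen g (at_right 0) (Rbar_locally p_infty)
    (plus (scal (Rpower p x * (1 - x)) (Gamma p)) (scal (Rpower p x * x / p) (Gamma (p + 1))))).
  { apply (is_RInt_gen_plus (V := R_NormedModule) (fun t => scal (Rpower p x * (1 - x)) (gamma_integrand p t))).
    - apply (is_RInt_gen_scal (V := R_NormedModule)), is_Gamma, Hp.
    - apply (is_RInt_gen_scal (V := R_NormedModule)), is_Gamma; lra. }
  assert (Hle : norm (Gamma (p + x)) <=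
    plus (scal (Rpower p x * (1 - x)) (Gamma p)) (scal (Rpower p x * x / p) (Gamma (p + 1)))).
  { apply (RInt_gen_norm (V := R_CompleteNormedModule) (Fa := at_right 0) (Fb := Rbar_locally p_infty)
      (gamma_integrand (p + x)) g); auto.
    - apply filter_prod_0_infty with 1 1; [lra|]. intros a b Ha Hb. simpl. lra.
    - apply filter_prod_0_infty with 1 1; [lra|]. intros a b Ha Hb t Ht. simpl in Ht.
      change (Rabs (gamma_integrand (p + x) t) <= g t).
      rewrite Rabs_pos_eq by (left; apply gamma_integrand_pos).
      assert (Ht0 : 0 < t) by lra.
      unfold g, gamma_integrand, plus, scal; simpl. unfold mult; simpl.
      assert (H := Rpower_weighted (t / p) x ltac:(now apply Rdiv_lt_0_compat) Hx).
      assert (E1 : Rpower t (p + x - 1) = Rpower t (p - 1) * (Rpower p x * Rpower (t / p) x)).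
      { rewrite <- Rpower_mult_base by (auto; now apply Rdiv_lt_0_compat).
        replace (p * (t / p)) with t by (field; lra). rewrite <- Rpower_plus. f_equal; ring. }
      assert (E2 : Rpower t (p + 1 - 1) = Rpower t (p - 1) * t).
      { rewrite <- (Rpower_1 t) at 3 by auto. rewrite <- Rpower_plus. f_equal; ring. }
      rewrite E1, E2.
      assert (P1 := Rpower_pos t (p - 1)). assert (P2 := Rpower_pos p x). assert (P3 := exp_pos (- t)).
      apply Rle_trans with (Rpower t (p - 1) * (Rpower p x * (1 - x + x * (t / p))) * exp (- t)).
      + apply Rmult_le_compat_r; [lra|]. apply Rmult_le_compat_l; [lra|]. apply Rmult_le_compat_l; lra.
      + right. field. lra.
    - apply is_Gamma; lra. }
  change (Rabs (Gamma (p + x)) <= Rpower p x * (1 - x) * Gamma p + Rpower p x * x / p * Gamma (p + 1)) in Hle.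
  rewrite Gamma_succ in Hle by auto.
  eapply Rle_trans; [apply Rle_abs|]. eapply Rle_trans; [apply Hle|]. right. field. lra.
Qed.

Lemma is_derive_eq (f : R -> R) (x l l' : R) : is_derive f x l -> l = l' -> is_derive f x l'.
Proof. now intros H <-. Qed.

(* The derivative of zeta(x,q) in [x] at [x = 0]. *)
Definition lerch (q : R) : R := - zeta_num' q 0 - zeta_num q 0.

(** The two contributions of Z(1,q) cancel. *)
Lemma lerch_derive (q : R) : 0 < q -> is_derive lerch q (- zeta_num' q 1).
Proof.
  intros Hq.
  assert (H1 := is_derive_opp _ _ _ (zeta_num'_dq q 0 Hq)).
  assert (H := is_derive_minus _ _ _ _ _ H1 (zeta_num_dq q 0 Hq)).
  rewrite Rplus_0_l in H. unfold minus, plus, opp in H; simpl in H.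
  apply (is_derive_eq _ _ _ _ H). ring.
Qed.

Lemma lerch_succ (q : R) : 0 < q -> lerch (q + 1) = lerch q + ln q.
Proof.
  intros Hq. unfold lerch. rewrite zeta_num_shift, zeta_num'_shift by auto.
  rewrite Ropp_0, Rpower_O by auto. ring.
Qed.

(** At x = 1 the term with the factor x - 1 drops out of [zeta_num'_dq], leaving Z(2,q) as
    derivative. *)
Lemma neg_zeta_num'_1_incr (x y : R) : 0 < x <= y -> - zeta_num' x 1 <= - zeta_num' y 1.
Proof.
  intros Hxy.
  assert (D : forall q, 0 < q -> is_derive (fun q => - zeta_num' q 1) q (zeta_num q 2)).
  { intros q Hq. assert (H := is_derive_opp _ _ _ (zeta_num'_dq q 1 Hq)).
    unfold opp in H; simpl in H. replace (1 + 1) with 2 in H by ring.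
    apply (is_derive_eq _ _ _ _ H). ring. }
  destruct (MVT_gen (fun q => - zeta_num' q 1) x y (fun q => zeta_num q 2)) as [xi [Hxi E]].
  - intros t Ht. apply D. rewrite Rmin_left in Ht; lra.
  - intros t Ht. eapply is_derive_continuity_pt, D. rewrite Rmin_left in Ht; lra.
  - rewrite Rmin_left in Hxi by lra.
    assert (H := zeta_num_2_ge_0 xi ltac:(lra)). nra.
Qed.

Lemma lerch_mvt (x y : R) : 0 < x < y ->
  exists xi, x <= xi <= y /\ lerch y - lerch x = - zeta_num' xi 1 * (y - x).
Proof.
  intros Hxy. destruct (MVT_gen lerch x y (fun q => - zeta_num' q 1)) as [xi [Hxi E]].
  - intros t Ht. apply lerch_derive. rewrite Rmin_left in Ht; lra.
  - intros t Ht. eapply is_derive_continuity_pt, lerch_derive. rewrite Rmin_left in Ht; lra.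
  - exists xi. rewrite Rmin_left, Rmax_right in Hxi by lra. auto.
Qed.

(** Over [p, p+1] [lerch] grows by ln p, which is therefore a value of its increasing derivative on
    that interval. *)
Lemma neg_zeta_num'_1_le_ln (p : R) : 0 < p -> - zeta_num' p 1 <= ln p <= - zeta_num' (p + 1) 1.
Proof.
  intros Hp. destruct (lerch_mvt p (p + 1)) as [xi [Hxi E]]; [lra|].
  rewrite lerch_succ in E by auto.
  assert (E' : ln p = - zeta_num' xi 1) by lra.
  assert (H1 := neg_zeta_num'_1_incr p xi ltac:(lra)).
  assert (H2 := neg_zeta_num'_1_incr xi (p + 1) ltac:(lra)). lra.
Qed.

(** The quantity of the Bohr-Mollerup argument: it has period 1, and its oscillation over [p, p+1]
    tends to 0 as p grows, so it is constant. *)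
Definition lngamma_defect (q : R) : R := ln (Gamma q) - lerch q.

Lemma lngamma_defect_periodic (n : nat) (q : R) :
  0 < q -> lngamma_defect (q + INR n) = lngamma_defect q.
Proof.
  intros Hq. induction n; [simpl; f_equal; ring|].
  rewrite S_INR, <- IHn. rewrite <- Rplus_assoc. pose proof (pos_INR n).
  unfold lngamma_defect. rewrite Gamma_succ, lerch_succ by lra.
  rewrite ln_mult; [ring|lra|apply Gamma_pos; lra].
Qed.

(** Over [p, p+x] both ln Gamma and [lerch] grow by x ln p up to an error of order 1/p. For Gamma
    the lower bound is [Gamma_add_le] run from p + x to p + 1; for [lerch] it is
    [neg_zeta_num'_1_le_ln] one unit to the left, which brings in ln(p-1). *)
Lemma lngamma_defect_increment (p x : R) :
  1 < p -> 0 <= x <= 1 -> Rabs (lngamma_defect (p + x) - lngamma_defect p) <= / (p - 1).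
Proof.
  intros Hp Hx.
  assert (Hip : 0 < / (p - 1)) by (apply Rinv_0_lt_compat; lra).
  destruct (Req_dec x 0) as [->|Hx0].
  { rewrite Rplus_0_r, Rminus_diag, Rabs_R0. lra. }
  assert (G1 := Gamma_pos p ltac:(lra)). assert (G2 := Gamma_pos (p + x) ltac:(lra)).
  assert (U : ln (Gamma (p + x)) - ln (Gamma p) <= x * ln p).
  { assert (H := ln_le _ _ G2 (Gamma_add_le p x ltac:(lra) Hx)).
    rewrite ln_mult in H by (auto; apply Rpower_pos). unfold Rpower in H. rewrite ln_exp in H. lra. }
  assert (Lw : ln p - (1 - x) * ln (p + x) <= ln (Gamma (p + x)) - ln (Gamma p)).
  { assert (H := Gamma_add_le (p + x) (1 - x) ltac:(lra) ltac:(lra)).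
    replace (p + x + (1 - x)) with (p + 1) in H by ring. rewrite Gamma_succ in H by lra.
    apply ln_le in H; [|nra]. rewrite !ln_mult in H by (try apply Rpower_pos; lra).
    unfold Rpower in H. rewrite ln_exp in H. lra. }
  destruct (lerch_mvt p (p + x)) as [xi [Hxi E]]; [lra|].
  replace (p + x - p) with x in E by ring.
  assert (B1 := proj1 (neg_zeta_num'_1_le_ln xi ltac:(lra))).
  assert (B1' := ln_le xi (p + x) ltac:(lra) ltac:(lra)).
  assert (B2 := proj2 (neg_zeta_num'_1_le_ln (xi - 1) ltac:(lra))).
  replace (xi - 1 + 1) with xi in B2 by ring.
  assert (B2' := ln_le (p - 1) (xi - 1) ltac:(lra) ltac:(lra)).
  unfold lngamma_defect.
  assert (T1 : ln p - ln (p - 1) <= / (p - 1)).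
  { rewrite <- ln_div by lra. eapply Rle_trans; [apply ln_le_sub1, Rdiv_lt_0_compat; lra|].
    right. field. lra. }
  assert (T2 : ln (p + x) - ln p <= / (p - 1)).
  { rewrite <- ln_div by lra. eapply Rle_trans; [apply ln_le_sub1, Rdiv_lt_0_compat; lra|].
    apply Rle_trans with (/ p).
    - replace ((p + x) / p - 1) with (x * / p) by (field; lra).
      assert (0 < / p) by (apply Rinv_0_lt_compat; lra). nra.
    - apply Rinv_le_contravar; lra. }
  apply Rabs_le. split; nra.
Qed.

(** By periodicity the increment may be measured from p + n, where the bound 1/(p+n-1) is
    arbitrarily small. *)
Lemma lngamma_defect_const (p x : R) :
  0 < p -> 0 <= x <= 1 -> lngamma_defect (p + x) = lngamma_defect p.
Proof.
  intros Hp Hx. apply Rminus_diag_uniq.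
  destruct (Req_dec (lngamma_defect (p + x) - lngamma_defect p) 0) as [|Hn]; auto. exfalso.
  set (e := Rabs (lngamma_defect (p + x) - lngamma_defect p)).
  assert (He : 0 < e) by now apply Rabs_pos_lt.
  assert (Hie : 0 < / e) by now apply Rinv_0_lt_compat.
  destruct (INR_unbounded (/ e + 1)) as [n Hn'].
  assert (H := lngamma_defect_increment (p + INR n) x ltac:(lra) Hx).
  replace (p + INR n + x) with (p + x + INR n) in H by ring.
  rewrite !lngamma_defect_periodic in H by lra. fold e in H.
  assert (/ (p + INR n - 1) < e); [|lra].
  rewrite <- (Rinv_inv e). apply Rinv_lt_contravar; [|lra]. apply Rmult_lt_0_compat; lra.
Qed.

Lemma digamma_eq (q : R) : 0 < q -> digamma q = - zeta_num' q 1.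
Proof.
  intros Hq. apply is_derive_unique.
  apply is_derive_ext_loc with (fun x => lerch x + lngamma_defect q).
  (* The radius is at most 1 for [lngamma_defect_const] and at most [q] to stay among positive
     arguments. *)
  - assert (Hd : 0 < Rmin 1 q) by (apply Rmin_pos; lra).
    exists (mkposreal _ Hd). intros y Hy. change (Rabs (y - q) < Rmin 1 q) in Hy.
    pose proof (Rmin_l 1 q). pose proof (Rmin_r 1 q). apply Rabs_def2 in Hy.
    assert (E : lngamma_defect y = lngamma_defect q).
    { destruct (Rle_dec q y).
      - replace y with (q + (y - q)) by ring. apply lngamma_defect_const; lra.
      - symmetry. replace q with (y + (q - y)) by ring. apply lngamma_defect_const; lra. }
    rewrite <- E. unfold lngamma_defect. apply Rplus_minus.
  - replace (- zeta_num' q 1) with (plus (- zeta_num' q 1) 0) by apply Rplus_0_r.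
    apply (is_derive_plus lerch (fun _ => lngamma_defect q)); [now apply lerch_derive|].
    apply (is_derive_const (V := R_NormedModule) (lngamma_defect q)).
Qed.

(** * Bernoulli polynomials *)

(* [bern_coef k] is B_k(0) / k!.  The first argument of [bern_upto] is fuel that
   makes the course-of-values recursion structural. *)
Fixpoint bern_upto (n k : nat) : R :=
  match n with
  | O => 1
  | S m => if (k <=? m)%nat then bern_upto m k
           else - sum_f_R0 (fun i => bern_upto m i / INR (fact (S (S m) - i))) m
  end.

Definition bern_coef (k : nat) : R := bern_upto k k.

Lemma bern_upto_eq (n k : nat) : (k <= n)%nat -> bern_upto n k = bern_coef k.
Proof.
  intros H. induction n.
  - now replace k with 0%nat by lia.
  - destruct (Nat.eq_dec k (S n)) as [->|Hk]; [reflexivity|].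
    simpl. destruct (Nat.leb_spec k n); [apply IHn; lia|lia].
Qed.

(** The coefficient of t^(m+1) in the product of the generating series with (exp t - 1)/t is 0; this
    is solved for its last term, whose denominator is 1!. *)
Lemma bern_coef_S (m : nat) :
  bern_coef (S m) = - sum_f_R0 (fun i => bern_coef i / INR (fact (S (S m) - i))) m.
Proof.
  unfold bern_coef at 1. cbn [bern_upto].
  destruct (Nat.leb_spec (S m) m) as [H|H]; [lia|]. f_equal.
  apply sum_eq. intros i Hi. now rewrite bern_upto_eq.
Qed.

Lemma pow2_le_fact_S (k : nat) : 2 ^ k <= INR (fact (S k)).
Proof.
  induction k; [simpl; lra|].
  rewrite fact_simpl, mult_INR. simpl pow.
  assert (2 <= INR (S (S k))) by (rewrite !S_INR; pose proof (pos_INR k); lra).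
  apply Rmult_le_compat; try lra. apply pow_le; lra.
Qed.

(** Since 1/(j+1)! <= 2^(-j), the recursion bounds the next coefficient by 1/2 + 1/4 + ... < 1. The
    resulting radius 1 is below the true 2 pi but covers a punctured neighbourhood of 0. *)
Lemma bern_coef_bound (k : nat) : Rabs (bern_coef k) <= 1.
Proof.
  induction k as [k IH] using lt_wf_ind. destruct k as [|m].
  - unfold bern_coef; simpl. rewrite Rabs_R1; lra.
  - rewrite bern_coef_S, Rabs_Ropp.
    eapply Rle_trans; [apply Rsum_abs|].
    apply Rle_trans with (sum_f_R0 (fun i => (1 / 2) ^ (S m - i)) m).
    + apply sum_Rle. intros i Hi.
      unfold Rdiv at 1. rewrite Rabs_mult, (Rabs_pos_eq (/ _)) by (left; apply Rinv_0_lt_compat, INR_fact_pos).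
      replace (S (S m) - i)%nat with (S (S m - i)) by lia.
      assert (H := pow2_le_fact_S (S m - i)).
      assert (H2 : 0 < 2 ^ (S m - i)) by (apply pow_lt; lra).
      assert (H3 : / INR (fact (S (S m - i))) <= (1 / 2) ^ (S m - i)).
      { replace ((1 / 2) ^ (S m - i)) with (/ 2 ^ (S m - i)).
        - apply Rinv_le_contravar; auto.
        - rewrite <- pow_inv. f_equal. field. }
      assert (H4 := IH i ltac:(lia)). assert (H5 := Rabs_pos (bern_coef i)).
      assert (0 < / INR (fact (S (S m - i)))) by (apply Rinv_0_lt_compat, INR_fact_pos).
      nra.
    + assert (E : sum_f_R0 (fun i => (1 / 2) ^ (S m - i)) m = 1 - (1 / 2) ^ S m).
      { clear IH. induction m; [simpl; lra|].
        rewrite tech5. rewrite (sum_eq _ (fun i => (1 / 2) ^ (S m - i) * (1 / 2))).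
        - rewrite <- scal_sum, IHm. replace (S (S m) - S m)%nat with 1%nat by lia. simpl. field.
        - intros i Hi. replace (S (S m) - i)%nat with (S (S m - i)) by lia. simpl. ring. }
      rewrite E. pose proof (pow_le (1 / 2) (S m)). lra.
Qed.

Lemma CV_radius_ge_of_bound (a : nat -> R) (r B : R) :
  (forall k, Rabs (a k * r ^ k) <= B) -> Rbar_le r (CV_radius a).
Proof. intros H. apply (proj1 (CV_radius_bounded a)). now exists B. Qed.

Lemma bern_coef_CV (t : R) : Rabs t < 1 -> Rbar_lt (Rabs t) (CV_radius bern_coef).
Proof.
  intros Ht. apply Rbar_lt_le_trans with 1; [exact Ht|].
  apply CV_radius_ge_of_bound with 1. intros k. rewrite pow1, Rmult_1_r. apply bern_coef_bound.
Qed.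

Definition expcoef (q : R) (k : nat) : R := q ^ k / INR (fact k).

Lemma expcoef_CV (q : R) : CV_radius (expcoef q) = p_infty.
Proof.
  apply CV_radius_infinite. intros r Hr. exists (exp (Rabs q * r)). intros k.
  apply exp_coef_bound; auto; [rewrite RPow_abs; lra|apply Rabs_pos].
Qed.

Lemma expcoef_pseries (q t : R) : is_pseries (expcoef q) t (exp (q * t)).
Proof.
  assert (H := is_exp_Reals (q * t)). apply is_pseries_R in H.
  apply is_pseries_R. revert H. apply is_series_ext. intros k. unfold expcoef, Rdiv.
  rewrite Rpow_mult_distr. change (/ INR (fact k) * (q ^ k * t ^ k) = q ^ k * / INR (fact k) * t ^ k). ring.
Qed.

(** Coefficients of (exp t - 1)/t, the reciprocal of the series with coefficients [bern_coef]. *)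
Definition expm1coef (k : nat) : R := / INR (fact (S k)).

Lemma expm1coef_CV : CV_radius expm1coef = p_infty.
Proof.
  assert (H : CV_radius (PS_decr_1 (expcoef 1)) = p_infty) by (rewrite CV_radius_decr_1; apply expcoef_CV).
  rewrite <- H. apply CV_radius_ext. intros k. unfold PS_decr_1, expcoef, expm1coef. rewrite pow1. 
  unfold Rdiv. now rewrite Rmult_1_l.
Qed.

Lemma expm1coef_PSeries (t : R) : t * PSeries expm1coef t = exp t - 1.
Proof.
  assert (E := PSeries_decr_1 (expcoef 1) t ltac:(eexists; apply expcoef_pseries)).
  rewrite (is_pseries_unique _ _ _ (expcoef_pseries 1 t)), Rmult_1_l in E.
  rewrite (PSeries_ext expm1coef (PS_decr_1 (expcoef 1))).
  - rewrite E. unfold expcoef; simpl. field.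
  - intros k. unfold PS_decr_1, expcoef, expm1coef. rewrite pow1. unfold Rdiv. now rewrite Rmult_1_l.
Qed.

Lemma bern_coef_PSeries (t : R) :
  Rabs t < 1 -> t <> 0 -> PSeries bern_coef t = t / (exp t - 1).
Proof.
  intros Ht Ht0.
  assert (Hm : PSeries bern_coef t * PSeries expm1coef t = 1).
  { rewrite <- PSeries_mult; [|now apply bern_coef_CV|rewrite expm1coef_CV; exact I].
    unfold PSeries. rewrite (Series_ext _ (fun k => match k with O => 1 | S _ => 0 end)).
    - rewrite Series_incr_1.
      + rewrite (Series_ext _ (fun k => 0 * 0)) by (intros; ring). rewrite Series_scal_l. ring.
      + apply ex_series_incr_1. exists 0. apply filterlim_ext with (fun _ => 0).
        { intros n. rewrite sum_n_const. ring. } apply filterlim_const.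
    - intros [|m].
      + unfold PS_mult, bern_coef, expm1coef; simpl. field.
      + unfold PS_mult. rewrite tech5, bern_coef_S, Nat.sub_diag.
        replace (expm1coef 0) with 1 by (unfold expm1coef; simpl; field).
        rewrite (sum_eq _ (fun i => bern_coef i / INR (fact (S (S m) - i)))); [ring|].
        intros i Hi. unfold expm1coef, Rdiv. do 3 f_equal. now replace (S (S m - i))%nat with (S (S m) - i)%nat by lia. }
  assert (E := expm1coef_PSeries t).
  assert (HQ : PSeries expm1coef t <> 0) by (intros H0; rewrite H0, Rmult_0_r in Hm; lra).
  rewrite <- E. apply Rmult_eq_reg_r with (PSeries expm1coef t); auto.
  rewrite Hm. field. auto.
Qed.

Lemma exp_minus_1_neq_0 (t : R) : t <> 0 -> exp t - 1 <> 0.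
Proof.
  intros Ht E. apply Ht. apply exp_inv. rewrite exp_0. lra.
Qed.

Definition bern_gen_coef (q : R) : nat -> R := PS_mult bern_coef (expcoef q).

Lemma bern_gen_pseries (q t : R) :
  Rabs t < 1 -> t <> 0 ->
  is_pseries (bern_gen_coef q) t (t * exp (q * t) / (exp t - 1)).
Proof.
  intros Ht Ht0.
  replace (t * exp (q * t) / (exp t - 1)) with (t / (exp t - 1) * exp (q * t))
    by (field; now apply exp_minus_1_neq_0).
  rewrite <- bern_coef_PSeries by auto.
  apply is_pseries_mult.
  - apply PSeries_correct, CV_radius_inside, bern_coef_CV, Ht.
  - apply expcoef_pseries.
  - now apply bern_coef_CV.
  - rewrite expcoef_CV. exact I.
Qed.

Lemma is_bernoulli_seq_bern_gen (q : R) :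
  is_bernoulli_seq q (fun k => INR (fact k) * bern_gen_coef q k).
Proof.
  exists (mkposreal 1 Rlt_0_1). intros t Ht Ht0.
  change (Rabs (t - 0) < 1) in Ht. rewrite Rminus_0_r in Ht.
  assert (H := bern_gen_pseries q t Ht Ht0). revert H. apply is_pseries_ext. intros k.
  change (bern_gen_coef q k = INR (fact k) * bern_gen_coef q k / INR (fact k)).
  field. apply INR_fact_neq_0.
Qed.

(** The complex statement on accumulating zeros, applied along the positive real axis. *)
Lemma pseries_R_unique (a b : nat -> R) (f : R -> R) :
  locally' 0 (fun t => is_pseries a t (f t)) -> locally' 0 (fun t => is_pseries b t (f t)) ->
  forall k, a k = b k.
Proof.
  intros [d1 H1] [d2 H2] k. apply Rminus_diag_uniq. apply RtoC_inj.
  revert k. apply (pseries_C_zero (fun k => RtoC (a k - b k))). intros eps He.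
  set (t := Rmin eps (Rmin d1 d2) / 2).
  assert (Hd1 := cond_pos d1). assert (Hd2 := cond_pos d2).
  assert (Hm : 0 < Rmin eps (Rmin d1 d2)) by (repeat apply Rmin_pos; auto).
  assert (Ht : 0 < t) by (unfold t; lra).
  assert (Hlt : t < eps /\ t < d1 /\ t < d2).
  { pose proof (Rmin_l eps (Rmin d1 d2)). pose proof (Rmin_r eps (Rmin d1 d2)).
    pose proof (Rmin_l d1 d2). pose proof (Rmin_r d1 d2). unfold t. lra. }
  exists (RtoC t). repeat split.
  - intros E; apply RtoC_inj in E; lra.
  - rewrite Cmod_R, Rabs_pos_eq; lra.
  - apply (is_pseries_RtoC (fun k => a k - b k) t 0).
    assert (B1 : is_pseries a t (f t)).
    { apply H1; [|lra]. change (Rabs (t - 0) < d1). rewrite Rminus_0_r, Rabs_pos_eq; lra. }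
    assert (B2 : is_pseries b t (f t)).
    { apply H2; [|lra]. change (Rabs (t - 0) < d2). rewrite Rminus_0_r, Rabs_pos_eq; lra. }
    assert (B3 := is_pseries_minus (V := R_NormedModule) a b t _ _ B1 B2).
    replace 0 with (@plus R_NormedModule (f t) (opp (f t))) by apply Rplus_opp_r.
    exact B3.
Qed.

Lemma bernoulli_poly_eq_gen (k : nat) (q : R) :
  bernoulli_poly k q = INR (fact k) * bern_gen_coef q k.
Proof.
  assert (H : is_bernoulli_seq q (epsilon (inhabits (fun _ : nat => 0)) (is_bernoulli_seq q))).
  { apply epsilon_spec. eexists. apply is_bernoulli_seq_bern_gen. }
  assert (H2 := is_bernoulli_seq_bern_gen q).
  assert (E := pseries_R_unique _ _ _ H H2 k). simpl in E.
  unfold bernoulli_poly. pose proof (INR_fact_neq_0 k).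
  apply (f_equal (fun v => v * INR (fact k))) in E. field_simplify in E; auto.
Qed.

Lemma expcoef_is_derive (k : nat) (q : R) :
  is_derive (fun q => expcoef q (S k)) q (expcoef q k).
Proof.
  assert (H := is_derive_pow (fun t => t) (S k) q 1 (is_derive_id q)).
  assert (H2 := is_derive_scal _ _ (/ INR (fact (S k))) _ H).
  apply is_derive_ext with (fun t => / INR (fact (S k)) * t ^ S k).
  { intros t. apply Rmult_comm. }
  apply (is_derive_eq _ _ _ _ H2). unfold expcoef.
  rewrite fact_simpl, mult_INR. simpl Init.Nat.pred.
  field. split; [apply INR_fact_neq_0|apply not_0_INR; lia].
Qed.

Lemma is_derive_sum_f_R0 (f g : nat -> R -> R) (n : nat) (x : R) :
  (forall k, (k <= n)%nat -> is_derive (f k) x (g k x)) ->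
  is_derive (fun y => sum_f_R0 (fun k => f k y) n) x (sum_f_R0 (fun k => g k x) n).
Proof.
  intros H. induction n; simpl.
  - apply H; lia.
  - apply (is_derive_plus (fun y => sum_f_R0 (fun k => f k y) n)); [apply IHn; intros; apply H; lia|apply H; lia].
Qed.

Lemma bern_gen_is_derive (k : nat) (q : R) :
  is_derive (fun q => bern_gen_coef q (S k)) q (bern_gen_coef q k).
Proof.
  unfold bern_gen_coef, PS_mult.
  apply is_derive_ext with (fun q => sum_f_R0 (fun i => bern_coef i * expcoef q (S k - i)) k + bern_coef (S k)).
  { intros y. rewrite tech5, Nat.sub_diag. replace (expcoef y 0) with 1 by (unfold expcoef; simpl; field).
    now rewrite Rmult_1_r. }
  replace (sum_f_R0 (fun i => bern_coef i * expcoef q (k - i)) k)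
    with (plus (sum_f_R0 (fun i => bern_coef i * expcoef q (k - i)) k) 0) by apply Rplus_0_r.
  apply (is_derive_plus (fun q => sum_f_R0 (fun i => bern_coef i * expcoef q (S k - i)) k)).
  - apply (is_derive_sum_f_R0 (fun i q => bern_coef i * expcoef q (S k - i))
      (fun i q => bern_coef i * expcoef q (k - i))).
    intros i Hi. apply (is_derive_scal (fun q => expcoef q (S k - i))).
    replace (S k - i)%nat with (S (k - i)) by lia. apply expcoef_is_derive.
  - apply (is_derive_const (V := R_NormedModule) (bern_coef (S k))).
Qed.

(** The generating functions differ by t exp(qt), whose coefficients are those of exp(qt) shifted by
    one. *)
Lemma bern_gen_shift (k : nat) (q : R) :
  bern_gen_coef (q + 1) (S k) - bern_gen_coef q (S k) = expcoef q k.
Proof.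
  change (expcoef q k) with (PS_incr_1 (expcoef q) (S k)).
  change (bern_gen_coef (q + 1) (S k) - bern_gen_coef q (S k))
    with (PS_minus (bern_gen_coef (q + 1)) (bern_gen_coef q) (S k)).
  generalize (S k). apply pseries_R_unique with (fun t => t * exp (q * t)).
  - exists (mkposreal 1 Rlt_0_1). intros t Ht Ht0.
    change (Rabs (t - 0) < 1) in Ht. rewrite Rminus_0_r in Ht.
    assert (H := is_pseries_minus (V := R_NormedModule) _ _ _ _ _
      (bern_gen_pseries (q + 1) t Ht Ht0) (bern_gen_pseries q t Ht Ht0)).
    replace (t * exp (q * t)) with
      (plus (t * exp ((q + 1) * t) / (exp t - 1)) (opp (t * exp (q * t) / (exp t - 1)))); auto.
    change (t * exp ((q + 1) * t) / (exp t - 1) + - (t * exp (q * t) / (exp t - 1)) = t * exp (q * t)).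
    rewrite Rmult_plus_distr_r, Rmult_1_l, exp_plus. field. now apply exp_minus_1_neq_0.
  - exists (mkposreal 1 Rlt_0_1). intros t _ _.
    apply (is_pseries_incr_1 (V := R_NormedModule) (expcoef q) t). apply expcoef_pseries.
Qed.

(** This is (Z(1-j,q) - B_j(q)) / j!; the division by j! lets d/dq lower [j] without a factor. *)
Definition bern_defect (j : nat) (q : R) : R :=
  zeta_num q (1 - INR j) / INR (fact j) - bern_gen_coef q j.

Lemma bern_defect_periodic (j : nat) (q : R) : 0 < q -> bern_defect j (q + 1) = bern_defect j q.
Proof.
  intros Hq. unfold bern_defect. rewrite zeta_num_shift by auto.
  destruct j as [|j].
  - unfold bern_gen_coef, PS_mult, expcoef; simpl. field.
  - assert (H := bern_gen_shift j q). unfold expcoef in H.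
    rewrite fact_simpl, mult_INR, S_INR.
    replace (- (1 - (INR j + 1))) with (INR j) by ring. rewrite Rpower_pow by auto.
    replace (bern_gen_coef (q + 1) (S j)) with (bern_gen_coef q (S j) + q ^ j / INR (fact j)) by lra.
    field. split; [apply INR_fact_neq_0|]. pose proof (pos_INR j); lra.
Qed.

Lemma bern_defect_is_derive_S (j : nat) (q : R) :
  0 < q -> is_derive (bern_defect (S j)) q (bern_defect j q).
Proof.
  intros Hq. unfold bern_defect.
  assert (H1 := zeta_num_dq q (1 - INR (S j)) Hq).
  assert (H2 := is_derive_scal _ _ (/ INR (fact (S j))) _ H1).
  assert (H3 := is_derive_minus _ _ _ _ _ H2 (bern_gen_is_derive j q)).
  apply is_derive_ext with (fun q => / INR (fact (S j)) * zeta_num q (1 - INR (S j)) - bern_gen_coef q (S j)).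
  { intros t. unfold Rdiv. now rewrite Rmult_comm. }
  apply (is_derive_eq _ _ _ _ H3).
  change (/ INR (fact (S j)) * - ((1 - INR (S j) - 1) * zeta_num q (1 - INR (S j) + 1)) - bern_gen_coef q j =
    zeta_num q (1 - INR j) / INR (fact j) - bern_gen_coef q j).
  rewrite fact_simpl, mult_INR, S_INR. replace (1 - (INR j + 1) + 1) with (1 - INR j) by ring.
  field. split; [apply INR_fact_neq_0|]. pose proof (pos_INR j); lra.
Qed.

Lemma bern_defect_0_is_derive (q : R) : 0 < q -> is_derive (bern_defect 0) q 0.
Proof.
  intros Hq. assert (H1 := zeta_num_dq q (1 - INR 0) Hq).
  apply is_derive_ext with (fun q => zeta_num q (1 - INR 0) - 1).
  { intros t. unfold bern_defect, bern_gen_coef, PS_mult, bern_coef, expcoef; simpl. field. }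
  assert (H2 := is_derive_minus _ _ _ _ _ H1 (is_derive_const (V := R_NormedModule) 1 q)).
  apply (is_derive_eq _ _ _ _ H2). unfold minus, plus, opp, zero; simpl. ring.
Qed.

(** Suppose D_i = [bern_defect i] has derivative 0. Since D_(i+1) is periodic with derivative D_i,
    Rolle's theorem gives a zero of D_i, and a constant with a zero vanishes. Then D_(i+1) has
    derivative 0 as well, which drives the induction. *)
Lemma bern_defect_eq_0 (j : nat) (q : R) : 0 < q -> bern_defect j q = 0.
Proof.
  intros Hq. revert q Hq.
  assert (Hz : forall j, (forall q, 0 < q -> is_derive (bern_defect j) q 0) ->
    forall q, 0 < q -> bern_defect j q = 0).
  { intros i Hi q Hq.
    destruct (MVT_gen (bern_defect (S i)) q (q + 1) (bern_defect i)) as [xi [Hxi E]].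
    - intros t Ht. apply bern_defect_is_derive_S. rewrite Rmin_left in Ht; lra.
    - intros t Ht. eapply is_derive_continuity_pt, bern_defect_is_derive_S. rewrite Rmin_left in Ht; lra.
    - rewrite bern_defect_periodic in E by auto. rewrite Rmin_left, Rmax_right in Hxi by lra.
      assert (E0 : bern_defect i xi = 0) by lra.
      destruct (MVT_gen (bern_defect i) q xi (fun _ => 0)) as [eta [_ E2]].
      + intros t Ht. apply Hi. rewrite Rmin_left in Ht; lra.
      + intros t Ht. eapply is_derive_continuity_pt, Hi. rewrite Rmin_left in Ht; lra.
      + lra. }
  induction j; apply Hz.
  - apply bern_defect_0_is_derive.
  - intros q Hq. rewrite <- (IHj q Hq). now apply bern_defect_is_derive_S.
Qed.

Lemma bernoulli_poly_eq (k : nat) (q : R) :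
  0 < q -> bernoulli_poly k q = zeta_num q (1 - INR k).
Proof.
  intros Hq. rewrite bernoulli_poly_eq_gen.
  assert (H := bern_defect_eq_0 k q Hq). unfold bern_defect in H.
  replace (bern_gen_coef q k) with (zeta_num q (1 - INR k) / INR (fact k)) by lra.
  field. apply INR_fact_neq_0.
Qed.

(** * The polygamma family *)

Lemma harmonic_S (k : nat) : harmonic (S k) = harmonic k + / INR (S k).
Proof. unfold harmonic. rewrite sum_n_Sm by lia. reflexivity. Qed.

Lemma harmonic_0 : harmonic 0 = 0.
Proof. unfold harmonic. rewrite sum_n_m_zero by lia. reflexivity. Qed.

(* psi^(-k); at [k = 0] this is the digamma function. *)
Definition negapolygamma_num (k : nat) (q : R) : R :=
  - / INR (fact k) * (zeta_num' q (1 - INR k) + harmonic k * zeta_num q (1 - INR k)).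

(** Write K for [S k]. The quotient rule at x - 1 = -K turns K zeta'(1-K,q) into -(Z' + Z/K), and
    the term 1/K raises H_(K-1) to H_K. *)
Lemma negapolygamma_eq (k : nat) (q : R) :
  0 < q -> negapolygamma (S k) q = negapolygamma_num (S k) q.
Proof.
  intros Hq. unfold negapolygamma, negapolygamma_num.
  rewrite negapolygamma_A_eq, bernoulli_poly_eq by (auto; lia).
  assert (Hk : 0 < INR (S k)) by (apply lt_0_INR; lia).
  set (x := 1 - INR (S k)).
  assert (H := is_derive_zeta_num q x Hq).
  assert (E : Derive (fun x => zeta_num q x / (x - 1)) x =
    (zeta_num' q x * (x - 1) - zeta_num q x) / (x - 1) ^ 2).
  { apply is_derive_unique.
    assert (Hx : x - 1 <> 0) by (unfold x; lra).
    auto_derive.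
    - split; [eexists; apply H|auto].
    - change (fun x0 => zeta_num q x0) with (zeta_num q). rewrite (is_derive_unique _ _ _ H).
      field. auto. }
  rewrite E. replace (S k - 1)%nat with k by lia. rewrite harmonic_S.
  replace (x - 1) with (- INR (S k)) by (unfold x; ring).
  field. split; [lra|apply INR_fact_neq_0].
Qed.

Lemma negapolygamma_num_0 (q : R) : 0 < q -> digamma q = negapolygamma_num 0 q.
Proof.
  intros Hq. rewrite digamma_eq by auto. unfold negapolygamma_num.
  rewrite harmonic_0. simpl. rewrite Rminus_0_r. field.
Qed.

(** With K = [S k] and x - 1 = -K, differentiating Z' leaves an additional -Z(x+1,q), which lowers
    H_K by 1/K; the common factor K turns 1/K! into 1/k!. *)
Lemma negapolygamma_num_is_derive (k : nat) (q : R) :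
  0 < q -> is_derive (negapolygamma_num (S k)) q (negapolygamma_num k q).
Proof.
  intros Hq. unfold negapolygamma_num. set (x := 1 - INR (S k)).
  assert (H1 := zeta_num'_dq q x Hq).
  assert (H2 := is_derive_scal _ _ (harmonic (S k)) _ (zeta_num_dq q x Hq)).
  assert (H3 := is_derive_scal _ _ (- / INR (fact (S k))) _ (is_derive_plus _ _ _ _ _ H1 H2)).
  apply (is_derive_eq _ _ _ _ H3).
  change (- / INR (fact (S k)) * (- (zeta_num q (x + 1) + (x - 1) * zeta_num' q (x + 1)) +
     harmonic (S k) * - ((x - 1) * zeta_num q (x + 1))) =
   - / INR (fact k) * (zeta_num' q (1 - INR k) + harmonic k * zeta_num q (1 - INR k))).
  replace (x + 1) with (1 - INR k) by (unfold x; rewrite S_INR; ring).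
  replace (x - 1) with (- INR (S k)) by (unfold x; ring).
  rewrite harmonic_S, fact_simpl, mult_INR. field.
  split; [apply INR_fact_neq_0|apply not_0_INR; lia].
Qed.

(** Since Z(m+2,q) = (m+1) zeta(m+2,q), the second case is the classical (-1)^(n+1) n! zeta(n+1,q)
    for n = m + 1. *)
Definition polygamma_num (n : nat) (q : R) : R :=
  match n with
  | O => - zeta_num' q 1
  | S m => (-1) ^ m * INR (fact m) * zeta_num q (INR m + 2)
  end.

Lemma polygamma_num_is_derive (n : nat) (q : R) :
  0 < q -> is_derive (polygamma_num n) q (polygamma_num (S n) q).
Proof.
  intros Hq. destruct n as [|m]; unfold polygamma_num.
  - apply (is_derive_eq _ _ _ _ (is_derive_opp _ _ _ (zeta_num'_dq q 1 Hq))).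
    change (- - (zeta_num q (1 + 1) + (1 - 1) * zeta_num' q (1 + 1)) =
      (-1) ^ 0 * INR (fact 0) * zeta_num q (INR 0 + 2)).
    simpl. replace (1 + 1) with (0 + 2) by ring. ring.
  - apply (is_derive_eq _ _ _ _ (is_derive_scal _ _ ((-1) ^ m * INR (fact m)) _ (zeta_num_dq q (INR m + 2) Hq))).
    rewrite fact_simpl, mult_INR, S_INR. replace (INR m + 2 + 1) with (INR m + 1 + 2) by ring.
    simpl pow. ring.
Qed.

Lemma locally_pos (q : R) : 0 < q -> locally q (fun y => 0 < y).
Proof.
  intros Hq. exists (mkposreal q Hq). intros y Hy. change (Rabs (y - q) < q) in Hy.
  apply Rabs_def2 in Hy. lra.
Qed.

Lemma Derive_n_digamma (n : nat) (q : R) : 0 < q -> Derive_n digamma n q = polygamma_num n q.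
Proof.
  revert q. induction n; intros q Hq; [now apply digamma_eq|].
  simpl Derive_n. rewrite <- (is_derive_unique _ _ _ (polygamma_num_is_derive n q Hq)).
  apply Derive_ext_loc. generalize (locally_pos q Hq). apply filter_imp. exact IHn.
Qed.

Lemma polygamma_of_nat (n : nat) (q : R) : polygamma (Z.of_nat n) q = Derive_n digamma n q.
Proof.
  destruct n as [|n]; [reflexivity|]. simpl Z.of_nat. cbv [polygamma].
  now rewrite SuccNat2Pos.id_succ.
Qed.

Lemma polygamma_opp_of_nat_S (n : nat) (q : R) :
  polygamma (- Z.of_nat (S n)) q = negapolygamma (S n) q.
Proof. simpl Z.of_nat. cbv [polygamma Z.opp]. now rewrite SuccNat2Pos.id_succ. Qed.

Lemma polygamma_is_derive (k : Z) (q : R) :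
  0 < q -> is_derive (polygamma k) q (polygamma (k + 1) q).
Proof.
  intros Hq. assert (Hloc := locally_pos q Hq).
  destruct (Z_lt_le_dec k 0) as [Hk|Hk].
  - replace k with (- Z.of_nat (S (Z.to_nat (- k - 1))))%Z by lia.
    set (n := Z.to_nat (- k - 1)).
    apply is_derive_ext_loc with (negapolygamma_num (S n)).
    + revert Hloc. apply filter_imp. intros y Hy.
      now rewrite polygamma_opp_of_nat_S, negapolygamma_eq.
    + apply (is_derive_eq _ _ _ _ (negapolygamma_num_is_derive n q Hq)).
      (* For k = -1 the derivative leaves the negative family and has to be [digamma] itself. *)
      destruct n as [|n].
      * simpl. symmetry. now apply negapolygamma_num_0.
      * replace (- Z.of_nat (S (S n)) + 1)%Z with (- Z.of_nat (S n))%Z by lia.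
        now rewrite polygamma_opp_of_nat_S, negapolygamma_eq.
  - replace k with (Z.of_nat (Z.to_nat k)) by lia. set (n := Z.to_nat k).
    apply is_derive_ext_loc with (polygamma_num n).
    + revert Hloc. apply filter_imp. intros y Hy.
      now rewrite polygamma_of_nat, Derive_n_digamma.
    + apply (is_derive_eq _ _ _ _ (polygamma_num_is_derive n q Hq)).
      replace (Z.of_nat n + 1)%Z with (Z.of_nat (S n)) by lia.
      now rewrite polygamma_of_nat, Derive_n_digamma.
Qed.

(** * Integration by parts *)

Lemma antiderivative_term_is_derive (n m j : nat) (a b q : R) :
  b <> 0 -> 0 < a + b * q ->
  is_derive (fun x => (-1) ^ j / (b ^ (j + 1) * INR (fact (n - j))) * x ^ (n - j) *
      polygamma (Z.of_nat m - Z.of_nat j - 1) (a + b * x)) q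
    ((-1) ^ j / (b ^ (j + 1) * INR (fact (n - j))) *
     (INR (n - j) * q ^ pred (n - j) * polygamma (Z.of_nat m - Z.of_nat j - 1) (a + b * q) +
      b * q ^ (n - j) * polygamma (Z.of_nat m - Z.of_nat j) (a + b * q))).
Proof.
  intros Hb Hpos.
  assert (H := polygamma_is_derive (Z.of_nat m - Z.of_nat j - 1) _ Hpos).
  replace (Z.of_nat m - Z.of_nat j - 1 + 1)%Z with (Z.of_nat m - Z.of_nat j)%Z in H by lia.
  set (psi := polygamma (Z.of_nat m - Z.of_nat j - 1)) in *.
  set (c := (-1) ^ j / (b ^ (j + 1) * INR (fact (n - j)))).
  (* Keeping [psi] and [c] abstract lets [auto_derive] treat [psi] as an unknown differentiable
     function. *)
  clearbody psi c. auto_derive.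
  - eexists; apply H.
  - change (fun x => psi x) with psi. rewrite (is_derive_unique _ _ _ H). ring.
Qed.

Theorem theorem4p2 (n m : nat) (a b : R) (lo hi : Rbar)
  (hm : (1 <= m)%nat) (hb : b <> 0)
  (hI : forall q : R, Rbar_lt lo q -> Rbar_lt q hi -> 0 < a + b * q) :
  forall q : R, Rbar_lt lo q -> Rbar_lt q hi ->
    is_derive
      (fun x : R =>
         INR (fact n) *
         sum_n (fun j : nat =>
           (-1) ^ j / (b ^ (j + 1) * INR (fact (n - j))) * x ^ (n - j) *
           polygamma (Z.of_nat m - Z.of_nat j - 1) (a + b * x)) n)
      q
      (q ^ n * polygamma (Z.of_nat m) (a + b * q)).
Proof.
  intros q Hlo Hhi. assert (Hpos := hI q Hlo Hhi).
  (* The derivative of the partial sum up to [J] telescopes to the integrand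
     plus one remaining term, which vanishes for [J = n]. *)
  assert (Htel : forall J, (J <= n)%nat ->
    is_derive (fun x => sum_n (fun j =>
        (-1) ^ j / (b ^ (j + 1) * INR (fact (n - j))) * x ^ (n - j) *
        polygamma (Z.of_nat m - Z.of_nat j - 1) (a + b * x)) J) q
      (q ^ n * polygamma (Z.of_nat m) (a + b * q) / INR (fact n) +
       (-1) ^ J / (b ^ (J + 1) * INR (fact (n - J))) *
       (INR (n - J) * q ^ pred (n - J) * polygamma (Z.of_nat m - Z.of_nat J - 1) (a + b * q)))).
  { induction J as [|J IH]; intros HJ.
    - apply is_derive_ext with (fun x => (-1) ^ 0 / (b ^ (0 + 1) * INR (fact (n - 0))) * x ^ (n - 0) *
        polygamma (Z.of_nat m - Z.of_nat 0 - 1) (a + b * x)).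
      { intros t. now rewrite sum_O. }
      apply (is_derive_eq _ _ _ _ (antiderivative_term_is_derive n m 0 a b q hb Hpos)).
      rewrite Nat.sub_0_r. replace (Z.of_nat m - Z.of_nat 0)%Z with (Z.of_nat m) by lia.
      simpl (0 + 1)%nat. rewrite pow_1. simpl ((-1) ^ 0).
      field. split; [apply INR_fact_neq_0|auto].
    - eapply is_derive_ext.
      { intros t. symmetry. apply sum_Sn. }
      apply (is_derive_eq _ _ _ _ (is_derive_plus _ _ _ _ _ (IH ltac:(lia))
        (antiderivative_term_is_derive n m (S J) a b q hb Hpos))).
      (* The leftover term of index J has the factor (n-J)/(n-J)! = 1/(n-J-1)!, and the term of
         index J + 1 contributes the same with opposite sign, one power of [b] cancelling. *)
      replace (n - J)%nat with (S (n - S J)) by lia.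
      replace (Z.of_nat m - Z.of_nat (S J))%Z with (Z.of_nat m - Z.of_nat J - 1)%Z by lia.
      set (N := (n - S J)%nat). rewrite (fact_simpl N), mult_INR. simpl pred.
      match goal with |- plus ?u ?v = _ => change (plus u v) with (u + v) end.
      replace (S J + 1)%nat with (S (J + 1)) by lia.
      rewrite <- (tech_pow_Rmult b), <- (tech_pow_Rmult (-1)).
      field. repeat split; auto using INR_fact_neq_0, pow_nonzero. apply not_0_INR; lia. }
  assert (H := is_derive_scal _ _ (INR (fact n)) _ (Htel n (le_n n))).
  apply (is_derive_eq _ _ _ _ H). rewrite Nat.sub_diag. change (INR 0) with 0.
  field. repeat split; auto using INR_fact_neq_0, pow_nonzero.
Qed.
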